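(* Let $G$ be an $m$-dimensional complex Lie group with identity element $e$ and holomorphic Lie algebra $\mathfrak g=T^{1,0}_eG$, and let $\Omega$ be a domain in $G$. Fix a basis $\varepsilon=(\varepsilon_1,\dots,\varepsilon_m)$ of $\mathfrak g$. Let $N$ be a compact Hermitian manifold and let $\mathscr F$ be a family of holomorphic mappings from $\Omega$ to $N$. Let $p_0\in\Omega$. Then $\mathscr F$ is not normal at $p_0$ if and only if there exist (a) a sequence $\{f_j\}_{j=1}^{+\infty}\subset\mathscr F$; (b) a sequence $\{p_j\}_{j=1}^{+\infty}\subset\Omega$ with $p_j\to p_0$ as $j\to+\infty$; (c) a sequence $\{\rho_j\}_{j=1}^{+\infty}\subset\mathbb R$ with $0<\rho_j\to 0$ as $j\to+\infty$ such that the sequence $$\phi_j(z):=f_j\circ\exp_{p_j}\big(\rho_j\,(dL_{p_j})_e(\varepsilon z^T)\big),\qquad j=1,2,\dots$$ converges uniformly on compact subsets of $\mathbb C^m$ to a nonconstant holomorphic mapping $\phi:\mathbb C^m\to N$. Here $z^T$ is the transpose of $z=(z_1,\dots,z_m)$, so that $\varepsilon z^T=\sum_{k=1}^m z_k\varepsilon_k\in\mathfrak g$.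
   Context: A complex Lie group $G$ is a complex manifold with a group structure whose multiplication and inversion are holomorphic. $T^{1,0}_gG$ denotes the holomorphic tangent space of $G$ at $g$. For $g\in G$, $L_g:G\to G$, $L_g(h)=gh$, is the left translation, and $(dL_g)_h:T^{1,0}_hG\to T^{1,0}_{gh}G$ is its differential at $h$. Exponential mapping at $g$: each $\xi\in T^{1,0}_gG$ generates a unique left-invariant holomorphic vector field $\tilde\xi$ on $G$, $\tilde\xi_h=(dL_{hg^{-1}})_g(\xi)$, with $\tilde\xi_g=\xi$. Let $\gamma_\xi:\mathbb C\to G$ be the unique holomorphic curve with $\gamma_\xi'=\tilde\xi_{\gamma_\xi}$ and $\gamma_\xi(0)=g$. Then $\exp_g:T^{1,0}_gG\to G$ is defined by $\exp_g(\xi)=\gamma_\xi(1)$; it is holomorphic. Normality: for complex manifolds $M,N$, let $\mathscr C(M,N)$ be the set of continuous mappings $M\to N$ with the compact-open topology. A family $\mathscr F\subset\mathscr C(M,N)$ is normal (on $M$) if each sequence in $\mathscr F$ contains a subsequence which is either relatively compact in $\mathscr C(M,N)$ or compactly divergent. The family is normal at a point $p_0$ if its restriction to some open neighborhood of $p_0$ is normal on that neighborhood. Convergence: $\phi_j$ is defined at those $z\in\mathbb C^m$ for which $\exp_{p_j}(\rho_j(dL_{p_j})_e(\varepsilon z^T))\in\Omega$; uniform convergence on compact subsets of $\mathbb C^m$ means that for every compact $K\subset\mathbb C^m$, $\phi_j$ is defined on $K$ for all sufficiently large $j$ and $\phi_j\to\phi$ uniformly on $K$ (with respect to a distance function on $N$).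 *)

(* Defs.v *)
From HB Require Import structures.
From mathcomp Require Import all_boot all_order all_algebra.
From mathcomp Require Import complex.
From mathcomp Require Import all_classical all_reals all_analysis.

Set Implicit Arguments.
Unset Strict Implicit.
Unset Printing Implicit Defensive.

Import Order.TTheory GRing.Theory Num.Theory numFieldNormedType.Exports.

Local Open Scope ring_scope.
Local Open Scope complex_scope.
Local Open Scope classical_set_scope.

(* [R[i]] itself carries no canonical topology; as a [numClosedFieldType] it
   inherits the one defined by the modulus. *)
Definition cplx (R : realType) : numClosedFieldType := R[i].

Section DiffNear.
Context {K : numFieldType} {V W : normedModType K}.

Lemma near_eq_differentiable (f g : V -> W) (x : V) :
  (\forall y \near x, f y = g y) -> differentiable f x ->
  differentiable g x /\ forall v, 'd g x v = 'd f x v.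
Proof.
move=> fg df.
have fgx : f x = g x by exact: nbhs_singleton fg.
have gE : g \o shift x = cst (g x) + 'd f x +o_ 0 id.
  apply/eqaddoP => e e0.
  have /eqaddoP/(_ e e0) := diff_locally df.
  apply: filter_app.
  have : \forall h \near 0, f (h + x) = g (h + x).
    by rewrite (near_shift 0 x) in fg; apply: filterS fg => h /=; rewrite subr0.
  apply: filterS => h fgh.
  by rewrite -[(_ - _) h]/(_ h - _ h) -[(_ - _) h in X in _ -> X]/(_ h - _ h)
    /= -fgh -[(cst (g x) + _) h]/(g x + _) -fgx.
have dE : 'd g x = 'd f x :> (V -> W).
  by apply: diff_unique gE; exact: diff_continuous.
split=> [|v]; last by rewrite dE.
by apply/diff_locallyP; rewrite dE; split=> //; exact: diff_continuous.
Qed.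

End DiffNear.

Lemma open_setX (S T : topologicalType) (A : set S) (B : set T) :
  open A -> open B -> open (A `*` B).
Proof.
move=> oA oB; rewrite openE => -[x y] [/= Ax By].
by exists (A, B) => //; split; exact: open_nbhs_nbhs.
Qed.

Section Atlases.
Context {R : realType}.
Local Notation C := (cplx R).

(* A chart is a homeomorphism from an open subset of [M] onto an open subset of
   [E]; both directions are total functions whose values off these open sets
   are irrelevant. *)
Record chart (E : normedModType C) (M : topologicalType) := Chart {
  chart_dom : set M;
  chart_fun :> M -> E;
  chart_inv : E -> M;
  chart_dom_open : open chart_dom;
  chart_img_open : open (chart_fun @` chart_dom);
  chart_funK : forall x, chart_dom x -> chart_inv (chart_fun x) = x;
  chart_fun_cont : forall x, chart_dom x -> {for x, continuous chart_fun};
  chart_inv_cont :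
    forall y, (chart_fun @` chart_dom) y -> {for y, continuous chart_inv} }.

(* Holomorphic = complex (Frechet) differentiable at every point of an open
   set: the domain of each transition map is open. *)
Record atlas (E : normedModType C) (M : topologicalType) := Atlas {
  charts : set (chart E M);
  atlas_cover : forall p, exists a, charts a /\ chart_dom a p;
  atlas_compat : forall a b p, charts a -> charts b ->
    chart_dom a p -> chart_dom b p ->
    differentiable (b \o chart_inv a) (a p) }.

Definition chart_at (E : normedModType C) (M : topologicalType)
  (A : atlas E M) (p : M) (a : chart E M) := charts A a /\ chart_dom a p.

Definition pref_chart (E : normedModType C) (M : topologicalType)
  (A : atlas E M) (p : M) : chart E M := projT1 (cid (atlas_cover A p)).

Lemma pref_chartP (E : normedModType C) (M : topologicalType)
  (A : atlas E M) (p : M) : chart_at A p (pref_chart A p).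
Proof. exact: (projT2 (cid (atlas_cover A p))). Qed.

Definition cdiff_at (E F : normedModType C) (M N : topologicalType)
    (A : atlas E M) (B : atlas F N) (f : M -> N) (p : M) :=
  {for p, continuous f} /\
  forall a b, chart_at A p a -> chart_at B (f p) b ->
    differentiable (b \o f \o chart_inv a) (a p).

Definition holomorphic_on (E F : normedModType C) (M N : topologicalType)
    (A : atlas E M) (B : atlas F N) (U : set M) (f : M -> N) :=
  forall p, U p -> cdiff_at A B f p.

Lemma chart_inv_near (E : normedModType C) (M : topologicalType)
    (a : chart E M) (p : M) (P : set M) :
  chart_dom a p -> (\forall q \near p, P q) ->
  \forall y \near a p, P (chart_inv a y).
Proof.
move=> ap pP; have /chart_inv_cont : (a @` chart_dom a) (a p) by exists p.
by move=> ic; apply: ic; rewrite chart_funK.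
Qed.

Section StandardAtlas.
Variable E : normedModType C.

Lemma std_chart_img_open : open (@id E @` setT).
Proof. by rewrite image_id; exact: openT. Qed.

Definition std_chart : chart E E :=
  @Chart E E setT id id openT std_chart_img_open
    (fun _ _ => erefl) (fun _ _ => @cvg_id _ _) (fun _ _ => @cvg_id _ _).

Lemma std_atlas_compat (a b : chart E E) (p : E) :
  [set std_chart] a -> [set std_chart] b -> chart_dom a p -> chart_dom b p ->
  differentiable (b \o chart_inv a) (a p).
Proof. by move=> -> -> _ _; exact: (@ex_diff _ _ _ _ _ _ id). Qed.

Definition std_atlas : atlas E E :=
  Atlas (fun p => ex_intro _ std_chart (conj erefl I)) std_atlas_compat.

End StandardAtlas.

Section ProductAtlas.
Variables (E1 E2 : normedModType C) (M1 M2 : topologicalType).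
Variables (A1 : atlas E1 M1) (A2 : atlas E2 M2).

Section ProductChart.
Variables (a1 : chart E1 M1) (a2 : chart E2 M2).
Let D := chart_dom a1 `*` chart_dom a2.
Let f (p : M1 * M2) : E1 * E2 := (a1 p.1, a2 p.2).
Let g (y : E1 * E2) : M1 * M2 := (chart_inv a1 y.1, chart_inv a2 y.2).

Lemma prod_chart_img : f @` D = (a1 @` chart_dom a1) `*` (a2 @` chart_dom a2).
Proof.
apply/seteqP; split=> [_ [[p q] [/= Dp Dq] <-]|[x y] [/= [p Dp <-] [q Dq <-]]].
  by split; [exists p | exists q].
by exists (p, q).
Qed.

Lemma prod_chart_dom_open : open D.
Proof. by apply: open_setX; exact: chart_dom_open. Qed.

Lemma prod_chart_img_open : open (f @` D).
Proof. by rewrite prod_chart_img; apply: open_setX; exact: chart_img_open. Qed.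

Lemma prod_chart_funK p : D p -> g (f p) = p.
Proof. by case: p => p q [/= Dp Dq]; rewrite /g /= !chart_funK. Qed.

Lemma prod_chart_fun_cont p : D p -> {for p, continuous f}.
Proof.
case: p => p q [/= Dp Dq]; apply: cvg_pair => /=.
  by apply: (@cvg_comp _ _ _ fst a1); [exact: cvg_fst | exact: chart_fun_cont].
by apply: (@cvg_comp _ _ _ snd a2); [exact: cvg_snd | exact: chart_fun_cont].
Qed.

Lemma prod_chart_inv_cont y : (f @` D) y -> {for y, continuous g}.
Proof.
rewrite prod_chart_img; case: y => y z [/= Dy Dz]; apply: cvg_pair => /=.
  apply: (@cvg_comp _ _ _ fst (chart_inv a1)); first exact: cvg_fst.
  exact: chart_inv_cont.
apply: (@cvg_comp _ _ _ snd (chart_inv a2)); first exact: cvg_snd.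
exact: chart_inv_cont.
Qed.

Definition prod_chart : chart (E1 * E2)%type (M1 * M2)%type :=
  Chart prod_chart_dom_open prod_chart_img_open prod_chart_funK
    prod_chart_fun_cont prod_chart_inv_cont.

End ProductChart.

Definition prod_charts : set (chart (E1 * E2)%type (M1 * M2)%type) :=
  [set c | exists a1 a2, [/\ charts A1 a1, charts A2 a2 & c = prod_chart a1 a2]].

Lemma prod_atlas_cover (p : M1 * M2) :
  exists c, prod_charts c /\ chart_dom c p.
Proof.
have [a1 [Aa1 a1p]] := atlas_cover A1 p.1.
have [a2 [Aa2 a2p]] := atlas_cover A2 p.2.
by exists (prod_chart a1 a2); split; [exists a1, a2 | split].
Qed.

Lemma prod_atlas_compat a b p : prod_charts a -> prod_charts b ->
  chart_dom a p -> chart_dom b p -> differentiable (b \o chart_inv a) (a p).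
Proof.
move=> [a1 [a2 [Aa1 Aa2 ->]]] [b1 [b2 [Ab1 Ab2 ->]]] [a1p a2p] [b1p b2p].
apply: (@differentiable_pair _ _ _ _
  ((b1 \o chart_inv a1) \o fst) ((b2 \o chart_inv a2) \o snd)).
  apply: differentiable_comp; last exact: (atlas_compat Aa1 Ab1 a1p b1p).
  by apply: linear_differentiable => x; exact: cvg_fst.
apply: differentiable_comp; last exact: (atlas_compat Aa2 Ab2 a2p b2p).
by apply: linear_differentiable => x; exact: cvg_snd.
Qed.

Definition prod_atlas : atlas (E1 * E2)%type (M1 * M2)%type :=
  Atlas prod_atlas_cover prod_atlas_compat.

End ProductAtlas.

Section TangentSpaces.
Variables (E : normedModType C) (M : topologicalType) (A : atlas E M) (p : M).

(* A tangent vector at [p] is the family of its coordinate vectors in all the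
   charts at [p], related by the differentials of the transition maps. For a
   complex manifold this is the holomorphic tangent space T^{1,0}. Charts that
   are not at [p] are assigned 0, so that Leibniz equality is the right one. *)
Definition is_tangent (v : chart E M -> E) :=
  (forall a b, chart_at A p a -> chart_at A p b ->
     v b = 'd (b \o chart_inv a) (a p) (v a)) /\
  (forall a, ~ chart_at A p a -> v a = 0).

Definition tangent_pred : {pred chart E M -> E} := fun v => `[< is_tangent v >].

Lemma tangent_submod_closed : submod_closed tangent_pred.
Proof.
split; first by apply/asboolP; split=> // a b _ _; rewrite linear0.
move=> k u v /asboolP[ut u0] /asboolP[vt v0]; apply/asboolP; split=> [a b ap bp|a ap].
  by rewrite /= -[LHS]/(k *: u b + v b) -[(k *: u + v) a]/(k *: u a + v a)
    linearP -ut// -vt.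
by rewrite -[LHS]/(k *: u a + v a) u0// v0// scaler0 addr0.
Qed.

HB.instance Definition _ :=
  GRing.isSubmodClosed.Build C (chart E M -> E) tangent_pred tangent_submod_closed.

Record tangent := Tangent {
  tangent_coord :> chart E M -> E ; _ : tangent_coord \in tangent_pred }.

HB.instance Definition _ := [isSub for tangent_coord].
HB.instance Definition _ := [Choice of tangent by <:].
HB.instance Definition _ := [SubChoice_isSubLmodule of tangent by <:].

Lemma transition_diff (a b c : chart E M) :
  chart_at A p a -> chart_at A p b -> chart_at A p c ->
  forall u, 'd (c \o chart_inv a) (a p) u =
            'd (c \o chart_inv b) (b p) ('d (b \o chart_inv a) (a p) u).
Proof.
move=> [Aa ap] [Ab bp] [Ac cp] u.
have dba := atlas_compat Aa Ab ap bp.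
have dcb := atlas_compat Ab Ac bp cp.
have bE : (b \o chart_inv a) (a p) = b p by rewrite /= chart_funK.
have dcomp : differentiable ((c \o chart_inv b) \o (b \o chart_inv a)) (a p).
  by apply: differentiable_comp => //; rewrite bE.
have nE : \forall y \near a p, ((c \o chart_inv b) \o (b \o chart_inv a)) y =
    (c \o chart_inv a) y.
  apply: (chart_inv_near (P := fun q => c (chart_inv b (b q)) = c q)) => //.
  apply: filterS (open_nbhs_nbhs (conj (chart_dom_open b) bp)) => q bq.
  by rewrite chart_funK.
have [_ dE] := near_eq_differentiable nE dcomp.
have dcb' : differentiable (c \o chart_inv b) ((b \o chart_inv a) (a p)).
  by rewrite bE.
apply: etrans (dE u) _; apply: etrans (congr1 (@^~ u) (diff_comp dba dcb')) _.
by rewrite bE.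
Qed.

Definition tangent_of_fun (a : chart E M) (u : E) (b : chart E M) : E :=
  if `[< chart_at A p a /\ chart_at A p b >]
  then 'd (b \o chart_inv a) (a p) u else 0.

Lemma tangent_of_subproof a u : tangent_of_fun a u \in tangent_pred.
Proof.
apply/asboolP; rewrite /tangent_of_fun; split=> [b c bp cp|b bp]; last first.
  by case: asboolP => // -[].
have [ap|nap] := pselect (chart_at A p a).
  by rewrite !asboolT//; exact: transition_diff.
by rewrite !asboolF ?linear0// => -[].
Qed.

(* The tangent vector at [p] with coordinate vector [u] in the chart [a]. *)
Definition tangent_of (a : chart E M) (u : E) : tangent :=
  Tangent (tangent_of_subproof a u).

Lemma tangent_ofE (a : chart E M) (u : E) :
  chart_at A p a -> tangent_of a u a = u.
Proof.
move=> ap; rewrite /= /tangent_of_fun asboolT//.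
have did : differentiable (id : E -> E) (a p) by exact: ex_diff.
have nE : \forall y \near a p, id y = (a \o chart_inv a) y.
  have [_ dap] := ap.
  have iap : (a @` chart_dom a) (a p) by exists p.
  apply: filterS (open_nbhs_nbhs (conj (chart_img_open a) iap)).
  by move=> _ [q aq <-] /=; rewrite chart_funK.
have [_ dE] := near_eq_differentiable nE did.
apply: etrans (dE u) _.
by rewrite (@diff_val _ _ _ _ _ id id).
Qed.

Definition is_basis (m : nat) (eps : 'I_m -> tangent) :=
  forall v, exists! z : 'rV[C]_m, v = \sum_(k < m) z 0 k *: eps k.

End TangentSpaces.

Section Differential.
Variables (E F : normedModType C) (M N : topologicalType).
Variables (A : atlas E M) (B : atlas F N).

(* [(df)_p] as a map T_p M -> T_q N where [q = f p]; the proof of [f p = q] only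
   fixes the type of the result. [tdiffE] shows that the charts in which the
   differential is computed are irrelevant. *)
Definition tdiff (f : M -> N) (p : M) (q : N) (fpq : f p = q)
    (v : tangent A p) : tangent B q :=
  let a := pref_chart A p in let b := pref_chart B q in
  tangent_of B q b ('d (b \o f \o chart_inv a) (a p) (v a)).

Lemma tdiffE (f : M -> N) (p : M) (q : N) (fpq : f p = q) (v : tangent A p) :
  cdiff_at A B f p -> forall a b, chart_at A p a -> chart_at B q b ->
  tdiff fpq v b = 'd (b \o f \o chart_inv a) (a p) (v a).
Proof.
case: q / fpq => -[fc fd] a b ap bq.
have a0p := pref_chartP A p; have b0q := pref_chartP B (f p).
rewrite /= /tangent_of_fun asboolT//.
set a0 := pref_chart A p in a0p *; set b0 := pref_chart B (f p) in b0q *.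
have [Aa pa] := ap; have [Aa0 pa0] := a0p.
have [Bb pb] := bq; have [Bb0 pb0] := b0q.
have /asboolP[vt _] := valP v.
have -> : v a0 = 'd (a0 \o chart_inv a) (a p) (v a) by exact: vt.
have d1 := atlas_compat Aa Aa0 pa pa0; have d2 := fd _ _ a0p b0q.
have d3 := atlas_compat Bb0 Bb pb0 pb.
have E1 : (a0 \o chart_inv a) (a p) = a0 p by rewrite /= chart_funK.
have E2 : (b0 \o f \o chart_inv a0) (a0 p) = b0 (f p) by rewrite /= chart_funK.
have d2' : differentiable (b0 \o f \o chart_inv a0) ((a0 \o chart_inv a) (a p)).
  by rewrite E1.
have d12 := differentiable_comp d1 d2'.
have E12 : ((b0 \o f \o chart_inv a0) \o (a0 \o chart_inv a)) (a p) = b0 (f p).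
  by rewrite -[LHS]/((b0 \o f \o chart_inv a0) ((a0 \o chart_inv a) (a p))) E1.
have d3' : differentiable (b \o chart_inv b0)
    (((b0 \o f \o chart_inv a0) \o (a0 \o chart_inv a)) (a p)).
  by rewrite E12.
have d123 := differentiable_comp d12 d3'.
have nE : \forall y \near a p, ((b \o chart_inv b0) \o
    ((b0 \o f \o chart_inv a0) \o (a0 \o chart_inv a))) y =
    (b \o f \o chart_inv a) y.
  apply: (chart_inv_near (P := fun q => b (chart_inv b0 (b0 (f (chart_inv a0 (a0 q)))))
    = b (f q))) => //.
  have na0 := open_nbhs_nbhs (conj (chart_dom_open a0) pa0).
  have nb0 := fc _ (open_nbhs_nbhs (conj (chart_dom_open b0) pb0)).
  by apply: filterS2 na0 nb0 => q qa0 qb0; rewrite !chart_funK.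
have [_ dE] := near_eq_differentiable nE d123.
apply/esym; apply: etrans (dE (v a)) _.
apply: etrans (congr1 (@^~ (v a)) (diff_comp d12 d3')) _; rewrite E12 /=.
congr ('d _ _ _); apply: etrans (congr1 (@^~ (v a)) (diff_comp d1 d2')) _.
by rewrite E1.
Qed.

End Differential.

End Atlases.

Definition is_domain (T : topologicalType) (U : set T) :=
  [/\ U !=set0, open U & connected U].

Record complex_structure (R : realType) (m : nat) (M : topologicalType) :=
  ComplexStructure {
    cs_atlas :> atlas ('rV[cplx R]_m) M;
    cs_hausdorff : hausdorff_space M;
    cs_second_countable : @second_countable M }.

(* Only the two underlying structures: the continuity of the group operations
   is part of [lie_mul_holomorphic] and [lie_inv_holomorphic]. *)
#[short(type="groupTopologicalType")]
HB.structure Definition GroupTopological := {G of Group G & Topological G}.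

Record complexLieGroup (R : realType) (m : nat) := ComplexLieGroup {
  lie_sort :> groupTopologicalType;
  lie_struct : complex_structure R m lie_sort;
  lie_mul_holomorphic :
    holomorphic_on (prod_atlas lie_struct lie_struct) lie_struct setT
      (fun gh : lie_sort * lie_sort => gh.1 * gh.2)%g;
  lie_inv_holomorphic :
    holomorphic_on lie_struct lie_struct setT (fun g : lie_sort => g^-1)%g }.

Section Smooth.
Context {R : realType}.

Fixpoint Ck_on (V : normedModType R) (k : nat) (U : set V) (f : V -> R) : Prop :=
  if k is k'.+1 then
    (forall x, U x -> differentiable f x) /\
    (forall v : V, Ck_on k' U ('D_v f))
  else forall x, U x -> {for x, continuous f}.

Definition smooth_on (V : normedModType R) (U : set V) (f : V -> R) :=
  forall k, Ck_on k U f.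

Definition of_real_coords (n : nat) (xy : 'rV[R]_n * 'rV[R]_n) : 'rV[cplx R]_n :=
  \row_j (xy.1 0 j +i* xy.2 0 j).

(* C^oo in the real coordinates x_j, y_j, where z_j = x_j + i y_j. *)
Definition real_smooth_on (n : nat) (U : set 'rV[cplx R]_n)
    (f : 'rV[cplx R]_n -> cplx R) :=
  let U' := @of_real_coords n @^-1` U in
  smooth_on U' (fun xy => complex.Re (f (of_real_coords xy))) /\
  smooth_on U' (fun xy => complex.Im (f (of_real_coords xy))).

End Smooth.

Record hermitian_metric (R : realType) (n : nat) (N : topologicalType)
    (B : complex_structure R n N) := HermitianMetric {
  herm :> forall q, tangent B q -> tangent B q -> cplx R;
  herm_linear : forall q (c : cplx R) (u v w : tangent B q),
    herm (c *: u + v) w = c * herm u w + herm v w;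
  herm_sym : forall q (u v : tangent B q), herm u v = Num.conj (herm v u);
  herm_pos : forall q (u : tangent B q), u != 0 -> 0 < herm u u;
  herm_smooth : forall b, charts B b -> forall u v : 'rV[cplx R]_n,
    real_smooth_on (b @` chart_dom b) (fun y =>
      herm (tangent_of B (chart_inv b y) b u) (tangent_of B (chart_inv b y) b v)) }.

Record hermitianManifold (R : realType) (n : nat) := HermitianManifold {
  hm_sort :> topologicalType;
  hm_struct : complex_structure R n hm_sort;
  hm_metric : hermitian_metric hm_struct }.

Section Exponential.
Context {R : realType} {m : nat} (G : complexLieGroup R m).
Local Notation C := (cplx R).
Local Notation A := (cs_atlas (lie_struct G)).

Definition velocity (gamma : C -> G) (t : C) : tangent A (gamma t) :=
  tdiff A (erefl (gamma t)) (tangent_of (std_atlas C) t (std_chart C) 1).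

Definition left_invariant_field (g : G) (xi : tangent A g) (h : G) : tangent A h :=
  tdiff A (divgK g h : (fun k : G => h / g * k)%g g = h) xi.

Definition is_exp_curve (g : G) (xi : tangent A g) (gamma : C -> G) :=
  [/\ holomorphic_on (std_atlas C) A setT gamma, gamma 0 = g &
      forall t, velocity gamma t = left_invariant_field xi (gamma t)].

Definition exp_curve (g : G) (xi : tangent A g) : C -> G :=
  xget (fun=> g) [set gamma | is_exp_curve xi gamma].

Definition lie_exp (g : G) (xi : tangent A g) : G := exp_curve xi 1.

Definition dL_e (p : G) : tangent A 1%g -> tangent A p :=
  tdiff A (mulg1 p : (fun k : G => p * k)%g 1%g = p).

End Exponential.

Section Normality.
Variables M N : topologicalType.

Definition relatively_compact (S : set {compact-open, M -> N}) :=
  compact (closure S `&` [set f : {compact-open, M -> N} | continuous (f : M -> N)]).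

Definition compactly_divergent (u : nat -> M -> N) :=
  forall (K : set M) (K' : set N), compact K -> compact K' ->
    \forall j \near \oo, u j @` K `&` K' = set0.

Definition normal_family (F : set (M -> N)) :=
  forall u : nat -> M -> N, (forall j, F (u j)) ->
    exists s : nat -> nat, {homo s : i j / (i < j)%N} /\
      (relatively_compact (range (u \o s)) \/ compactly_divergent (u \o s)).

End Normality.

(* [set_type U] is [U] with the subspace topology. *)
Definition normal_at (M N : topologicalType) (Omega : set M)
    (F : set (M -> N)) (p0 : M) :=
  exists U : set M, [/\ open U, U p0, U `<=` Omega &
    normal_family [set (fun x : set_type U => f (set_val x)) | f in F]].

Definition is_distance (R : realType) (T : topologicalType) (d : T -> T -> R) :=
  [/\ forall x y, 0 <= d x y,
      forall x y, d x y = 0 <-> x = y,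
      forall x y, d x y = d y x,
      forall x y z, d x z <= d x y + d y z &
      forall x (V : set T), nbhs x V <->
        exists2 e : R, 0 < e & [set y | d x y < e] `<=` V].

(* [phi_j] is a partial mapping, defined on [D j]. *)
Definition cvg_on_compacts (R : realType) (M T : topologicalType)
    (d : T -> T -> R) (D : nat -> set M) (phi_ : nat -> M -> T) (phi : M -> T) :=
  forall K : set M, compact K ->
    (\forall j \near \oo, K `<=` D j) /\
    (forall e : R, 0 < e ->
      \forall j \near \oo, forall z, K z -> d (phi_ j z) (phi z) < e).

(* Main.v *)
Require Import Defs.
From HB Require Import structures.
From mathcomp Require Import all_boot all_order all_algebra.
From mathcomp Require Import complex.
From mathcomp Require Import all_classical all_reals all_analysis.
From mathcomp Require Import ring lra.

Set Implicit Arguments.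
Unset Strict Implicit.
Unset Printing Implicit Defensive.

Import Order.TTheory GRing.Theory Num.Theory numFieldNormedType.Exports.

Local Open Scope ring_scope.
Local Open Scope complex_scope.
Local Open Scope classical_set_scope.

(** Normality is compared with the oscillation of the maps, measured with the distance
    [d] in charts of [G]. A Schwarz lemma ([schwarz]) says that there is [delta > 0] such
    that holomorphic maps into the compact manifold [N] whose oscillation on balls is
    less than [delta] form an equicontinuous family, with a scale-invariant modulus of
    continuity: such maps take their values in charts, where Cauchy's estimate holds.

    Hence, if [F] is not normal at [p0], Ascoli's theorem ([ascoli_subsequence]) shows that
    members of [F] have oscillation at least [delta] on arbitrarily small balls near the
    image of [p0] in a chart ([normal_of_small_osc]). In place of maximizing a
    derivative, as in Zalcman's lemma, one selects a point and a scale at which the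
    oscillation is large while it is small at half of that scale around all nearby
    points ([oscillation_selection]). After rescaling, the maps are equicontinuous on
    larger and larger balls, so that a subsequence converges locally uniformly; the limit
    is holomorphic, and nonconstant because its oscillation on the unit ball stays
    large ([zalcman]). To replace the affine maps of the chart by exponential mappings,
    one shows that in the chart [exp_p (rho v)] differs from [a p + rho L v] by [o(rho)] as
    [p] tends to [p0], where [L] is an isomorphism independent of [p] ([exp_asymptotics],
    [rescaled_exp]). The limit is then composed with a linear isomorphism [frame].

    Conversely, if [F] is normal on a neighborhood of [p0], compact divergence is
    excluded by the compactness of [N], and the maps of a subsequence have a continuous
    cluster map. Since the points [exp_p (rho v)] tend to [p0] for every [v], the limit of the
    rescaled maps takes a single value ([normal_limit_constant]).

    The function theory needed rests on Goursat's theorem for rectangles, with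
    primitives of continuous curves instead of integrals. In logarithmic coordinates
    around a point it gives Cauchy's estimate [cauchy_estimate] on the derivative, from
    which follow Lipschitz bounds, Weierstrass' theorem on limits of holomorphic maps
    [weierstrass] and, by Picard iteration, the differential equation
    [holomorphic_ode]. The latter gives local one-parameter subgroups of [G], extended to the
    complex line by squaring ([one_parameter_subgroup]); their left translates are the
    curves that define [lie_exp]. *)


(** * Real-valued norms on complex normed spaces *)

Section RealNorm.
Context {R : realType}.
Local Notation C := (cplx R).

Definition Rez (z : C) : R := complex.Re z.
Definition Imz (z : C) : R := complex.Im z.

Lemma RezD z w : Rez (z + w) = Rez z + Rez w.
Proof. exact: (raddfD (@complex.Re R)). Qed.

Lemma ImzD z w : Imz (z + w) = Imz z + Imz w.
Proof. exact: (raddfD (@complex.Im R)). Qed.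

Lemma RezB z w : Rez (z - w) = Rez z - Rez w.
Proof. exact: (raddfB (@complex.Re R)). Qed.

Lemma ImzB z w : Imz (z - w) = Imz z - Imz w.
Proof. exact: (raddfB (@complex.Im R)). Qed.

Lemma complex_RezImz z : z = (Rez z)%:C + 'i%C * (Imz z)%:C.
Proof. exact: (complexE (z : R[i])). Qed.

Lemma Rez_real z : z \is Num.real -> (Rez z)%:C = z.
Proof. exact: RRe_real. Qed.

(** The norm of a complex normed space takes its values in the partially ordered
    field of complex numbers; its real part is the usual norm, and all the
    estimates below are between real numbers. *)
Definition nr (E : normedModType C) (x : E) : R := Rez `|x|.

Section Basics.
Variable E : normedModType C.
Implicit Types x y z : E.

Lemma nrE x : `|x| = (nr x)%:C :> C.
Proof. by rewrite /nr Rez_real// normr_real. Qed.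

Lemma nr_ge0 x : 0 <= nr x.
Proof. by rewrite -ler0c -nrE normr_ge0. Qed.

Lemma nrD x y : nr (x + y) <= nr x + nr y.
Proof. by rewrite -lecR rmorphD/= -!nrE ler_normD. Qed.

Lemma nrN x : nr (- x) = nr x.
Proof. by rewrite /nr normrN. Qed.

Lemma nr0 : nr (0 : E) = 0.
Proof. by rewrite /nr normr0. Qed.

Lemma nr_eq0 x : nr x = 0 -> x = 0.
Proof. by move=> x0; apply/normr0_eq0; rewrite nrE x0. Qed.

Lemma nr_distC x y : nr (x - y) = nr (y - x).
Proof. by rewrite -nrN opprB. Qed.

Lemma nr_tri y x z : nr (x - z) <= nr (x - y) + nr (y - z).
Proof. by rewrite -[x - z](subrKA y) nrD. Qed.

Lemma nrB x y : nr (x - y) <= nr x + nr y.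
Proof. by rewrite -(nrN y) nrD. Qed.

Lemma nr_subD x y : nr x <= nr (x - y) + nr y.
Proof. by rewrite -{1}[x](subrK y) nrD. Qed.

Lemma nbhs_nrP x (V : set E) :
  nbhs x V <-> exists2 e : R, 0 < e & forall y, nr (y - x) < e -> V y.
Proof.
split=> [/nbhs_normP[e /= e0 eV]|[e e0 eV]].
  have eE : e = (Rez e)%:C by rewrite Rez_real// gtr0_real.
  exists (Rez e) => [|y yx]; first by move: e0; rewrite {1}eE ltcR.
  by apply: eV; rewrite /= eE nrE ltcR nr_distC.
apply/nbhs_normP; exists (e%:C); first by rewrite /= ltcR.
by move=> y /=; rewrite nrE ltcR nr_distC; exact: eV.
Qed.

Lemma nr_ball_nbhs x (e : R) : 0 < e -> \forall y \near x, nr (y - x) < e.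
Proof. by move=> e0; apply/nbhs_nrP; exists e. Qed.

Lemma open_nr_ball x (e : R) : open [set y | nr (y - x) < e].
Proof.
rewrite openE => y /= yx; apply/nbhs_nrP; exists (e - nr (y - x)).
  by rewrite subr_gt0.
by move=> z zy /=; rewrite (le_lt_trans (nr_tri y _ _))// -ltrBrDr.
Qed.

End Basics.

Lemma nrZ (E : normedModType C) (k : C) (x : E) : nr (k *: x) = nr k * nr x.
Proof. by apply: complexI; rewrite rmorphM/= -!nrE normrZ. Qed.

Lemma nrM (a b : C) : nr (a * b : C) = nr a * nr b.
Proof. by apply: complexI; rewrite rmorphM/= -!nrE normrM. Qed.

Lemma nrV (a : C) : nr (a^-1 : C) = (nr a)^-1.
Proof.
have [->|a0] := eqVneq a 0; first by rewrite invr0 nr0 invr0.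
apply: (mulfI (_ : nr a != 0)).
  by apply: contra a0 => /eqP/nr_eq0 ->.
rewrite -nrM mulfV// mulfV; first by rewrite /nr normr1.
by apply: contra a0 => /eqP/nr_eq0 ->.
Qed.

Lemma nr_eq0E (E : normedModType C) (x : E) : (nr x == 0) = (x == 0).
Proof. by apply/eqP/eqP => [/nr_eq0//|->]; rewrite nr0. Qed.

Lemma nr_gt0 (E : normedModType C) (x : E) : x != 0 -> 0 < nr x.
Proof. by move=> x0; rewrite lt_def nr_ge0 nr_eq0E x0. Qed.

Lemma nrc (z : C) : nr z = Num.sqrt (Rez z ^+ 2 + Imz z ^+ 2).
Proof. by rewrite /nr normc_def. Qed.

Lemma nr_real (r : R) : nr (r%:C : C) = `|r|.
Proof. by rewrite nrc /= expr0n addr0 sqrtr_sqr. Qed.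

Lemma Re_le_nr (z : C) : `|Rez z| <= nr z.
Proof. by rewrite nrc -sqrtr_sqr ler_sqrt ?addr_ge0 ?sqr_ge0// lerDl sqr_ge0. Qed.

Lemma nr_i : nr ('i%C : C) = 1.
Proof. by rewrite nrc /= expr0n add0r expr1n sqrtr1. Qed.

Lemma Im_le_nr (z : C) : `|Imz z| <= nr z.
Proof.
have := Re_le_nr (z * 'i%C : C); rewrite nrM nr_i mulr1.
by rewrite -[Rez _]/(complex.Re (z * 'i%C)) (ReiNIm (z : R[i])) normrN.
Qed.

Section RowVectors.
Variable n : nat.
Implicit Types x y : 'rV[C]_n.

Lemma nr_coord x i : nr (x 0 i) <= nr x.
Proof.
rewrite -lecR -!nrE [leRHS]/Num.norm/= mx_normE.
exact: (le_bigmax _ (fun i : 'I_1 * 'I_n => `|x i.1 i.2|%:nng) (0, i)).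
Qed.

Lemma nr_rV_le x (e : R) : 0 <= e -> (forall i, nr (x 0 i) <= e) -> nr x <= e.
Proof.
move=> e0 xe; rewrite -lecR -nrE [leLHS]/Num.norm/= mx_normE.
have e0C : 0 <= e%:C :> C by rewrite lecR.
rewrite -[leRHS]/((NngNum e0C)%:num) num_le; apply/bigmax_leP; split.
  by rewrite -num_le /= lecR.
by move=> [i j] _; rewrite -num_le /= !ord1 nrE lecR.
Qed.

End RowVectors.

Lemma nr_pair (E1 E2 : normedModType C) (x : E1) (y : E2) :
  nr ((x, y) : (E1 * E2)%type) = Num.max (nr x) (nr y).
Proof.
apply: complexI; rewrite -nrE prod_normE/= !nrE.
by case: (leP (nr x) (nr y)) => xy; [rewrite max_r|rewrite max_l];
  rewrite ?lecR// ltW.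
Qed.

End RealNorm.

(** * Differentiability and mean values in terms of real norms *)

Section Differentiability.
Context {R : realType}.
Local Notation C := (cplx R).
Implicit Types V W : normedModType C.

Lemma continuous_nrP V W (f : V -> W) x :
  {for x, continuous f} <-> forall e : R, 0 < e ->
    exists2 d : R, 0 < d & forall y, nr (y - x) < d -> nr (f y - f x) < e.
Proof.
split=> [fc e e0|fc A /nbhs_nrP[e e0 eA]].
  by have /nbhs_nrP := fc _ (nr_ball_nbhs (f x) e0).
have [d d0 dP] := fc _ e0.
by apply/nbhs_nrP; exists d => // y yx; apply: eA; exact: dP.
Qed.

Lemma differentiable_nr V W (f : V -> W) x : differentiable f x ->
  forall e : R, 0 < e -> exists2 d : R, 0 < d & forall y, nr (y - x) < d ->
    nr (f y - f x - 'd f x (y - x)) <= e * nr (y - x).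
Proof.
move=> fx e e0.
have /eqaddoP/(_ e%:C) := diff_locally fx.
rewrite ltcR => /(_ e0)/nbhs_nrP[d d0 dP]; exists d => // y yx.
have := dP (y - x); rewrite subr0 => /(_ yx).
rewrite -[(_ - _) (y - x)]/(f (y - x + x) - (f x + 'd f x (y - x))) subrK.
by rewrite opprD addrA !nrE -rmorphM lecR.
Qed.

Lemma diff_nr_bounded V W (f : V -> W) x : differentiable f x ->
  exists2 M : R, 0 < M & forall h, nr ('d f x h) <= M * nr h.
Proof.
move=> fx; have dc : continuous ('d f x) by exact: diff_continuous.
have /continuous_nrP := dc 0.
move=> /(_ _ ltr01)[d d0 dP]; exists (2 / d); first by rewrite divr_gt0.
move=> h; have [->|h0] := eqVneq h 0; first by rewrite linear0 !nr0 mulr0.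
have nh := nr_gt0 h0.
have := dP ((d / 2 / nr h)%:C *: h).
rewrite -linearB !subr0 linearZ/= !nrZ nr_real.
rewrite ger0_norm; last by rewrite !divr_ge0 ?nr_ge0// ltW.
rewrite divfK ?gt_eqF//.
have -> : d / 2 < d by rewrite ltr_pdivrMr// ltr_pMr// ltr1n.
move=> /(_ isT) /ltW; rewrite mulrAC ler_pdivrMr// mul1r => H.
rewrite -(ler_pM2l (_ : 0 < d / 2)) ?divr_gt0//; apply: le_trans H _.
by rewrite !mulrA divfK ?pnatr_eq0// divff ?gt_eqF// mul1r.
Qed.

Lemma nr_differentiable V W (f : V -> W) x (L : V -> W) (M : R) :
  linear L -> (forall h, nr (L h) <= M * nr h) ->
  (forall e : R, 0 < e -> exists2 d : R, 0 < d & forall y, nr (y - x) < d ->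
    nr (f y - f x - L (y - x)) <= e * nr (y - x)) ->
  differentiable f x /\ forall h, 'd f x h = L h.
Proof.
move=> Llin LM fL.
pose L' : {linear V -> W} := HB.pack L (GRing.isLinear.Build _ _ _ _ L Llin).
have Lc : continuous L'.
  move=> y; apply/continuous_nrP => e e0.
  exists (e / (`|M| + 1)); first by rewrite divr_gt0// ltr_wpDl.
  move=> z zy; rewrite -linearB (le_lt_trans (LM _))//.
  move: zy; rewrite ltr_pdivlMr ?ltr_wpDl// mulrC; apply: le_lt_trans.
  by rewrite ler_wpM2r ?nr_ge0// (le_trans (ler_norm _))// lerDl.
have fE : f \o shift x = cst (f x) + L' +o_ 0 id.
  apply/eqaddoP => e e0.
  have eE : e = (Rez e)%:C by rewrite Rez_real// gtr0_real.
  have [|d d0 dP] := fL (Rez e); first by move: e0; rewrite {1}eE ltcR.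
  apply/nbhs_nrP; exists d => // h; rewrite subr0 => hd.
  rewrite -[(_ - _) h]/(f (h + x) - (f x + L' h)) opprD addrA.
  rewrite !nrE eE -rmorphM lecR.
  by have := dP (h + x); rewrite !addrK; exact.
have dE : 'd f x = L' :> (V -> W) by apply: diff_unique fE.
split=> [|h]; last by rewrite dE.
by apply/diff_locallyP; rewrite dE.
Qed.

(** The case of one complex variable, where a differential is a multiplication. *)
Lemma nr_differentiable1 W (f : C -> W) (z : C) (l : W) :
  (forall e : R, 0 < e -> exists2 d : R, 0 < d & forall y, nr (y - z : C) < d ->
    nr (f y - f z - (y - z) *: l) <= e * nr (y - z : C)) ->
  differentiable f z /\ forall h, 'd f z h = h *: l.
Proof.
move=> fl; apply: (@nr_differentiable _ _ _ _ (fun h : C => h *: l) (nr l)) => //.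
  by move=> a u v; rewrite scalerDl scalerA.
by move=> h; rewrite nrZ mulrC.
Qed.

Lemma diff1E W (f : C -> W) (z h : C) : 'd f z h = h *: 'd f z 1.
Proof. by rewrite -linearZ/= /GRing.scale/= mulr1. Qed.

Lemma differentiable_rV V n (f : V -> 'rV[C]_n) x :
  (forall i, differentiable (fun y => f y 0 i : C) x) ->
  differentiable f x /\
  forall h i, 'd f x h 0 i = 'd (fun y => f y 0 i : C) x h.
Proof.
move=> fi; pose L h := \row_i 'd (fun y => f y 0 i : C) x h.
have Mi i : exists M : R, 0 < M /\
    forall h, nr ('d (fun y => f y 0 i : C) x h) <= M * nr h.
  by have [M] := diff_nr_bounded (fi i); exists M.
have [M MP] := choice Mi.
have [|||dd dE] := @nr_differentiable _ _ f x L (\sum_i M i).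
- by move=> a u v; apply/rowP => i; rewrite !mxE linearP.
- move=> h; have Ms0 : 0 <= \sum_i M i by apply: sumr_ge0 => i _; case/ltW: (MP i).1.
  apply: nr_rV_le => [|i]; first by rewrite mulr_ge0// nr_ge0.
  rewrite mxE (le_trans ((MP i).2 _))// ler_wpM2r ?nr_ge0//.
  by rewrite (bigD1 i)//= lerDl sumr_ge0// => j _; exact/ltW/(MP j).1.
- move=> e e0; have di i : exists d : R, 0 < d /\ forall y, nr (y - x) < d ->
      nr (f y 0 i - f x 0 i - 'd (fun y => f y 0 i : C) x (y - x) : C) <= e * nr (y - x).
    by have [d d0 dP] := differentiable_nr (fi i) e0; exists d.
  have [d dP] := choice di.
  have [D D0 DP] : exists2 D : R, 0 < D & forall i, D <= d i.
    exists (\big[Num.min/1]_i d i); last by move=> i; exact: bigmin_le_cond.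
    by apply/bigmin_gtP; split => // i _; exact: (dP i).1.
  exists D => // y yx; apply: nr_rV_le => [|i]; first by rewrite mulr_ge0 ?nr_ge0// ltW.
  by rewrite !mxE; apply: (dP i).2; exact: lt_le_trans (DP i).
- by split=> // h i; rewrite dE mxE.
Qed.

Lemma differentiable_coordE V n (f : V -> 'rV[C]_n) x i : differentiable f x ->
  differentiable (fun y => f y 0 i : C) x /\
  forall h, 'd (fun y => f y 0 i : C) x h = 'd f x h 0 i.
Proof.
move=> fx; have [M M0 MP] := diff_nr_bounded fx.
apply: (@nr_differentiable _ _ _ _ (fun h => 'd f x h 0 i : C) M).
- by move=> a u v; rewrite linearP !mxE.
- by move=> h; rewrite (le_trans (nr_coord _ _)).
move=> e e0; have [d d0 dP] := differentiable_nr fx e0; exists d => // y yx.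
rewrite (le_trans _ (dP _ yx))// (le_trans _ (nr_coord _ i))//.
by rewrite !mxE.
Qed.

End Differentiability.

(** * Curves parametrized by real intervals *)

Section RealCurves.
Context {R : realType}.
Local Notation C := (cplx R).

(** Induction on a real interval: a property that passes to the right and to
    suprema of initial segments holds on the whole interval. *)
Lemma real_induction (a b : R) (P : R -> Prop) :
  (forall t, a <= t <= b -> (forall s, a <= s -> s < t -> P s) ->
     P t /\ exists2 e : R, 0 < e & forall s, t < s -> s < t + e -> s <= b -> P s) ->
  forall t, a <= t <= b -> P t.
Proof.
move=> step t /andP[at_ tb].
have ab := le_trans at_ tb.
pose S : set R := [set t | a <= t <= b /\ forall s, a <= s <= t -> P s].
have Pa : P a by have [] := step a; rewrite ?lexx// => s /le_lt_trans h /h; rewrite ltxx.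
have Sa : S a.
  by split; [rewrite lexx|move=> s /andP[h1 h2]; have -> : s = a by apply/le_anti/andP].
have hS : has_sup S by split; [exists a|exists b => s [/andP[]]].
pose x := sup S.
have xb : x <= b by apply: ge_sup; [exists a|move=> s [/andP[]]].
have ax : a <= x by apply: ub_le_sup => //; case: hS.
have Pltx s : a <= s -> s < x -> P s.
  move=> as_ sx; have [|y [_ Sy] sy] := sup_adherent (_ : 0 < x - s) hS.
    by rewrite subr_gt0.
  by apply: Sy; rewrite as_ ltW//; move: sy; rewrite subKr.
have [|Px [e e0 eP]] := step x _ Pltx; first by rewrite ax.
have Pall s : a <= s -> s < x + e -> s <= b -> P s.
  move=> as_ se sb; have [sx|xs|->//] := ltgtP s x; first exact: Pltx.
  exact: eP.
have [xlb|] := ltP x b; last first.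
  by move=> bx; apply: Pall => //; rewrite (le_lt_trans (le_trans tb bx))// ltrDl.
pose y := Num.min b (x + e / 2).
have xy : x < y by rewrite lt_min xlb ltrDl divr_gt0.
have : S y.
  split=> [|s /andP[as_ sy]].
    by rewrite (le_trans ax (ltW xy)) ge_min lexx.
  apply: Pall => //.
    rewrite (le_lt_trans sy)// gt_min ltrD2l ltr_pdivrMr// ltr_pMr// ltr1n orbT//.
  by rewrite (le_trans sy)// ge_min lexx.
have [_ ubS] := hS.
by move=> /(ub_le_sup ubS); rewrite -/x leNgt xy.
Qed.

Section RealDerivative.
Variable W : normedModType C.
Implicit Types (u v : R -> W) (t : R).

(** [l] is the derivative at [t] of the curve [u] in a complex vector space; such
    a space is not a normed space over [R], so that the notion is spelled out. *)
Definition rder u t (l : W) := forall e : R, 0 < e ->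
  exists2 d : R, 0 < d & forall s, `|s - t| < d ->
    nr (u s - u t - (s - t)%:C *: l) <= e * `|s - t|.

Lemma rder_lip u t l : rder u t l -> forall e : R, 0 < e ->
  exists2 d : R, 0 < d & forall s, `|s - t| < d ->
    nr (u s - u t) <= (nr l + e) * `|s - t|.
Proof.
move=> ul e e0; have [d d0 dP] := ul e e0; exists d => // s /dP st.
rewrite (le_trans (nr_subD _ ((s - t)%:C *: l)))// mulrDl addrC.
by rewrite nrZ nr_real mulrC lerD2l.
Qed.

Lemma rder_eq u v t l : (forall s, u s = v s) -> rder u t l -> rder v t l.
Proof. by move=> uv; have -> : v = u by apply/funext => s; rewrite uv. Qed.

Lemma rderD u v t k l : rder u t k -> rder v t l ->
  rder (fun s => u s + v s) t (k + l).
Proof.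
move=> uk vl e e0; have e20 : 0 < e / 2 by rewrite divr_gt0.
have [d d0 dP] := uk _ e20; have [d' d'0 d'P] := vl _ e20.
exists (Num.min d d'); first by rewrite lt_min d0.
move=> s; rewrite lt_min => /andP[/dP h1 /d'P h2].
rewrite scalerDr [e]splitr mulrDl (le_trans _ (lerD h1 h2))//.
rewrite (le_trans _ (nrD _ _))// le_eqVlt; apply/orP; left; apply/eqP.
by congr nr; rewrite !opprD [X in X + _ = _]addrACA [LHS]addrACA.
Qed.

Lemma rderZ u (k : C) t l : rder u t l -> rder (fun s => k *: u s) t (k *: l).
Proof.
move=> ul e e0; have [|d d0 dP] := ul (e / (nr k + 1)).
  by rewrite divr_gt0// ltr_wpDl ?nr_ge0.
exists d => // s /dP; rewrite scalerA [_ * k]mulrC -scalerA -!scalerBr nrZ.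
rewrite mulrAC ler_pdivlMr ?ltr_wpDl ?nr_ge0// => h; rewrite (le_trans _ h)//.
by rewrite mulrC ler_wpM2l ?nr_ge0// lerDl.
Qed.

Lemma rderB u v t k l : rder u t k -> rder v t l ->
  rder (fun s => u s - v s) t (k - l).
Proof.
move=> uk /(rderZ (-1)) vl; have := rderD uk vl; rewrite scaleN1r.
by apply: rder_eq => s; rewrite scaleN1r.
Qed.

Lemma rder_scal (l : W) t : rder (fun s => s%:C *: l) t l.
Proof.
move=> e e0; exists 1 => // s _.
by rewrite rmorphB/= scalerBl subrr nr0 mulr_ge0// ltW.
Qed.

(** The inequality with a constant larger than [B] propagates along the interval, by
    [real_induction]. *)
Lemma rder_mvi u u' (a b B : R) : a <= b ->
  (forall t, a <= t <= b -> rder u t (u' t)) ->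
  (forall t, a <= t <= b -> nr (u' t) <= B) ->
  nr (u b - u a) <= B * (b - a).
Proof.
move=> ab du uB; apply/ler_addgt0Pl => eps eps0.
pose e := eps / (b - a + 1).
have ba1 : 0 < b - a + 1 by rewrite ltr_wpDl// subr_ge0.
have e0 : 0 < e by rewrite divr_gt0.
suff H t : a <= t <= b -> nr (u t - u a) <= (B + e) * (t - a).
  have /H /le_trans : a <= b <= b by rewrite ab lexx.
  apply; rewrite mulrDl addrC lerD2r /e mulrAC ler_pdivrMr//.
  by rewrite ler_pM2l// lerDl.
move: t; apply: real_induction => t tab IH.
have [d d0 dP] := rder_lip (du _ tab) e0.
have /andP[at_ tb] := tab.
have L s : `|s - t| < d -> nr (u s - u t) <= (B + e) * `|s - t|.
  by move=> /dP /le_trans; apply; rewrite ler_wpM2r// lerD2r uB.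
have Pt : nr (u t - u a) <= (B + e) * (t - a).
  have [at'|] := ltP a t; last first.
    by move=> ta; have -> : t = a; [apply/le_anti; rewrite ta|rewrite !subrr nr0 mulr0].
  pose s := Num.max a (t - d / 2).
  have st : s < t by rewrite gt_max at' ltrBlDr ltrDl divr_gt0.
  have sd : `|s - t| < d.
    rewrite ltr0_norm ?subr_lt0// opprB ltrBlDr -ltrBlDl lt_max; apply/orP; right.
    by rewrite ltrD2l ltrN2 ltr_pdivrMr// ltr_pMr// ltr1n.
  rewrite (le_trans (nr_tri (u s) _ _))// nr_distC.
  have -> : (B + e) * (t - a) = (B + e) * `|s - t| + (B + e) * (s - a).
    by rewrite ltr0_norm ?subr_lt0// -mulrDr; congr (_ * _); ring.
  by apply: lerD; [exact: L|apply: IH => //; rewrite le_max lexx].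
split=> //; exists d => // s ts sd sb.
have ->: (B + e) * (s - a) = (B + e) * `|s - t| + (B + e) * (t - a).
  by rewrite gtr0_norm ?subr_gt0// -mulrDr; congr (_ * _); ring.
rewrite (le_trans (nr_tri (u t) _ _))// lerD// L//.
by rewrite gtr0_norm ?subr_gt0// ltrBlDl.
Qed.

Lemma rder_mvi_abs u u' (a b B : R) :
  (forall t, Num.min a b <= t <= Num.max a b -> rder u t (u' t)) ->
  (forall t, Num.min a b <= t <= Num.max a b -> nr (u' t) <= B) ->
  nr (u b - u a) <= B * `|b - a|.
Proof.
have [ab|ba] := leP a b => du uB.
  by rewrite ger0_norm ?subr_ge0//; exact: rder_mvi du uB.
by rewrite nr_distC ltr0_norm ?subr_lt0// opprB; apply: rder_mvi du uB; exact: ltW.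
Qed.

End RealDerivative.

Lemma rder_line (V W : normedModType C) (f : V -> W) (x v : V) (t : R) :
  differentiable f (x + t%:C *: v) ->
  rder (fun s : R => f (x + s%:C *: v)) t ('d f (x + t%:C *: v) v).
Proof.
move=> df e e0; have nv : 0 < nr v + 1 by rewrite ltr_wpDl ?nr_ge0.
have [|d d0 dP] := differentiable_nr df (_ : 0 < e / (nr v + 1)).
  by rewrite divr_gt0.
exists (d / (nr v + 1)); first by rewrite divr_gt0.
move=> s; rewrite ltr_pdivlMr// => sd.
have E : x + s%:C *: v - (x + t%:C *: v) = (s - t)%:C *: v.
  by rewrite opprD addrACA subrr add0r -scalerBl rmorphB.
have := dP (x + s%:C *: v); rewrite E nrZ nr_real linearZ/=.
have sv : `|s - t| * nr v <= `|s - t| * (nr v + 1) by rewrite ler_wpM2l// lerDl.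
move=> /(_ (le_lt_trans sv sd)) h; rewrite (le_trans h)//.
by rewrite mulrAC ler_pdivrMr// -mulrA ler_pM2l.
Qed.

Lemma rder_near (W : normedModType C) (u v : R -> W) t l (r : R) : 0 < r ->
  (forall s, `|s - t| < r -> u s = v s) -> rder u t l -> rder v t l.
Proof.
move=> r0 uv ul e e0; have [d d0 dP] := ul e e0.
exists (Num.min r d); first by rewrite lt_min r0.
move=> s; rewrite lt_min => /andP[sr /dP]; rewrite (uv _ sr) uv//.
by rewrite subrr normr0.
Qed.

(** The fundamental theorem of calculus for the Lebesgue integral. *)
Lemma real_antiderivative (g : R -> R) (A : R) : continuous g -> 0 < A ->
  exists P : R -> R, forall t, `|t| <= A -> derivable P t 1 /\ P^`() t = g t.
Proof.
move=> gc A0; exists (fun x => Rintegral (@lebesgue_measure R) `[- A - 1, x] g).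
move=> t; rewrite ler_norml => /andP[At tA].
apply: (@continuous_FTC1_closed _ _ _ _ (A + 1)).
- by rewrite (le_lt_trans tA)// ltrDl.
- apply: continuous_compact_integrable; first exact: segment_compact.
  exact: continuous_subspaceT.
- by rewrite (lt_le_trans _ At)// ltrBlDr ltrDl.
- exact: gc.
Qed.

Lemma rder_real (P : R -> R) (t l : R) : derivable P t 1 -> P^`() t = l ->
  rder (fun s => (P s)%:C : C) t l%:C.
Proof.
move=> dP Pl e e0.
have : h^-1 *: (P (h + t) - P t) @[h --> 0^'] --> l.
  rewrite -Pl /derive1; move/cvg_ex: dP => [k kP].
  have kP' : h^-1 *: (P (h + t) - P t) @[h --> 0^'] --> k.
    by apply: cvg_trans kP; apply: near_eq_cvg; near=> h; rewrite /= [h%:A]mulr1.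
  by rewrite (cvg_lim _ kP').
move=> /cvgrPdist_le /(_ _ e0) /nbhs_ballP[d /= d0 dd].
exists d => // s; have [->|st] := eqVneq s t.
  by rewrite !subrr scale0r subrr nr0 normr0 mulr0.
move=> sd; have := dd (s - t).
rewrite /ball/= sub0r normrN subr_eq0 => /(_ sd st); rewrite subrK => H.
rewrite -!rmorphB/= -[_ *: _]/((s - t)%:C * l%:C) -rmorphM -rmorphB/= nr_real.
have st0 : s - t != 0 by rewrite subr_eq0.
have -> : P s - P t - (s - t) * l = - ((s - t) * (l - (s - t)^-1 *: (P s - P t))).
  by rewrite /GRing.scale/= mulrBr mulrA divff// mul1r opprB.
by rewrite normrN normrM mulrC ler_wpM2r.
Unshelve. all: by end_near. Qed.

Lemma Re_continuous_nr (g : R -> C) : (forall t (e : R), 0 < e ->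
    exists2 d : R, 0 < d & forall s, `|s - t| < d -> nr (g s - g t : C) < e) ->
  continuous (fun t => Rez (g t)) /\ continuous (fun t => Imz (g t)).
Proof.
move=> gc; split=> t; apply/cvgrPdist_lt => e e0; have [d d0 dP] := gc t e e0;
  apply/nbhs_ballP; exists d => // s; rewrite /ball/= => st;
  apply: le_lt_trans (dP s _); rewrite 1?distrC//.
- by rewrite (le_trans _ (Re_le_nr _))// RezB.
- by rewrite (le_trans _ (Im_le_nr _))// ImzB.
Qed.

(** Antiderivatives of continuous curves on the line. They take the place of
    integrals: additivity over intervals holds by construction, for all
    orientations of the intervals, and estimates are mean value inequalities. *)
Lemma antiderivative (g : R -> C) : (forall t (e : R), 0 < e ->
    exists2 d : R, 0 < d & forall s, `|s - t| < d -> nr (g s - g t : C) < e) ->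
  exists P : R -> C, forall t, rder P t (g t).
Proof.
move=> gc; have [c1 c2] := Re_continuous_nr gc.
have loc (A : R) : exists P : R -> C, 0 < A ->
    forall t, `|t| <= A -> rder P t (g t).
  have [A0|A0] := ltP 0 A; last by exists (fun=> 0).
  have [P1 P1E] := real_antiderivative c1 A0.
  have [P2 P2E] := real_antiderivative c2 A0.
  exists (fun t => (P1 t)%:C + 'i%C *: ((P2 t)%:C : C)) => _ t tA.
  rewrite [g t]complex_RezImz.
  apply: (@rderD _ _ _ _ ((Rez (g t))%:C : C)).
    by have [] := P1E t tA; exact: rder_real.
  have [dP2 P2t] := P2E t tA.
  exact: (@rderZ C (fun s => (P2 s)%:C : C) ('i%C : C) t _ (rder_real dP2 P2t)).
have [Q QP] := choice loc.
have Q_eq (A B x : R) : `|x| < A -> `|x| < B -> Q A x - Q A 0 = Q B x - Q B 0.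
  move=> xA xB; apply/eqP; rewrite -subr_eq0; apply/eqP/nr_eq0.
  apply/le_anti; rewrite nr_ge0 andbT.
  have A0 : 0 < A by exact: le_lt_trans xA.
  have B0 : 0 < B by exact: le_lt_trans xB.
  have := @rder_mvi_abs _ (fun s => Q A s - Q B s) (fun s => g s - g s) 0 x 0.
  rewrite mul0r => H; have {}H : nr (Q A x - Q B x - (Q A 0 - Q B 0)) <= 0.
    apply: H => t tx; last by rewrite subrr nr0.
    have tx' : `|t| <= `|x|.
      move: tx; rewrite ge_min le_max; have [x0|x0] := leP 0 x.
        rewrite (ger0_norm x0) => /andP[/orP[t0|xt] /orP[t0'|tx]];
          rewrite ?ger0_norm ?ler_norml//; lra.
      by rewrite (ltr0_norm x0) ler_norml => /andP[/orP[t0|xt] /orP[t0'|tx]]; lra.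
    by apply: rderB; apply: QP => //; exact: le_trans tx' (ltW _).
  rewrite (le_trans _ H)// le_eqVlt; apply/orP; left; apply/eqP; congr nr.
  by rewrite !opprD !opprK [RHS]addrACA.
exists (fun x => Q (`|x| + 1) x - Q (`|x| + 1) 0) => t.
have H : rder (fun s => Q (`|t| + 2) s - Q (`|t| + 2) 0) t (g t - 0).
  apply: rderB; first by apply: QP; rewrite ?ltr_wpDl// lerDl.
  by move=> e e0; exists 1 => // s _; rewrite scaler0 subr0 subrr nr0 mulr_ge0// ltW.
rewrite subr0 in H; apply: rder_near H; first exact: ltr01.
move=> s st; apply: Q_eq; last by rewrite ltrDl.
have := ler_normD (s - t) t; rewrite subrK => h; lra.
Qed.

End RealCurves.

(** * Goursat's theorem for rectangles *)

Section Goursat.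
Context {R : realType}.
Local Notation C := (cplx R).

Lemma nested_intervals (a b : nat -> R) :
  (forall k, a k <= a k.+1) -> (forall k, b k.+1 <= b k) ->
  (forall k, a k <= b k) -> exists x, forall k, a k <= x <= b k.
Proof.
move=> ai bd ab.
have am i j : (i <= j)%N -> a i <= a j.
  by apply: (homo_leq (@lexx _ R) _ (r := fun x y => x <= y)) => // y x z; exact: le_trans.
have bm i j : (i <= j)%N -> b j <= b i.
  apply: (homo_leq (@lexx _ R) _ (r := fun x y => y <= x)) => // y x z.
  by move=> ? /le_trans; apply.
have ab' i j : a i <= b j.
  have [ij|/ltnW ji] := leqP i j; first exact: le_trans (am _ _ ij) _.
  exact: le_trans (ab _) (bm _ _ ji).
exists (sup (range a)) => k; apply/andP; split.
  by apply: ub_le_sup; [exists (b 0) => _ [i _ <-]; exact: ab'|exists k].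
by apply: ge_sup; [exists (a 0), 0|move=> _ [i _ <-]; exact: ab'].
Qed.

Lemma dyadic_small (l e : R) : 0 <= l -> 0 < e ->
  exists N, forall k, (N <= k)%N -> l / 2 ^+ k < e.
Proof.
move=> l0 e0; have l10 : 0 < l + 1 by rewrite ltr_wpDl.
have /cvgrPdist_lt/(_ (e / (l + 1))) : (2^-1 : R) ^+ k @[k --> \oo] --> (0 : R).
  by apply: cvg_expr; rewrite ger0_norm ?invr_ge0// invf_lt1// ltr1n.
rewrite divr_gt0// => /(_ isT)[N _ NP]; exists N => k /NP /=.
rewrite sub0r normrN ger0_norm ?exprn_ge0 ?invr_ge0// exprVn.
rewrite ltr_pdivlMr// mulrC; apply: le_lt_trans.
by rewrite ler_wpM2r ?invr_ge0 ?exprn_ge0// lerDl.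
Qed.

Definition Cpt (x y : R) : C := x%:C + 'i%C * y%:C.

Lemma CptE (z : C) : z = Cpt (Rez z) (Imz z).
Proof. exact: complex_RezImz. Qed.

Lemma Re_Cpt x y : Rez (Cpt x y) = x.
Proof. by rewrite /Cpt /= !(mul0r, mul1r, mulr0, subr0, addr0, add0r). Qed.

Lemma Im_Cpt x y : Imz (Cpt x y) = y.
Proof. by rewrite /Cpt /= !(mul0r, mul1r, mulr0, subr0, addr0, add0r). Qed.

Lemma CptB x y x' y' : Cpt x y - Cpt x' y' = Cpt (x - x') (y - y').
Proof. by rewrite /Cpt !rmorphB/=; ring. Qed.

Lemma nr_Cpt x y : nr (Cpt x y) <= `|x| + `|y|.
Proof. by rewrite (le_trans (nrD _ _))// nrM nr_i mul1r !nr_real. Qed.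

Variable u : C -> C.
Hypothesis u_cont : continuous u.

Lemma line_cont_h y t (e : R) : 0 < e -> exists2 d : R, 0 < d &
  forall s, `|s - t| < d -> nr (u (Cpt s y) - u (Cpt t y)) < e.
Proof.
move=> e0; have /continuous_nrP/(_ _ e0)[d d0 dP] := @u_cont (Cpt t y).
exists d => // s st; apply: dP; rewrite CptB subrr.
by rewrite (le_lt_trans (nr_Cpt _ _))// normr0 addr0.
Qed.

Lemma line_cont_v x t (e : R) : 0 < e -> exists2 d : R, 0 < d &
  forall s, `|s - t| < d -> nr (u (Cpt x s) - u (Cpt x t)) < e.
Proof.
move=> e0; have /continuous_nrP/(_ _ e0)[d d0 dP] := @u_cont (Cpt x t).
exists d => // s st; apply: dP; rewrite CptB subrr.
by rewrite (le_lt_trans (nr_Cpt _ _))// normr0 add0r.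
Qed.

Definition prim_h (y : R) : R -> C := projT1 (cid (antiderivative (line_cont_h y))).
Definition prim_v (x : R) : R -> C := projT1 (cid (antiderivative (line_cont_v x))).

Lemma prim_hP y t : rder (prim_h y) t (u (Cpt t y)).
Proof. exact: (projT2 (cid (antiderivative (line_cont_h y)))). Qed.

Lemma prim_vP x t : rder (prim_v x) t (u (Cpt x t)).
Proof. exact: (projT2 (cid (antiderivative (line_cont_v x)))). Qed.

(** The integral of [u] along the boundary of a rectangle. *)
Definition bdry (a b c d : R) : C :=
  (prim_h c b - prim_h c a) - (prim_h d b - prim_h d a) +
  'i%C * ((prim_v b d - prim_v b c) - (prim_v a d - prim_v a c)).

Lemma bdry_split m k a b c d : bdry a b c d =
  bdry a m c k + bdry m b c k + bdry a m k d + bdry m b k d.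
Proof. by rewrite /bdry; ring. Qed.

Let quad (al be z0 z : C) : C := al * (z - z0) + be / 2 * (z - z0) ^+ 2.

Lemma quad_diff al be z0 z :
  differentiable (quad al be z0) z /\
  forall h, 'd (quad al be z0) z h = h *: (al + be * (z - z0)).
Proof.
apply: nr_differentiable1 => e e0.
exists (e / (nr be + 1)); first by rewrite divr_gt0// ltr_wpDl ?nr_ge0.
move=> y; rewrite ltr_pdivlMr ?ltr_wpDl ?nr_ge0// => yz.
have -> : quad al be z0 y - quad al be z0 z - (y - z) *: (al + be * (z - z0)) =
    be / 2 * (y - z) * (y - z).
  by rewrite /quad /GRing.scale/=; field.
rewrite nrM ler_wpM2r ?nr_ge0// nrM mulrC.
rewrite (le_trans _ (ltW yz))// ler_wpM2l ?nr_ge0// nrM.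
have -> : nr (2^-1 : C) = 2^-1.
  have -> : (2^-1 : C) = (2^-1 : R)%:C by rewrite fmorphV rmorph_nat.
  by rewrite nr_real ger0_norm.
have := nr_ge0 be; lra.
Qed.

Let quad_h al be z0 y t :
  rder (fun s => quad al be z0 (Cpt s y)) t (al + be * (Cpt t y - z0)).
Proof.
have E s : quad al be z0 ('i%C * y%:C + s%:C *: (1 : C)) = quad al be z0 (Cpt s y).
  by rewrite /Cpt addrC /GRing.scale/= mulr1.
have Et : 'i%C * y%:C + t%:C *: (1 : C) = Cpt t y.
  by rewrite /Cpt addrC /GRing.scale/= mulr1.
apply: rder_eq E _; have [dq dE] := quad_diff al be z0 (Cpt t y).
rewrite -Et in dq dE *.
by have := rder_line dq; rewrite dE scale1r.
Qed.

Let quad_v al be z0 x t :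
  rder (fun s => quad al be z0 (Cpt x s)) t ('i%C * (al + be * (Cpt x t - z0))).
Proof.
have E s : quad al be z0 (x%:C + s%:C *: ('i%C : C)) = quad al be z0 (Cpt x s).
  by rewrite /Cpt /GRing.scale/= [s%:C * _]mulrC.
have Et : x%:C + t%:C *: ('i%C : C) = Cpt x t.
  by rewrite /Cpt /GRing.scale/= [t%:C * _]mulrC.
apply: rder_eq E _; have [dq dE] := quad_diff al be z0 (Cpt x t).
rewrite -Et in dq dE *.
by have := rder_line dq; rewrite dE.
Qed.

(** Affine functions have vanishing boundary integrals, so that a boundary integral
    only sees the distance of [u] to an affine function. *)
Lemma bdry_affine_le (al be z0 : C) (B a b c d : R) : a <= b -> c <= d ->
  (forall x y, a <= x <= b -> c <= y <= d ->
     nr (u (Cpt x y) - (al + be * (Cpt x y - z0))) <= B) ->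
  nr (bdry a b c d) <= 2 * B * ((b - a) + (d - c)).
Proof.
move=> ab cd uB; pose q := quad al be z0.
pose Eh y := (prim_h y b - q (Cpt b y)) - (prim_h y a - q (Cpt a y)).
pose Ev x : C := ('i%C * prim_v x d - q (Cpt x d)) - ('i%C * prim_v x c - q (Cpt x c)).
have hle y : c <= y <= d -> nr (Eh y) <= B * (b - a).
  move=> ycd; apply: (@rder_mvi _ _ (fun s => prim_h y s - q (Cpt s y))
    (fun s => u (Cpt s y) - (al + be * (Cpt s y - z0)))) => // t tab.
    by apply: rderB; [exact: prim_hP|exact: quad_h].
  exact: uB.
have vle x : a <= x <= b -> nr (Ev x) <= B * (d - c).
  move=> xab; apply: (@rder_mvi _ _ (fun s => 'i%C *: prim_v x s - q (Cpt x s))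
    (fun s => 'i%C *: u (Cpt x s) - 'i%C * (al + be * (Cpt x s - z0)))) => // t tab.
    by apply: rderB; [apply: rderZ; exact: prim_vP|exact: quad_v].
  by rewrite -mulrBr nrM nr_i mul1r; exact: uB.
have -> : bdry a b c d = Eh c - Eh d + (Ev b - Ev a).
  by rewrite /bdry /Eh /Ev; ring.
have -> : 2 * B * (b - a + (d - c)) =
    (B * (b - a) + B * (b - a)) + (B * (d - c) + B * (d - c)) by ring.
rewrite (le_trans (nrD _ _))// lerD// (le_trans (nrB _ _))// lerD//.
- by apply: hle; rewrite lexx.
- by apply: hle; rewrite lexx andbT.
- by apply: vle; rewrite lexx andbT.
- by apply: vle; rewrite lexx.
Qed.

Lemma bdry_quarter (q : R * R * R * R) : exists q' : R * R * R * R,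
  let: (a, b, c, d) := q in let: (a', b', c', d') := q' in
  [/\ b' - a' = (b - a) / 2, d' - c' = (d - c) / 2,
      a <= b -> a <= a' /\ b' <= b, c <= d -> c <= c' /\ d' <= d &
      nr (bdry a b c d) <= 4 * nr (bdry a' b' c' d')].
Proof.
case: q => [[[a b] c] d]; pose m := (a + b) / 2; pose k := (c + d) / 2.
have := bdry_split m k a b c d => E.
have nE : nr (bdry a b c d) <= nr (bdry a m c k) + nr (bdry m b c k) +
    nr (bdry a m k d) + nr (bdry m b k d).
  rewrite E (le_trans (nrD _ _))// lerD2r (le_trans (nrD _ _))// lerD2r.
  exact: nrD.
have [h1|h1] := leP (nr (bdry a b c d)) (4 * nr (bdry a m c k)).
  exists (a, m, c, k); rewrite /m /k in h1 *; split => //; try (move=> ?; split); lra.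
have [h2|h2] := leP (nr (bdry a b c d)) (4 * nr (bdry m b c k)).
  exists (m, b, c, k); rewrite /m /k in h2 *; split => //; try (move=> ?; split); lra.
have [h3|h3] := leP (nr (bdry a b c d)) (4 * nr (bdry a m k d)).
  exists (a, m, k, d); rewrite /m /k in h3 *; split => //; try (move=> ?; split); lra.
exists (m, b, k, d); rewrite /m /k in nE h1 h2 h3 *.
by split; [lra|lra|move=> ?; split; lra|move=> ?; split; lra|lra].
Qed.

(** If the integral along the boundary is not [0], it is at least a quarter of its
    value on one of the four quarters of the rectangle; the rectangles obtained by
    iteration shrink to a point, where [u] is almost affine. *)
Theorem goursat (a b c d : R) : a <= b -> c <= d ->
  (forall x y, a <= x <= b -> c <= y <= d -> differentiable u (Cpt x y)) ->
  bdry a b c d = 0.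
Proof.
move=> ab cd du; apply/nr_eq0; apply: contrapT => /eqP J0.
have {}J0 : 0 < nr (bdry a b c d) by rewrite lt_def J0 nr_ge0.
have [next nextP] := choice bdry_quarter.
pose q k := iter k next (a, b, c, d).
pose qa k := (q k).1.1.1; pose qb k := (q k).1.1.2.
pose qc k := (q k).1.2; pose qd k := (q k).2.
have qE k : q k = (qa k, qb k, qc k, qd k).
  by rewrite /qa /qb /qc /qd; case: (q k) => [[[? ?] ?] ?].
have qP k : [/\ qb k.+1 - qa k.+1 = (qb k - qa k) / 2,
    qd k.+1 - qc k.+1 = (qd k - qc k) / 2,
    qa k <= qb k -> qa k <= qa k.+1 /\ qb k.+1 <= qb k,
    qc k <= qd k -> qc k <= qc k.+1 /\ qd k.+1 <= qd k &
    nr (bdry (qa k) (qb k) (qc k) (qd k)) <=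
      4 * nr (bdry (qa k.+1) (qb k.+1) (qc k.+1) (qd k.+1))].
  by have := nextP (q k); rewrite -[next _]/(q k.+1) (qE k) (qE k.+1).
have hw k : qb k - qa k = (b - a) / 2 ^+ k.
  elim: k => [|k IH]; first by rewrite expr0 divr1.
  by have [-> _ _ _ _] := qP k; rewrite IH exprSr invfM mulrA.
have hh k : qd k - qc k = (d - c) / 2 ^+ k.
  elim: k => [|k IH]; first by rewrite expr0 divr1.
  by have [_ -> _ _ _] := qP k; rewrite IH exprSr invfM mulrA.
have qab k : qa k <= qb k by rewrite -subr_ge0 hw divr_ge0 ?subr_ge0 ?exprn_ge0.
have qcd k : qc k <= qd k by rewrite -subr_ge0 hh divr_ge0 ?subr_ge0 ?exprn_ge0.
have hJ k : nr (bdry a b c d) <= 4 ^+ k * nr (bdry (qa k) (qb k) (qc k) (qd k)).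
  elim: k => [|k IH]; first by rewrite expr0 mul1r.
  have [_ _ _ _ h] := qP k; apply: (le_trans IH); rewrite exprSr -mulrA.
  by apply: ler_wpM2l h; rewrite exprn_ge0.
have [|||x xP] := @nested_intervals qa qb => //.
- by move=> k; have [_ _ /(_ (qab k))[]] := qP k.
- by move=> k; have [_ _ /(_ (qab k))[]] := qP k.
have [|||y yP] := @nested_intervals qc qd => //.
- by move=> k; have [_ _ _ /(_ (qcd k))[]] := qP k.
- by move=> k; have [_ _ _ /(_ (qcd k))[]] := qP k.
have dz : differentiable u (Cpt x y) by apply: du; [exact: (xP 0)|exact: (yP 0)].
(* On the k-th rectangle [u] is affine up to [e * l / 2 ^+ k], so that the integral is
   at most [2 * e * l ^+ 2 / 4 ^+ k]; the choice of [e] makes this smaller than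
   [nr (bdry a b c d) / 4 ^+ k]. *)
pose l := (b - a) + (d - c).
have l0 : 0 <= l by rewrite addr_ge0// subr_ge0.
pose e := nr (bdry a b c d) / (4 * (l ^+ 2 + 1)).
have l21 : 0 < l ^+ 2 + 1 by rewrite ltr_wpDl ?sqr_ge0.
have e0 : 0 < e by rewrite divr_gt0// mulr_gt0.
have [r r0 rP] := differentiable_nr dz e0.
have [k /(_ k (leqnn k)) kP] := dyadic_small l0 r0.
have dist s t : qa k <= s <= qb k -> qc k <= t <= qd k ->
    nr (Cpt s t - Cpt x y) <= l / 2 ^+ k.
  move=> /andP[s1 s2] /andP[t1 t2]; rewrite CptB (le_trans (nr_Cpt _ _))//.
  rewrite mulrDl -hw -hh lerD// ler_norml;
    have /andP[x1 x2] := xP k; have /andP[y1 y2] := yP k; lra.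
have /(_ (e * (l / 2 ^+ k))) := @bdry_affine_le (u (Cpt x y)) ('d u (Cpt x y) 1) (Cpt x y) _
  (qa k) (qb k) (qc k) (qd k) (qab k) (qcd k).
have H : forall s t, qa k <= s <= qb k -> qc k <= t <= qd k ->
    nr (u (Cpt s t) - (u (Cpt x y) + 'd u (Cpt x y) 1 * (Cpt s t - Cpt x y))) <=
    e * (l / 2 ^+ k).
  move=> s t sP tP; have st := dist s t sP tP.
  rewrite opprD addrA mulrC -[_ * 'd u _ 1]/(_ *: 'd u _ 1) -diff1E.
  by rewrite (le_trans (rP _ _)) ?(le_lt_trans st)// ler_wpM2l// ltW.
move=> /(_ H) {H}; rewrite hw hh -mulrDl -/l => h.
have p2 : 0 < 2 ^+ k :> R by rewrite exprn_gt0.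
have := hJ k; have -> : 4 ^+ k = 2 ^+ k * 2 ^+ k :> R by rewrite -exprMn -natrM.
rewrite leNgt => /negP; apply.
rewrite -ltr_pdivlMl ?mulr_gt0//; apply: le_lt_trans h _.
have -> : 2 * (e * (l / 2 ^+ k)) * (l / 2 ^+ k) =
    (2 ^+ k * 2 ^+ k)^-1 * (2 * e * l ^+ 2) by field; rewrite gt_eqF.
rewrite ltr_pM2l ?invr_gt0 ?mulr_gt0//.
have -> : nr (bdry a b c d) = 4 * e * (l ^+ 2 + 1).
  by rewrite /e; field; rewrite gt_eqF.
have := sqr_ge0 l; nra.
Qed.

End Goursat.

(** * Cauchy's estimate and its consequences *)

Section Lines.
Context {R : realType}.
Local Notation C := (cplx R).
Implicit Types V W : normedModType C.

Lemma diff_line V W (f : V -> W) (x v : V) (t : C) :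
  differentiable f (x + t *: v) ->
  differentiable (fun s : C => f (x + s *: v)) t /\
  forall h, 'd (fun s : C => f (x + s *: v)) t h = h *: 'd f (x + t *: v) v.
Proof.
move=> df; apply: nr_differentiable1 => e e0.
have nv : 0 < nr v + 1 by rewrite ltr_wpDl ?nr_ge0.
have [|d d0 dP] := differentiable_nr df (_ : 0 < e / (nr v + 1)).
  by rewrite divr_gt0.
exists (d / (nr v + 1)); first by rewrite divr_gt0.
move=> s; rewrite ltr_pdivlMr// => sd.
have E : x + s *: v - (x + t *: v) = (s - t) *: v.
  by rewrite opprD addrACA subrr add0r -scalerBl.
have := dP (x + s *: v); rewrite E nrZ linearZ/=.
have sv : nr (s - t) * nr v <= nr (s - t) * (nr v + 1).
  by rewrite ler_wpM2l ?nr_ge0// lerDl.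
move=> /(_ (le_lt_trans sv sd)) h; rewrite (le_trans h)//.
by rewrite mulrAC ler_pdivrMr// -mulrA ler_pM2l.
Qed.

Lemma diffBE V W (f g : V -> W) x h : differentiable f x -> differentiable g x ->
  'd (fun y => f y - g y) x h = 'd f x h - 'd g x h.
Proof.
by move=> df dg; have := @diffB _ _ _ f g x df dg; move=> /(congr1 (@^~ h)).
Qed.

Lemma nr_convex V (x0 x y : V) (r t : R) : 0 <= t <= 1 ->
  nr (x - x0) < r -> nr (y - x0) < r -> nr (x + t%:C *: (y - x) - x0) < r.
Proof.
move=> /andP[t0 t1] xr yr.
have -> : x + t%:C *: (y - x) - x0 = (1 - t)%:C *: (x - x0) + t%:C *: (y - x0).
  rewrite rmorphB/= scalerBl scale1r -[RHS]addrA [- _ + _]addrC -scalerBr.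
  by rewrite opprB addrA subrK addrAC.
rewrite (le_lt_trans (nrD _ _))// !nrZ !nr_real !ger0_norm ?subr_ge0//.
have [->|t0'] := eqVneq t 0; first by rewrite subr0 mul1r mul0r addr0.
have {}t0' : 0 < t by rewrite lt_def t0'.
have -> : r = (1 - t) * r + t * r by ring.
by apply: ler_ltD; [rewrite ler_wpM2l ?subr_ge0// ltW|rewrite ltr_pM2l].
Qed.

Lemma diff_mvi V W (f : V -> W) (x0 : V) (r M : R) :
  (forall x, nr (x - x0) < r -> differentiable f x) ->
  (forall x h, nr (x - x0) < r -> nr ('d f x h) <= M * nr h) ->
  forall x y, nr (x - x0) < r -> nr (y - x0) < r ->
    nr (f y - f x) <= M * nr (y - x).
Proof.
move=> df fM x y xr yr.
have := @rder_mvi _ _ (fun t : R => f (x + t%:C *: (y - x)))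
  (fun t => 'd f (x + t%:C *: (y - x)) (y - x)) 0 1 (M * nr (y - x)) ler01.
rewrite scale1r scale0r addr0 subr0 mulr1 [x + _]addrC subrK; apply.
  by move=> t t01; apply: rder_line; apply: df; exact: nr_convex.
by move=> t t01; apply: fM; exact: nr_convex.
Qed.

End Lines.

Section ComplexExponential.
Context {R : realType}.
Local Notation C := (cplx R).

Definition cis (y : R) : C := Cpt (cos y) (sin y).
Definition cexp (z : C) : C := (expR (Rez z))%:C * cis (Imz z).

Lemma cisD x y : cis (x + y) = cis x * cis y.
Proof.
have i2 : ('i%C : C) * 'i%C = -1 by rewrite -expr2; exact: sqr_i.
rewrite /cis /Cpt cosD sinD !rmorphD rmorphN/= !rmorphM/= -[RHS]/(_ * _ : C).
rewrite mulrDl !mulrDr [('i%C * _) * ('i%C * _)]mulrACA i2; ring.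
Qed.

Lemma nr_cis y : nr (cis y) = 1.
Proof.
rewrite nrc /cis /Cpt /= !mul0r !mul1r subr0 !addr0 !add0r.
by rewrite cos2Dsin2 sqrtr1.
Qed.

Lemma cexpD z w : cexp (z + w) = cexp z * cexp w.
Proof. by rewrite /cexp RezD ImzD expRD cisD rmorphM mulrACA. Qed.

Lemma nr_cexp z : nr (cexp z) = expR (Rez z).
Proof. by rewrite nrM nr_cis mulr1 nr_real ger0_norm// expR_ge0. Qed.

Lemma cis0 : cis 0 = 1.
Proof. by rewrite /cis /Cpt cos0 sin0 mulr0 addr0. Qed.

Lemma rder_cis : rder cis 0 ('i%C : C).
Proof.
have -> : ('i%C : C) = (- sin 0)%:C + 'i%C *: ((cos 0)%:C : C).
  by rewrite sin0 cos0 oppr0 add0r /GRing.scale/= mulr1.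
apply: (@rderD _ _ (fun s => (cos s)%:C : C) (fun s => 'i%C *: ((sin s)%:C : C))).
  by apply: rder_real; [exact: derivable_cos|rewrite derive1E derive_val].
apply: rderZ.
by apply: rder_real; [exact: derivable_sin|rewrite derive1E derive_val].
Qed.

Lemma cexp_diff z : differentiable cexp z /\ forall h, 'd cexp z h = h *: cexp z.
Proof.
apply: nr_differentiable1 => e e0.
pose k := expR (Rez z); have k0 : 0 < k := expR_gt0 _.
pose e' := e / k / 3; have e'0 : 0 < e' by rewrite !divr_gt0.
have re : rder (fun s : R => (expR s)%:C : C) 0 ((1 : R)%:C).
  by apply: rder_real; [exact: derivable_expR|rewrite derive1E derive_val expR0].
have [d1 d10 d1P] := re _ e'0; have [d2 d20 d2P] := rder_cis e'0.
have [d3 d30 d3P] := rder_lip rder_cis (ltr01 : 0 < (1 : R)).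
pose d := Num.min (Num.min d1 d2) (Num.min d3 (e' / 2)).
exists d; first by rewrite !lt_min d10 d20 d30 divr_gt0.
move=> y; rewrite !lt_min => /andP[/andP[h1 h2] /andP[h3 h4]].
have -> : cexp y - cexp z - (y - z) *: cexp z =
    cexp z * (cexp (y - z) - 1 - (y - z)).
  rewrite -{1}[y](subrK z) cexpD /GRing.scale/=; ring.
rewrite nrM nr_cexp -/k mulrC -ler_pdivlMr//.
move: h1 h2 h3 h4; set h := y - z => h1 h2 h3 h4.
set x := Rez h; set w := Imz h.
have xh : `|x| <= nr h := Re_le_nr h; have wh : `|w| <= nr h := Im_le_nr h.
have -> : cexp h - 1 - h = ((expR x)%:C - 1 - x%:C) * cis w +
    (x%:C * (cis w - 1) + (cis w - 1 - 'i%C * w%:C)).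
  by rewrite {2}[h]CptE /cexp -/x -/w /Cpt; ring.
rewrite (le_trans (nrD _ _))// (le_trans (lerD (lexx _) (nrD _ _)))//.
rewrite !nrM nr_cis mulr1 nr_real.
have := d1P x; rewrite subr0 expR0 /GRing.scale/= mulr1 => /(_ (le_lt_trans xh h1)) A.
have := d2P w; rewrite subr0 cis0 -[_ *: _]/(w%:C * 'i%C : C) [w%:C * _]mulrC => /(_ (le_lt_trans wh h2)) B.
have := d3P w; rewrite subr0 cis0 nr_i => /(_ (le_lt_trans wh h3)) D.
have n0 := nr_ge0 h; have x0 := normr_ge0 x; have w0 := normr_ge0 w.
have -> : e * nr h / k = 3 * (e' * nr h) by rewrite /e'; field; rewrite gt_eqF.
have A' : e' * `|x| <= e' * nr h by rewrite ler_pM2l.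
have B' : e' * `|w| <= e' * nr h by rewrite ler_pM2l.
have D' : `|x| * nr (cis w - 1) <= nr h * e'.
  by apply: ler_pM => //; [exact: nr_ge0|lra].
lra.
Qed.

Lemma cexp_periodic x y : cexp (Cpt x (y + pi *+ 2)) = cexp (Cpt x y).
Proof.
rewrite /cexp /cis.
by rewrite !Im_Cpt !Re_Cpt cosD2pi sinD2pi.
Qed.

End ComplexExponential.

Section CauchyEstimate.
Context {R : realType}.
Local Notation C := (cplx R).

Lemma differentiable_quotient (f : C -> C) (a z : C) : z != a ->
  differentiable f z -> differentiable (fun y => (f y - f a) / (y - a)) z.
Proof.
move=> za df; apply: (@differentiableM _ _ (fun y => f y - f a) (fun y => (y - a)^-1)).
  exact: differentiableB.
apply: (@differentiableV _ _ (fun y => y - a)); first exact: differentiableB.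
by rewrite subr_eq0.
Qed.

(** With [q] the difference quotient of [f] at [a], the function
    [w |-> q (a + exp w)] is holomorphic on a left half-plane and has period
    [2 i pi]. By Goursat's theorem on rectangles of height [2 pi], whose horizontal
    sides cancel, its integral over vertical segments of that length does not depend
    on the real part; far to the left this integral tends to [2 pi f'(a)]. *)
Theorem cauchy_estimate (f : C -> C) (a : C) (r B : R) : 0 < r ->
  (forall z, nr (z - a) < r -> differentiable f z) ->
  (forall z, nr (z - a) < r -> nr (f z) <= B) ->
  nr ('d f a 1) <= 4 * B / r.
Proof.
move=> r0 df fB.
pose q (z : C) : C := (f z - f a) / (z - a).
have dq z : z != a -> nr (z - a) < r -> differentiable q z.
  by move=> za zr; apply: differentiable_quotient => //; exact: df.
(* The logarithms of two radii [r / 2] and [3 r / 4]; [cl] freezes the real part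
   beyond the second one, which makes [u] continuous on the whole plane. *)
pose s0 := ln (r / 2); pose s1 := ln (r * (3 / 4)).
have es0 : expR s0 = r / 2 by rewrite lnK// posrE divr_gt0.
have es1 : expR s1 = r * (3 / 4) by rewrite lnK// posrE mulr_gt0.
have s01 : s0 < s1 by rewrite -ltr_expR es0 es1 ltr_pM2l//; lra.
pose cl (w : C) : C := Cpt (Num.min (Rez w : R) s1) (Imz w).
have cl_cont : continuous cl.
  move=> w; apply/continuous_nrP => e e0; exists (e / 2); first by rewrite divr_gt0.
  move=> y yw; rewrite CptB (le_lt_trans (nr_Cpt _ _))//.
  have h1 : `|Rez y - Rez w| <= nr (y - w).
    by rewrite -RezB; exact: Re_le_nr.
  have h2 : `|Imz y - Imz w| <= nr (y - w).
    by rewrite -ImzB; exact: Im_le_nr.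
  have h3 : `|Num.min (Rez y) s1 - Num.min (Rez w) s1| <=
      `|Rez y - Rez w|.
    rewrite ler_norml; have := ler_norm (Rez y - Rez w).
    have := ler_norm (Rez w - Rez y); rewrite distrC.
    by case: (leP (Rez y) s1); case: (leP (Rez w) s1); lra.
  lra.
have clP w : a + cexp (cl w) != a /\ nr (a + cexp (cl w) - a) < r.
  have E : a + cexp (cl w) - a = cexp (cl w) by rewrite addrC addKr.
  split; first by rewrite -subr_eq0 E -nr_eq0E nr_cexp gt_eqF// expR_gt0.
  rewrite E nr_cexp Re_Cpt; apply: (@le_lt_trans _ _ (expR s1)).
    by rewrite ler_expR ge_min lexx orbT.
  by rewrite es1 gtr_pMr//; lra.
pose u w := q (a + cexp (cl w)).
have dac w : differentiable (fun w => a + cexp w) w.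
  apply: (@differentiableD _ _ _ (fun=> a) cexp); first exact: differentiable_cst.
  by have [] := cexp_diff w.
have u_cont : continuous u.
  move=> w; have [h1 h2] := clP w.
  apply: (@continuous_comp _ _ _ cl (fun w => q (a + cexp w))); first exact: cl_cont.
  apply: (@continuous_comp _ _ _ (fun w => a + cexp w) q).
    exact/differentiable_continuous/dac.
  exact/differentiable_continuous/dq.
have du (x y : R) : x < s1 -> differentiable u (Cpt x y).
  move=> xs.
  have d1 : differentiable (q \o (fun w => a + cexp w)) (Cpt x y).
    apply: differentiable_comp; first exact: dac.
    have clE : cl (Cpt x y) = Cpt x y.
      by rewrite /cl Re_Cpt Im_Cpt min_l// ltW.
    have := clP (Cpt x y).
    rewrite clE.
    case=> h1 h2.
    exact: dq.
  apply: (near_eq_differentiable _ d1).1.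
  apply/nbhs_nrP; exists (s1 - x); first by rewrite subr_gt0.
  move=> z zx; rewrite /u /cl /= min_l -?CptE//.
  have := Re_le_nr (z - Cpt x y); rewrite RezB Re_Cpt => h.
  have := ler_norm (Rez z - x); lra.
pose T : R := pi *+ 2.
have T0 : 0 < T by rewrite /T mulr2n addr_gt0// pi_gt0.
have uper x y : u (Cpt x (y + T)) = u (Cpt x y).
  by rewrite /u /cl !Re_Cpt !Im_Cpt cexp_periodic.
pose V x := prim_v u_cont x T - prim_v u_cont x 0.
have Vconst x : x < s0 -> V x = V s0.
  move=> xs; have := @goursat _ u u_cont x s0 0 T (ltW xs) (ltW T0).
  have H : prim_h u_cont 0 s0 - prim_h u_cont 0 x =
      prim_h u_cont T s0 - prim_h u_cont T x.
    apply/eqP; rewrite -subr_eq0; apply/eqP/nr_eq0/le_anti; rewrite nr_ge0 andbT.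
    have := @rder_mvi _ _ (fun s => prim_h u_cont 0 s - prim_h u_cont T s)
      (fun s => u (Cpt s 0) - u (Cpt s T)) x s0 0 (ltW xs).
    have E (p1 p2 p3 p4 : C) : p1 - p2 - (p3 - p4) = p1 - p3 - (p2 - p4) by ring.
    rewrite mul0r E; apply=> t _; first by apply: rderB; exact: prim_hP.
    by rewrite -[T]add0r uper subrr nr0.
  rewrite /bdry H subrr add0r => /(_ _)/eqP; rewrite mulf_eq0 => G.
  have /orP[/eqP i0|] := G (fun a0 b0 ha _ => du a0 b0 (le_lt_trans (andP ha).2 s01)).
    by have := congr1 (fun z : C => nr z) i0; rewrite nr_i nr0 => /eqP; rewrite oner_eq0.
  by rewrite subr_eq0 => /eqP /esym.
(* On the circle of radius [r / 2] the difference quotient is at most [2 B / (r / 2)]. *)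
have VB : nr (V s0) <= 4 * B / r * T.
  have := @rder_mvi _ _ (prim_v u_cont s0) (fun t => u (Cpt s0 t)) 0 T (4 * B / r) (ltW T0).
  rewrite subr0; apply=> t _; first exact: prim_vP.
  have := clP (Cpt s0 t); rewrite /u /q /cl Re_Cpt Im_Cpt min_l ?(ltW s01)// => -[h1 h2].
  rewrite nrM nrV.
  have -> : a + cexp (Cpt s0 t) - a = cexp (Cpt s0 t) by rewrite addrC addKr.
  rewrite nr_cexp Re_Cpt es0.
  rewrite ler_pdivrMr ?divr_gt0//.
  have -> : 4 * B / r * (r / 2) = B + B by field; rewrite gt_eqF.
  by rewrite (le_trans (nrB _ _))// lerD// fB// subrr nr0.
rewrite -(ler_pM2r T0); apply/ler_addgt0Pl => eps eps0.
have e0 : 0 < eps / T by rewrite divr_gt0.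
have [|d d0 dP] := differentiable_nr (df a _) e0; first by rewrite subrr nr0.
(* Far enough to the left, the difference quotient is within [eps / T] of [f'(a)]. *)
pose x := Num.min (s0 - 1) (ln (d / 2)).
have xs0 : x < s0 by rewrite gt_min ltrBlDr ltrDl ltr01.
have xd : expR x < d.
  apply: (@le_lt_trans _ _ (expR (ln (d / 2)))).
    by rewrite ler_expR ge_min lexx orbT.
  by rewrite lnK ?posrE ?divr_gt0// ltr_pdivrMr// ltr_pMr// ltr1n.
have H : nr (V x - T%:C * 'd f a 1) <= eps.
  have := @rder_mvi _ _ (fun t => prim_v u_cont x t - t%:C *: ('d f a 1 : C))
    (fun t => u (Cpt x t) - 'd f a 1) 0 T (eps / T) (ltW T0).
  rewrite subr0 divfK ?gt_eqF// scale0r subr0 addrAC; apply=> t _.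
    by apply: rderB; [exact: prim_vP|exact: rder_scal].
  have [] := clP (Cpt x t); rewrite /u /q /cl Re_Cpt Im_Cpt min_l; last first.
    exact/ltW/(lt_trans xs0).
  set z := a + cexp _ => za zr.
  have zaE : nr (z - a) = expR x by rewrite /z addrC addKr nr_cexp Re_Cpt.
  have za0 : z - a != 0 by rewrite subr_eq0.
  have -> : (f z - f a) / (z - a) - 'd f a 1 =
     (f z - f a - 'd f a (z - a)) / (z - a).
    by rewrite [in RHS]diff1E [RHS]mulrBl /GRing.scale/= [(z - a) * _]mulrC mulfK.
  rewrite nrM nrV ler_pdivrMr; last by rewrite zaE expR_gt0.
  by apply: dP; rewrite zaE.
have := nr_subD (T%:C * 'd f a 1 : C) (V x).
rewrite nr_distC nrM nr_real gtr0_norm// Vconst// in H *.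
rewrite mulrC; lra.
Qed.

End CauchyEstimate.

Section CauchyNormed.
Context {R : realType}.
Local Notation C := (cplx R).
Variables (V : normedModType C) (n : nat).
Implicit Types f : V -> 'rV[C]_n.

(** The estimate on complex lines, coordinate by coordinate. *)
Lemma diff_cauchy f (x : V) (r B : R) : 0 < r ->
  (forall y, nr (y - x) < r -> differentiable f y) ->
  (forall y, nr (y - x) < r -> nr (f y) <= B) ->
  forall h, nr ('d f x h) <= 4 * B / r * nr h.
Proof.
move=> r0 df fB h.
have B0 : 0 <= B by rewrite (le_trans (nr_ge0 (f x)))// fB// subrr nr0.
have cB : 0 <= 4 * B / r by rewrite divr_ge0 ?mulr_ge0// ltW.
have [->|h0] := eqVneq h 0; first by rewrite linear0 !nr0 mulr0.
have nh := nr_gt0 h0.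
have hr (t : C) : nr (t - 0) < r / nr h -> nr (x + t *: h - x) < r.
  by rewrite subr0 addrC addKr nrZ ltr_pdivlMr.
apply: nr_rV_le => [|i]; first by rewrite mulr_ge0 ?nr_ge0.
have dline (t : C) : nr (t - 0) < r / nr h ->
    differentiable (fun s : C => f (x + s *: h) 0 i : C) t /\
    'd (fun s : C => f (x + s *: h) 0 i : C) t 1 = 'd f (x + t *: h) h 0 i.
  move=> tr; have [d1 E1] := diff_line (df _ (hr t tr)).
  have [d2 E2] := differentiable_coordE i d1.
  by split=> //; rewrite E2 E1 scale1r.
have rh0 : 0 < r / nr h by rewrite divr_gt0.
have := @cauchy_estimate R (fun s : C => f (x + s *: h) 0 i : C) 0 (r / nr h) B rh0.
have [|_] := dline 0; first by rewrite subrr nr0.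
rewrite scale0r addr0 => -> H.
have -> : 4 * B / r * nr h = 4 * B / (r / nr h) by rewrite invf_div mulrA mulrAC.
apply: H => t tr; first by have [] := dline t tr.
by rewrite (le_trans (nr_coord _ _))// fB// hr.
Qed.

Lemma diff_lipschitz f (x0 : V) (r B : R) : 0 < r ->
  (forall y, nr (y - x0) < r -> differentiable f y) ->
  (forall y, nr (y - x0) < r -> nr (f y) <= B) ->
  forall x y, nr (x - x0) < r / 2 -> nr (y - x0) < r / 2 ->
  nr (f y - f x) <= 8 * B / r * nr (y - x).
Proof.
move=> r0 df fB x y xr yr.
have sub z w : nr (z - x0) < r / 2 -> nr (w - z) < r / 2 -> nr (w - x0) < r.
  by move=> zr wz; rewrite (le_lt_trans (nr_tri z _ _))// [ltRHS]splitr ltrD.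
apply: (@diff_mvi _ _ _ f x0 (r / 2)) => // [z zr|z h zr].
  by apply: df; rewrite (lt_le_trans zr)// ler_pdivrMr// ler_pMr// ler1n.
have -> : 8 * B / r = 4 * B / (r / 2) by field; rewrite gt_eqF.
apply: diff_cauchy => [|w wz|w wz]; first by rewrite divr_gt0.
  by apply: df; exact: sub wz.
by apply: fB; exact: sub wz.
Qed.

(** A differentiable function stays close to its differential on a neighborhood, in
    the Lipschitz sense: Cauchy's estimate applied to the remainder. *)
Lemma strict_differentiable f (x0 : V) (r : R) : 0 < r ->
  (forall y, nr (y - x0) < r -> differentiable f y) ->
  forall e : R, 0 < e -> exists2 d : R, 0 < d & forall x y,
    nr (x - x0) < d -> nr (y - x0) < d ->
    nr (f y - f x - 'd f x0 (y - x)) <= e * nr (y - x).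
Proof.
move=> r0 df e e0.
have df0 : differentiable f x0 by apply: df; rewrite subrr nr0.
have [|d d0 dP] := differentiable_nr df0 (_ : 0 < e / 8); first by rewrite divr_gt0.
pose L y := 'd f x0 (y - x0).
have dL y : differentiable L y.
  apply: (@differentiable_comp _ _ _ _ (fun y => y - x0) ('d f x0)).
    exact: differentiableB.
  by apply: linear_differentiable; exact: diff_continuous.
pose D := Num.min d r.
have D0 : 0 < D by rewrite lt_min d0.
have := @diff_lipschitz (fun y => f y - f x0 - L y) x0 D (e / 8 * D) D0.
have -> : 8 * (e / 8 * D) / D = e by field; rewrite gt_eqF.
move=> H; exists (D / 2); first by rewrite divr_gt0.
move=> x y xd yd; have {H} := H _ _ x y xd yd.
have -> : f y - f x0 - L y - (f x - f x0 - L x) = f y - f x - 'd f x0 (y - x).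
  by rewrite /L !linearB/=; apply/rowP => i; rewrite !mxE; ring.
apply=> z; rewrite lt_min => /andP[zd zr].
  apply: differentiableB; last exact: dL.
  by apply: differentiableB => //; exact: df.
rewrite (le_trans (dP _ zd))// ler_pM2l ?divr_gt0//.
by rewrite le_min !ltW.
Qed.

End CauchyNormed.

Section Completeness.
Context {R : realType}.
Local Notation C := (cplx R).

Lemma Cseq_complete (z : nat -> C) :
  (forall e : R, 0 < e -> exists N, forall j k, (N <= j)%N -> (N <= k)%N ->
     nr (z j - z k) <= e) ->
  exists l : C, forall e : R, 0 < e -> exists N, forall k, (N <= k)%N ->
     nr (z k - l) <= e.
Proof.
move=> zc.
have cv (g : nat -> R) : (forall j k, `|g j - g k| <= nr (z j - z k)) ->
    exists l : R, forall e : R, 0 < e -> exists N, forall k, (N <= k)%N -> `|g k - l| <= e.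
  move=> gz; have : cvgn g.
    apply: cauchy_cvg; apply: cauchy_exP => e e0.
    have [N NP] := zc (e / 2) (divr_gt0 e0 (ltr0n _ 2)).
    exists (g N); exists N => // k /= Nk; rewrite /ball/= (le_lt_trans (gz _ _))//.
    by rewrite (le_lt_trans (NP _ _ (leqnn _) Nk))// ltr_pdivrMr// ltr_pMr// ltr1n.
  move=> /cvg_ex[l gl]; exists l => e e0.
  have /cvgrPdist_le/(_ _ e0)[N _ NP] := gl.
  by exists N => k /NP; rewrite distrC.
have [a aP] := cv (Rez \o z) (fun j k => le_trans (eq_ind _ (fun r => r <= _)
  (Re_le_nr (z j - z k)) _ (congr1 Num.norm (RezB (z j) (z k)))) (lexx _)).
have [b bP] := cv (Imz \o z) (fun j k => le_trans (eq_ind _ (fun r => r <= _)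
  (Im_le_nr (z j - z k)) _ (congr1 Num.norm (ImzB (z j) (z k)))) (lexx _)).
exists (Cpt a b) => e e0; have e20 : 0 < e / 2 by rewrite divr_gt0.
have [N1 N1P] := aP _ e20; have [N2 N2P] := bP _ e20.
exists (maxn N1 N2) => k; rewrite geq_max => /andP[/N1P h1 /N2P h2].
rewrite [z k]CptE CptB (le_trans (nr_Cpt _ _))// [e]splitr.
exact: lerD h1 h2.
Qed.

Lemma rVseq_complete n (z : nat -> 'rV[C]_n) :
  (forall e : R, 0 < e -> exists N, forall j k, (N <= j)%N -> (N <= k)%N ->
     nr (z j - z k) <= e) ->
  exists l : 'rV[C]_n, forall e : R, 0 < e -> exists N, forall k, (N <= k)%N ->
     nr (z k - l) <= e.
Proof.
move=> zc; have li i : exists l : C, forall e : R, 0 < e ->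
    exists N, forall k, (N <= k)%N -> nr (z k 0 i - l) <= e.
  apply: Cseq_complete => e e0; have [N NP] := zc e e0; exists N => j k Nj Nk.
  have := nr_coord (z j - z k) i; rewrite !mxE => /le_trans; apply; exact: NP.
have [l lP] := choice li; exists (\row_i l i) => e e0.
have Ni i : exists N, forall k, (N <= k)%N -> nr (z k 0 i - l i) <= e by exact: lP.
have [N NP] := choice Ni; exists (\max_i N i) => k Nk.
apply: nr_rV_le => [|i]; first exact: ltW.
by rewrite !mxE; apply: NP; apply: leq_trans Nk; exact: leq_bigmax.
Qed.

End Completeness.

Section Weierstrass.
Context {R : realType}.
Local Notation C := (cplx R).
Variables (V : normedModType C) (n : nat).

Lemma le_of_lim (a b : R) (c : R) : 0 <= c ->
  (forall e : R, 0 < e -> a <= b + c * e) -> a <= b.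
Proof.
move=> c0 H; apply/ler_addgt0Pr => e e0.
have c10 : 0 < c + 1 by rewrite ltr_wpDl.
rewrite (le_trans (H (e / (c + 1)) _)) ?divr_gt0// lerD2l mulrCA ger_pMr//.
by rewrite ler_pdivrMr// mul1r lerDl.
Qed.

(** By Cauchy's estimate the differentials of a uniformly convergent sequence of
    holomorphic maps form a Cauchy sequence, and the differences of its terms
    have small Lipschitz constants. *)
Theorem weierstrass (fs : nat -> V -> 'rV[C]_n) (f : V -> 'rV[C]_n) (x0 : V) (r : R) :
  0 < r ->
  (forall k x, nr (x - x0) < r -> differentiable (fs k) x) ->
  (forall e : R, 0 < e -> exists N, forall k, (N <= k)%N ->
     forall x, nr (x - x0) < r -> nr (fs k x - f x) <= e) ->
  differentiable f x0 /\ forall h (e : R), 0 < e -> exists N, forall k, (N <= k)%N ->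
     nr ('d (fs k) x0 h - 'd f x0 h) <= e.
Proof.
move=> r0 dfs cv.
have x0r : nr (x0 - x0) < r by rewrite subrr nr0.
have pair (e : R) : 0 < e -> exists N, forall j k, (N <= j)%N -> (N <= k)%N ->
    forall x, nr (x - x0) < r -> nr (fs j x - fs k x) <= e.
  move=> e0; have [N NP] := cv (e / 2) (divr_gt0 e0 (ltr0n _ 2)).
  exists N => j k Nj Nk x xr; rewrite (le_trans (nr_tri (f x) _ _))// [e]splitr.
  by rewrite lerD ?NP// nr_distC NP.
have dB j k x : nr (x - x0) < r -> differentiable (fun y => fs j y - fs k y) x.
  by move=> xr; apply: differentiableB; exact: dfs.
have ddB j k h : 'd (fun y => fs j y - fs k y) x0 h = 'd (fs j) x0 h - 'd (fs k) x0 h.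
  by apply: diffBE; exact: dfs.
have dpair (e : R) : 0 < e -> exists N, forall j k, (N <= j)%N -> (N <= k)%N ->
    forall h, nr ('d (fs j) x0 h - 'd (fs k) x0 h) <= e * nr h.
  move=> e0; have [|N NP] := pair (e * r / 4); first by rewrite divr_gt0// mulr_gt0.
  exists N => j k Nj Nk h; rewrite -ddB.
  have := @diff_cauchy R V n (fun y => fs j y - fs k y) x0 r (e * r / 4) r0 (dB j k)
    (NP j k Nj Nk) h.
  by have -> : 4 * (e * r / 4) / r = e by field; rewrite gt_eqF.
have Lh h : exists l, forall e : R, 0 < e -> exists N, forall k, (N <= k)%N ->
    nr ('d (fs k) x0 h - l) <= e.
  apply: rVseq_complete => e e0.
  have [|N NP] := dpair (e / (nr h + 1)); first by rewrite divr_gt0// ltr_wpDl ?nr_ge0.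
  exists N => j k Nj Nk; rewrite (le_trans (NP j k Nj Nk h))// mulrAC.
  by rewrite ler_pdivrMr ?ltr_wpDl ?nr_ge0// ler_pM2l// lerDl.
have [L LP] := choice Lh.
have Llim (e : R) : 0 < e -> exists N, forall k, (N <= k)%N -> forall h,
    nr ('d (fs k) x0 h - L h) <= e * nr h.
  move=> e0; have [N NP] := dpair e e0; exists N => k Nk h.
  apply: (@le_of_lim _ _ 1) => // e' e'0; have [M MP] := LP h e' e'0.
  rewrite (le_trans (nr_tri ('d (fs (maxn N M)) x0 h) _ _))// mul1r lerD//.
    by apply: NP => //; exact: leq_maxl.
  by apply: MP; exact: leq_maxr.
have Llin : linear L.
  move=> a u v; apply/eqP; rewrite -subr_eq0; apply/eqP/nr_eq0/le_anti.
  rewrite nr_ge0 andbT; apply: (@le_of_lim _ _ (nr (a *: u + v) + nr a * nr u + nr v)).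
    by rewrite !addr_ge0 ?mulr_ge0 ?nr_ge0.
  move=> e e0; have [N NP] := Llim e e0; rewrite add0r.
  have E : L (a *: u + v) - (a *: L u + L v) =
     - ('d (fs N) x0 (a *: u + v) - L (a *: u + v)) +
     (a *: ('d (fs N) x0 u - L u) + ('d (fs N) x0 v - L v)).
    by rewrite linearP; apply/rowP => i; rewrite !mxE; ring.
  rewrite E (le_trans (nrD _ _))// nrN -addrA mulrDl lerD//.
    by rewrite mulrC NP.
  rewrite (le_trans (nrD _ _))// mulrDl lerD//; last by rewrite mulrC NP.
  by rewrite nrZ -mulrA ler_wpM2l ?nr_ge0// mulrC NP.
have [N0 N0P] := Llim 1 ltr01.
have [M0 M00 M0P] := diff_nr_bounded (dfs N0 _ x0r).
have LB h : nr (L h) <= (M0 + 1) * nr h.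
  rewrite (le_trans (nr_subD _ ('d (fs N0) x0 h)))// nr_distC mulrDl addrC lerD//.
  exact: N0P.
have [|df dfE] := nr_differentiable Llin LB (f := f) (x := x0).
  move=> e e0; have e30 : 0 < e / 3 by rewrite divr_gt0.
  have [N1 N1P] := Llim _ e30.
  have [|N2 N2P] := pair (e / 3 * r / 8); first by rewrite divr_gt0// mulr_gt0.
  pose k := maxn N1 N2.
  have [d d0 dP] := differentiable_nr (dfs k _ x0r) e30.
  exists (Num.min d (r / 2)); first by rewrite lt_min d0 divr_gt0.
  move=> y; rewrite lt_min => /andP[yd yr].
  have A : nr ((f y - fs k y) - (f x0 - fs k x0)) <= e / 3 * nr (y - x0).
    apply: (@le_of_lim _ _ 2) => // e' e'0; have [M MP] := cv e' e'0.
    pose j := maxn M N2.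
    have E : f y - fs k y - (f x0 - fs k x0) =
        (fs j y - fs k y - (fs j x0 - fs k x0)) + (- (fs j y - f y) + (fs j x0 - f x0)).
      by apply/rowP => i; rewrite !mxE; ring.
    rewrite E (le_trans (nrD _ _))// lerD//.
      have := @diff_lipschitz _ _ _ (fun y => fs j y - fs k y) x0 r (e / 3 * r / 8) r0
        (dB j k) (N2P j k (leq_maxr _ _) (leq_maxr _ _)) x0 y.
      have -> : 8 * (e / 3 * r / 8) / r = e / 3 by field; rewrite gt_eqF.
      by apply => //; rewrite subrr nr0 divr_gt0.
    rewrite (le_trans (nrD _ _))// nrN mulr_natl mulr2n lerD// MP// ?leq_maxl//.
    by rewrite (lt_trans yr)// ltr_pdivrMr// ltr_pMr// ltr1n.
  have E : f y - f x0 - L (y - x0) = ((f y - fs k y) - (f x0 - fs k x0)) +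
     ((fs k y - fs k x0 - 'd (fs k) x0 (y - x0)) + ('d (fs k) x0 (y - x0) - L (y - x0))).
    by apply/rowP => i; rewrite !mxE; ring.
  have -> : e * nr (y - x0) = e / 3 * nr (y - x0) + (e / 3 * nr (y - x0) + e / 3 * nr (y - x0)).
    by field.
  rewrite E (le_trans (nrD _ _))// lerD// (le_trans (nrD _ _))// lerD//.
    exact: dP.
  by apply: N1P; rewrite leq_maxl.
split=> // h e e0; have [N NP] := LP h e e0.
by exists N => k Nk; have := NP k Nk; rewrite -(dfE h).
Qed.

End Weierstrass.

Section Primitive.
Context {R : realType}.
Local Notation C := (cplx R).

Lemma nr_Cpt_mono (s t s' t' : R) : `|s| <= `|s'| -> `|t| <= `|t'| ->
  nr (Cpt s t) <= nr (Cpt s' t').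
Proof.
move=> ss tt; rewrite !nrc !Re_Cpt !Im_Cpt ler_sqrt ?addr_ge0 ?sqr_ge0//.
by rewrite -(real_normK (num_real s)) -(real_normK (num_real t))
  -(real_normK (num_real s')) -(real_normK (num_real t')) lerD// ler_sqr// nnegrE.
Qed.

Lemma bdryN_h (u : C -> C) (uc : continuous u) a b c d :
  bdry uc a b c d = - bdry uc b a c d.
Proof. by rewrite /bdry; ring. Qed.

Lemma bdryN_v (u : C -> C) (uc : continuous u) a b c d :
  bdry uc a b c d = - bdry uc a b d c.
Proof. by rewrite /bdry; ring. Qed.

Lemma goursat_oriented (u : C -> C) (uc : continuous u) a b c d :
  (forall x y, Num.min a b <= x <= Num.max a b ->
     Num.min c d <= y <= Num.max c d -> differentiable u (Cpt x y)) ->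
  bdry uc a b c d = 0.
Proof.
have [ab|/ltW ab] := leP a b; have [cd|/ltW cd] := leP c d => du.
- exact: goursat.
- by rewrite bdryN_v (goursat uc ab cd du) oppr0.
- by rewrite bdryN_h (goursat uc ab cd du) oppr0.
- by rewrite bdryN_v bdryN_h (goursat uc ab cd du) !oppr0.
Qed.

(** Radial retraction onto a disc, used to extend continuously to the plane a function
    on a larger disc. *)
Let cl (r : R) (z : C) : C := (r / Num.max r (nr z))%:C * z.

Let clE (r : R) (z : C) : 0 < r -> nr z <= r -> cl r z = z.
Proof. by move=> r0 zr; rewrite /cl max_l// divff ?gt_eqF// mul1r. Qed.

Let cl_le (r : R) (z : C) : 0 < r -> nr (cl r z) <= r.
Proof.
move=> r0; have m0 : 0 < Num.max r (nr z) by rewrite lt_max r0.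
rewrite nrM nr_real ger0_norm; last by rewrite divr_ge0// ltW.
by rewrite mulrAC ler_pdivrMr// ler_pM2l// le_max lexx orbT.
Qed.

Let cl_cont (r : R) : 0 < r -> continuous (cl r).
Proof.
move=> r0 w; apply/continuous_nrP => e e0; exists (e / 2); first by rewrite divr_gt0.
move=> z zw.
have m0 (x : C) : 0 < Num.max r (nr x) by rewrite lt_max r0.
have -> : cl r z - cl r w = (r / Num.max r (nr z))%:C * (z - w) +
    (r / Num.max r (nr z) - r / Num.max r (nr w))%:C * w.
  by rewrite /cl rmorphB/=; ring.
rewrite (le_lt_trans (nrD _ _))// !nrM !nr_real.
have h1 : `|r / Num.max r (nr z)| <= 1.
  rewrite ger0_norm; last by rewrite divr_ge0// ltW.
  by rewrite ler_pdivrMr// mul1r le_max lexx.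
have h2 : `|Num.max r (nr w) - Num.max r (nr z)| <= nr (z - w).
  have := nr_subD z w; have := nr_subD w z; rewrite [nr (w - z)]nr_distC.
  rewrite ler_norml => a1 a2; have := nr_ge0 (z - w).
  by case: (leP r (nr w)); case: (leP r (nr z)); lra.
have h3 : `|r / Num.max r (nr z) - r / Num.max r (nr w)| * nr w <= nr (z - w).
  have -> : r / Num.max r (nr z) - r / Num.max r (nr w) =
      r / Num.max r (nr z) * (Num.max r (nr w) - Num.max r (nr z)) / Num.max r (nr w).
    by field; rewrite !gt_eqF.
  rewrite normrM normrM normfV (ger0_norm (ltW (m0 w))) mulrAC ler_pdivrMr//.
  apply: ler_pM => //; [exact: nr_ge0| |by rewrite le_max lexx orbT].
  by rewrite -[leRHS]mul1r ler_pM.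
have h4 : `|r / Num.max r (nr z)| * nr (z - w) <= nr (z - w).
  by rewrite ler_piMl ?nr_ge0.
lra.
Qed.

Lemma between_norm (x y t : R) : Num.min x y <= t <= Num.max x y ->
  `|t| <= Num.max `|x| `|y| /\ `|t - x| <= `|y - x|.
Proof.
rewrite ge_min !le_max => /andP[h1 h2].
have := ler_norm x; have := ler_norm y; have := ler_norm (- x); have := ler_norm (- y).
rewrite !normrN => a1 a2 a3 a4.
have := ler_norm (y - x); have := ler_norm (x - y); rewrite [`|x - y|]distrC => b1 b2.
split; last by rewrite ler_norml; case/orP: h1; case/orP: h2; lra.
by rewrite !ler_norml; have [?|?] := leP `|x| `|y|;
  apply/orP; [right|left]; case/orP: h1; case/orP: h2; lra.
Qed.

(** The primitive is the integral along the horizontal, then vertical path from [0].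
    By [goursat_oriented] its increments are integrals along the other sides of the
    rectangle as well, close to the point where the derivative is taken. *)
Lemma primitive_smaller (f : C -> C) (r r1 : R) : 0 < r1 -> r1 < r ->
  (forall z, nr z < r -> differentiable f z) ->
  exists P : C -> C, P 0 = 0 /\ forall z, nr z < r1 ->
    differentiable P z /\ forall h, 'd P z h = h * f z.
Proof.
move=> r10 r1r df; pose u z := f (cl r1 z).
have u_cont : continuous u.
  move=> z; apply: (@continuous_comp _ _ _ (cl r1) f); first exact: cl_cont.
  by apply/differentiable_continuous/df; exact: le_lt_trans (cl_le _ r10) r1r.
have uf z : nr z < r1 -> u z = f z by move=> zr; rewrite /u clE// ltW.
have du z : nr z < r1 -> differentiable u z.
  move=> zr; have dz : differentiable f z by apply: df; exact: lt_trans r1r.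
  apply: (near_eq_differentiable _ dz).1; apply/nbhs_nrP.
  exists (r1 - nr z); first by rewrite subr_gt0.
  by move=> y yz; rewrite uf//; have := nr_subD y z; lra.
pose H := prim_h u_cont; pose V := prim_v u_cont.
pose P z : C := (H 0 (Rez z) - H 0 0) +
  'i%C * (V (Rez z) (Imz z) - V (Rez z) 0).
exists P; split; first by rewrite /P !subrr mulr0 addr0.
move=> z zr; apply: nr_differentiable1 => e e0.
have /continuous_nrP/(_ (e / 2)) := @u_cont z.
have -> : 0 < e / 2 by rewrite divr_gt0.
move=> /(_ isT)[d d0 dP].
exists (Num.min (d / 2) (r1 - nr z)); first by rewrite lt_min divr_gt0// subr_gt0.
move=> y; rewrite lt_min => /andP[yd yr].
have hx : `|Rez y - Rez z| <= nr (y - z) by rewrite -RezB; exact: Re_le_nr.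
have hy : `|Imz y - Imz z| <= nr (y - z) by rewrite -ImzB; exact: Im_le_nr.
have nzE : nr (Cpt (Rez z) (Imz z)) = nr z by rewrite -CptE.
have cornerE : nr (Cpt (Rez y) (Imz z)) < r1.
  have := nr_subD (Cpt (Rez y) (Imz z)) z.
  rewrite [Cpt (Rez y) (Imz z) - z](_ : _ = Cpt (Rez y - Rez z) 0); last first.
    by rewrite [X in _ - X]CptE CptB subrr.
  have := nr_Cpt (Rez y - Rez z) 0; rewrite normr0; lra.
have G : bdry u_cont (Rez z) (Rez y) 0 (Imz z) = 0.
  apply: goursat_oriented => s t /between_norm[s1 _] /between_norm[t1 _].
  apply: du; rewrite normr0 max_r// in t1.
  move: s1; rewrite le_max => /orP[s1|s1].
    by rewrite (le_lt_trans (nr_Cpt_mono s1 t1))// nzE.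
  by rewrite (le_lt_trans (nr_Cpt_mono s1 t1)).
have PE : P y - P z - (y - z) *: f z =
   ((H (Imz z) (Rez y) - (Rez y)%:C * f z) - (H (Imz z) (Rez z) - (Rez z)%:C * f z)) +
   'i%C * ((V (Rez y) (Imz y) - (Imz y)%:C * f z) - (V (Rez y) (Imz z) - (Imz z)%:C * f z)).
  have yzE : y - z = (Rez y)%:C - (Rez z)%:C + 'i%C * ((Imz y)%:C - (Imz z)%:C).
    by rewrite {1}[y]complex_RezImz {1}[z]complex_RezImz; ring.
  rewrite /P yzE /GRing.scale/= -[LHS]subr0 -G /bdry -/H -/V; ring.
rewrite PE (le_trans (nrD _ _))// nrM nr_i mul1r.
have A : nr ((H (Imz z) (Rez y) - (Rez y)%:C * f z) -
    (H (Imz z) (Rez z) - (Rez z)%:C * f z)) <= e / 2 * `|Rez y - Rez z|.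
  apply: (@rder_mvi_abs _ _ (fun s => H (Imz z) s - s%:C *: f z)
    (fun s => u (Cpt s (Imz z)) - f z)) => s sb.
    by apply: rderB; [exact: prim_hP|exact: rder_scal].
  rewrite -(uf z zr); apply/ltW/dP; rewrite [X in _ - X]CptE CptB subrr.
  have [_ h] := between_norm sb.
  have := nr_Cpt (s - Rez z) 0; rewrite normr0; lra.
have B : nr ((V (Rez y) (Imz y) - (Imz y)%:C * f z) -
    (V (Rez y) (Imz z) - (Imz z)%:C * f z)) <= e / 2 * `|Imz y - Imz z|.
  apply: (@rder_mvi_abs _ _ (fun s => V (Rez y) s - s%:C *: f z)
    (fun s => u (Cpt (Rez y) s) - f z)) => s sb.
    by apply: rderB; [exact: prim_vP|exact: rder_scal].
  rewrite -(uf z zr); apply/ltW/dP; rewrite [X in _ - X]CptE CptB.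
  have [_ h] := between_norm sb.
  have := nr_Cpt (Rez y - Rez z) (s - Imz z); lra.
have e20 : 0 < e / 2 by rewrite divr_gt0.
have A' : e / 2 * `|Rez y - Rez z| <= e / 2 * nr (y - z) by rewrite ler_pM2l.
have B' : e / 2 * `|Imz y - Imz z| <= e / 2 * nr (y - z) by rewrite ler_pM2l.
lra.
Qed.

(** The primitives on smaller discs vanish at [0], hence agree where both exist. *)
Lemma primitive (f : C -> C) (r : R) : 0 < r ->
  (forall z, nr z < r -> differentiable f z) ->
  exists P : C -> C, P 0 = 0 /\ forall z, nr z < r ->
    differentiable P z /\ forall h, 'd P z h = h * f z.
Proof.
move=> r0 df.
have loc (s : R) : exists P : C -> C, 0 < s < r -> P 0 = 0 /\ forall z, nr z < s ->
    differentiable P z /\ forall h, 'd P z h = h * f z.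
  have [/andP[s0 sr]|_] := boolP (0 < s < r); last by exists (fun=> 0).
  by have [P PP] := primitive_smaller s0 sr df; exists P.
have [Q QP] := choice loc.
have Q_eq s t z : 0 < s < r -> 0 < t < r -> nr z < s -> nr z < t -> Q s z = Q t z.
  move=> sr tr zs zt; apply/eqP; rewrite -subr_eq0; apply/eqP/nr_eq0/le_anti.
  rewrite nr_ge0 andbT.
  have [Qs0 Qs] := QP s sr; have [Qt0 Qt] := QP t tr.
  pose m := Num.min s t.
  have ms (y : C) : nr (y - 0) < m -> nr y < s by rewrite subr0 lt_min => /andP[].
  have mt (y : C) : nr (y - 0) < m -> nr y < t by rewrite subr0 lt_min => /andP[].
  suff : nr (Q s z - Q t z - (Q s 0 - Q t 0)) <= 0 * nr (z - 0 : C).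
    by rewrite Qs0 Qt0 subrr [X in nr X]subr0 mul0r.
  apply: (@diff_mvi _ _ _ (fun y : C => Q s y - Q t y) 0 m 0).
  - move=> y ym; have [d1 _] := Qs _ (ms _ ym); have [d2 _] := Qt _ (mt _ ym).
    exact: (@differentiableB _ _ _ (Q s) (Q t) y d1 d2).
  - move=> y h ym; have [d1 E1] := Qs _ (ms _ ym); have [d2 E2] := Qt _ (mt _ ym).
    have -> : 'd (fun y => Q s y - Q t y) y h = 0.
      apply: etrans (diffBE h d1 d2) _.
      by apply: etrans (congr2 (fun a b => a - b) (E1 h) (E2 h)) _; rewrite subrr.
    by rewrite nr0 mul0r.
  - by rewrite subr0 nr0 lt_min; case/andP: sr => ->; case/andP: tr => ->.
  - by rewrite subr0 lt_min zs zt.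
pose rho (z : C) := (nr z + r) / 2.
have rhoP (z : C) : nr z < r -> [/\ 0 < rho z < r & nr z < rho z].
  by move=> zr; have := nr_ge0 z; split; rewrite /rho; lra.
exists (fun z => Q (rho z) z); split.
  have [|h _] := rhoP 0; first by rewrite nr0.
  by have [-> _] := QP _ h.
move=> z zr; have [h1 h2] := rhoP z zr.
have [_ /(_ z h2)[dz dE]] := QP _ h1.
have N : \forall y \near z, Q (rho z) y = Q (rho y) y.
  apply/nbhs_nrP; exists (rho z - nr z); first by rewrite subr_gt0.
  move=> y yz; have yr : nr y < rho z by have := nr_subD y z; lra.
  case/andP: (h1) => _ h3; have [h4 h5] := rhoP y (lt_trans yr h3).
  exact: Q_eq.
have [d' dE'] := near_eq_differentiable N dz.
split; first exact: d'.
by move=> h; exact: etrans (dE' h) (dE h).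
Qed.

Lemma primitive_rV n (f : C -> 'rV[C]_n) (r : R) : 0 < r ->
  (forall z, nr z < r -> differentiable f z) ->
  exists P : C -> 'rV[C]_n, P 0 = 0 /\ forall z, nr z < r ->
    differentiable P z /\ forall h, 'd P z h = h *: f z.
Proof.
move=> r0 df.
have loc i : exists P : C -> C, P 0 = 0 /\ forall z, nr z < r ->
    differentiable P z /\ forall h, 'd P z h = h * f z 0 i.
  apply: (@primitive (fun z => f z 0 i)) => // z zr.
  by have [] := differentiable_coordE i (df z zr).
have [P PP] := choice loc.
exists (fun z => \row_i P i z); split; first by apply/rowP => i; rewrite !mxE (PP i).1.
move=> z zr.
have E i : (fun y => (\row_i P i y) 0 i : C) = P i by apply/funext => y; rewrite mxE.
have [|d1 dE] := @differentiable_rV R _ n (fun z => \row_i P i z) z.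
  by move=> i; rewrite E; have [] := (PP i).2 z zr.
split; first exact: d1.
move=> h; apply/rowP => i; apply: etrans (dE h i) _; rewrite E mxE.
by have [_ H] := (PP i).2 z zr; exact: H.
Qed.

End Primitive.

(** * Compactness *)

Section CompactBalls.
Context {R : realType}.
Local Notation C := (cplx R).

Lemma closed_nr_ball (E : normedModType C) (x : E) (r : R) :
  closed [set y | nr (y - x) <= r].
Proof.
rewrite -openC openE => y /= /negP; rewrite -ltNge => yr.
apply/nbhs_nrP; exists (nr (y - x) - r); first by rewrite subr_gt0.
move=> z zy /=; apply/negP; rewrite -ltNge.
by have := nr_tri z y x; rewrite [nr (y - z)]nr_distC; lra.
Qed.

Lemma Cpt_continuous : continuous (fun p : R * R => Cpt p.1 p.2).
Proof.
move=> [a b] /= A /nbhs_nrP[e e0 eA].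
have e20 : 0 < e / 2 by rewrite divr_gt0.
exists (ball a (e / 2), ball b (e / 2)).
  by split; exact: nbhsx_ballx.
move=> [c d] [/= ac bd]; apply: eA; rewrite CptB (le_lt_trans (nr_Cpt _ _))//.
move: ac bd; rewrite /ball/= => ac bd.
by rewrite [ltRHS]splitr [`|c - a|]distrC [`|d - b|]distrC ltrD.
Qed.

Lemma compact_disc (z : C) (r : R) : compact [set y | nr (y - z) <= r].
Proof.
pose M := nr z + r.
apply: (@subclosed_compact _ _
  ((fun p : R * R => Cpt p.1 p.2) @` (`[- M, M] `*` `[- M, M]))).
- exact: closed_nr_ball.
- apply: continuous_compact.
    by apply: continuous_subspaceT; exact: Cpt_continuous.
  by apply: compact_setX; exact: segment_compact.
move=> y /= yz; exists (Rez y, Imz y); last by rewrite /= -CptE.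
have yM : nr y <= M by have := nr_subD y z; rewrite /M; lra.
have := Re_le_nr y; have := Im_le_nr y; rewrite !ler_norml => h1 h2.
by split; rewrite /= in_itv/=; lra.
Qed.

Lemma compact_nr_ball n (x : 'rV[C]_n) (r : R) :
  compact [set y | nr (y - x) <= r].
Proof.
have [r0|r0] := leP 0 r; last first.
  rewrite (_ : [set y | _] = set0); first exact: compact0.
  by apply/seteqP; split => // y /= yr; have := nr_ge0 (y - x); lra.
rewrite (_ : [set y | _] =
   [set v : 'rV[C]_n | forall i, [set y : C | nr (y - x 0 i) <= r] (v ord0 i)]).
  exact: (@rV_compact C n (fun i => [set y : C | nr (y - x 0 i) <= r])
    (fun i => @compact_disc (x 0 i) r)).
apply/seteqP; split=> y /= yr.
  by move=> i; have := nr_coord (y - x) i; rewrite !mxE => /le_trans; exact.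
by apply: nr_rV_le => // i; rewrite !mxE; exact: yr.
Qed.

End CompactBalls.

Section Metric.
Context {R : realType} {N : topologicalType} (d : N -> N -> R).
Hypothesis dP : is_distance d.

Lemma dist_ge0 x y : 0 <= d x y. Proof. by case: dP. Qed.
Lemma dist0 x y : d x y = 0 -> x = y. Proof. by case: dP => _ /(_ x y)[]. Qed.
Lemma distC x y : d x y = d y x. Proof. by case: dP. Qed.
Lemma dist_tri y x z : d x z <= d x y + d y z. Proof. by case: dP. Qed.

Lemma nbhs_distP x (V : set N) :
  nbhs x V <-> exists2 e : R, 0 < e & [set y | d x y < e] `<=` V.
Proof. by case: dP. Qed.

Lemma dist_ball_nbhs x (e : R) : 0 < e -> \forall y \near x, d x y < e.
Proof. by move=> e0; apply/nbhs_distP; exists e. Qed.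

Lemma dist_continuousP (T : topologicalType) (f : T -> N) x :
  {for x, continuous f} <->
  forall e : R, 0 < e -> \forall y \near x, d (f x) (f y) < e.
Proof.
split=> [fc e e0|fd A /nbhs_distP[e e0 eA]].
  exact: (fc _ (dist_ball_nbhs (f x) e0)).
by apply: filterS (fd e e0) => y; exact: eA.
Qed.

(** The limit is taken along an ultrafilter finer than the Frechet filter;
    equicontinuity makes this convergence uniform on compact sets, so that indices
    realizing it up to smaller and smaller errors can be picked one after another. *)
Theorem ascoli_subsequence (X : topologicalType) (K : nat -> set X) (g : nat -> X -> N) :
  compact [set: N] -> (forall k, compact (K k)) ->
  (forall k x, K k x -> forall e : R, 0 < e ->
     \forall y \near x & j \near \oo, d (g j y) (g j x) < e) ->
  exists s : nat -> nat, {homo s : i j / (i < j)%N} /\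
    exists phi : X -> N, forall k (e : R), 0 < e ->
      \forall j \near \oo, forall x, K k x -> d (g (s j) x) (phi x) < e.
Proof.
move=> Nc Kc geq.
have [U [UU ooU]] := @ultraFilterLemma nat \oo _.
have UP : ProperFilter U by exact: ultra_proper.
have lim x : exists p : N, forall e : R, 0 < e -> U [set j | d (g j x) p < e].
  have [p [_ pP]] := Nc (fmap (g ^~ x) U) _ filterT.
  exists p => e e0.
  have [//|nU] := in_ultra_setVsetC [set j | d (g j x) p < e] UU.
  have [q [/= qe]] := pP [set q | ~ d q p < e] _ nU (dist_ball_nbhs p e0).
  by rewrite distC.
have [phi phiP] := choice lim.
have unif k (e : R) : 0 < e -> U [set j | forall x, K k x -> d (g j x) (phi x) < e].
  move=> e0; have e40 : 0 < e / 4 by rewrite divr_gt0.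
  have /compact_near_coveringP := Kc k.
  move=> /(_ _ U (fun j x => d (g j x) (phi x) < e) _); apply => x Kx.
  have [[V J] /= [Vx JJ] VJ] := geq k x Kx _ e40.
  have J' : U J by exact: ooU.
  exists (V, J `&` [set j | d (g j x) (phi x) < e / 4]) => /=.
    by split=> //; apply: filterI => //; exact: phiP.
  move=> [y j] [/= Vy [Jj gx]].
  have e80 : 0 < e / 8 by rewrite divr_gt0.
  have [i [[Ji h1] h2]] := filter_ex (filterI (filterI J' (phiP y _ e80)) (phiP x _ e80)).
  have h3 := VJ (y, i) (conj Vy Ji); have h4 := VJ (y, j) (conj Vy Jj).
  rewrite /= in h1 h2 h3 h4 gx.
  have t1 := dist_tri (g j x) (g j y) (phi y).
  have t2 := dist_tri (phi x) (g j x) (phi y).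
  have t3 := dist_tri (g i x) (phi x) (phi y).
  have t4 := dist_tri (g i y) (g i x) (phi y).
  rewrite [d (phi x) (g i x)]distC [d (g i x) (g i y)]distC in t3 t4.
  lra.
have pickP (p : nat * nat) : exists j, (p.2 < j)%N /\ forall k, (k <= p.1)%N ->
    forall x, K k x -> d (g j x) (phi x) < p.1.+1%:R^-1.
  case: p => i n /=.
  have H k : (k <= i)%N -> U [set j | (n < j)%N /\ forall l, (l < k.+1)%N ->
      forall x, K l x -> d (g j x) (phi x) < i.+1%:R^-1].
    elim: k => [_|k IH ki].
      have i0 : 0 < (i.+1%:R : R)^-1 by rewrite invr_gt0.
      have nU : U [set j | (n < j)%N] by apply: ooU; exists n.+1.
      apply: filterS (filterI nU (unif 0%N _ i0)) => j [nj gj]; split=> // l.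
      by rewrite ltnS leqn0 => /eqP ->.
    have i0 : 0 < (i.+1%:R : R)^-1 by rewrite invr_gt0.
    apply: filterS (filterI (IH (ltnW ki)) (unif k.+1 _ i0)) => j [[nj gj] gk].
    split=> // l; rewrite ltnS leq_eqVlt => /orP[/eqP ->//|]; exact: gj.
  by have [j [nj gj]] := filter_ex (H i (leqnn i)); exists j.
have [pick pP] := choice pickP.
pose s := fix s i := if i is i'.+1 then pick (i'.+1, s i') else pick (0%N, 0%N).
have sS i : (s i < s i.+1)%N by have [] := pP (i.+1, s i).
have sP i k : (k <= i)%N -> forall x, K k x -> d (g (s i) x) (phi x) < i.+1%:R^-1.
  by case: i => [|i]; [have [_] := pP (0%N, 0%N)|have [_] := pP (i.+1, s i)]; apply.
exists s; split.
  by apply: homo_ltn => // y x z; exact: ltn_trans.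
exists phi => k e e0.
have [M MP] : exists M : nat, (M.+1%:R : R)^-1 < e.
  exists (Num.truncn e^-1); rewrite invf_plt ?posrE// truncnS_gt//.
exists (maxn k M) => // i /=; rewrite geq_max => /andP[ki Mi] x Kx.
apply: lt_trans (sP i k ki x Kx) _; apply: le_lt_trans MP.
by rewrite lef_pV2 ?posrE// ler_nat.
Qed.

End Metric.

(** * Calculus of differentials *)

Section IsDifferential.
Context {R : realType}.
Local Notation C := (cplx R).
Implicit Types U V W : normedModType C.

(** A relational form of ['d f x], convenient for chain rules. *)
Definition isd V W (f : V -> W) (x : V) (L : V -> W) :=
  differentiable f x /\ forall h, 'd f x h = L h.

Lemma isd_diff V W (f : V -> W) x : differentiable f x -> isd f x ('d f x).
Proof. by split. Qed.

Lemma isd_uniq V W (f : V -> W) x L L' : isd f x L -> isd f x L' ->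
  forall h, L h = L' h.
Proof. by move=> [_ E] [_ E'] h; exact: etrans (esym (E h)) (E' h). Qed.

Lemma isd_near V W (f g : V -> W) x L : (\forall y \near x, f y = g y) ->
  isd f x L -> isd g x L.
Proof.
move=> fg [df E]; have [dg E'] := near_eq_differentiable fg df.
by split; [exact: dg|move=> h; exact: etrans (E' h) (E h)].
Qed.

Lemma isd_eq V W (f : V -> W) x L L' : (forall h, L h = L' h) ->
  isd f x L -> isd f x L'.
Proof. by move=> LL [df E]; split; [exact: df|move=> h; rewrite -LL; exact: E]. Qed.

Lemma isd_comp U V W (f : U -> V) (g : V -> W) x L M :
  isd f x L -> isd g (f x) M -> isd (fun y => g (f y)) x (fun h => M (L h)).
Proof.
move=> [df E] [dg E']; split; first exact: (@differentiable_comp _ _ _ _ f g).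
move=> h; apply: etrans (congr1 (@^~ h) (diff_comp df dg)) _.
exact: etrans (E' _) (congr1 M (E h)).
Qed.

Lemma isd_affine V W (f : V -> W) x (L : V -> W) (M : R) : linear L ->
  (forall h, nr (L h) <= M * nr h) -> (forall y, f y - f x = L (y - x)) -> isd f x L.
Proof.
move=> Llin LM fE; apply: (nr_differentiable Llin LM) => e e0.
by exists 1 => // y _; rewrite fE subrr nr0 mulr_ge0 ?nr_ge0// ltW.
Qed.

Lemma isd_id V (x : V) : isd id x id.
Proof. by apply: (@isd_affine _ _ _ _ _ 1) => // h; rewrite mul1r. Qed.

Lemma isd_cst V W (c : W) (x : V) : isd (fun=> c) x (fun=> 0).
Proof.
apply: (@isd_affine _ _ _ _ _ 0) => [a u v|h|y].
- by rewrite scaler0 addr0.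
- by rewrite nr0 mul0r.
- by rewrite subrr.
Qed.

Lemma isdD V W (f g : V -> W) x L M : isd f x L -> isd g x M ->
  isd (fun y => f y + g y) x (fun h => L h + M h).
Proof.
move=> [df E] [dg E']; split; first exact: (@differentiableD _ _ _ f g).
move=> h; have H : 'd (fun y => f y + g y) x h = 'd f x h + 'd g x h.
  exact: (congr1 (@^~ h) (@diffD _ _ _ f g x df dg)).
by apply: etrans H _; congr (_ + _); [exact: E|exact: E'].
Qed.

Lemma isdZ V W (f : V -> W) x L (k : C) : isd f x L ->
  isd (fun y => k *: f y) x (fun h => k *: L h).
Proof.
move=> [df E]; split; first exact: (@differentiableZ _ _ _ f).
move=> h; have H : 'd (fun y => k *: f y) x h = k *: 'd f x h.
  exact: (congr1 (@^~ h) (@diffZ _ _ _ f k x df)).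
by apply: etrans H _; congr (_ *: _); exact: E.
Qed.

Lemma isdB V W (f g : V -> W) x L M : isd f x L -> isd g x M ->
  isd (fun y => f y - g y) x (fun h => L h - M h).
Proof.
move=> [df E] [dg E']; split; first exact: (@differentiableB _ _ _ f g).
move=> h; apply: etrans (diffBE h df dg) _.
by congr (_ - _); [exact: E|exact: E'].
Qed.

Lemma isd_pair U V W (f : U -> V) (g : U -> W) x L M : isd f x L -> isd g x M ->
  isd (fun y => (f y, g y)) x (fun h => (L h, M h)).
Proof.
move=> [df E] [dg E']; split; first exact: (@differentiable_pair _ _ _ _ f g).
move=> h; have H : 'd (fun y => (f y, g y)) x h = ('d f x h, 'd g x h).
  exact: (congr1 (@^~ h) (@diff_pair _ _ _ _ f g x df dg)).
by apply: etrans H _; congr (_, _); [exact: E|exact: E'].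
Qed.

Lemma isd_continuous V W (f : V -> W) x L : isd f x L -> {for x, continuous f}.
Proof. by move=> [df _]; exact: differentiable_continuous. Qed.

End IsDifferential.

(** * Manifolds, tangent vectors and translations in charts *)

Section Charts.
Context {R : realType}.
Local Notation C := (cplx R).
Variables (E : normedModType C) (M : topologicalType) (A : atlas E M).

Lemma chart_near (p : M) (a : chart E M) : chart_at A p a ->
  \forall q \near p, chart_at A q a.
Proof.
move=> [Aa ap]; apply: filterS (open_nbhs_nbhs (conj (chart_dom_open a) ap)).
by move=> q aq; split.
Qed.

Lemma chart_at_inv (a : chart E M) (p : M) : chart_at A p a ->
  \forall y \near a p, chart_at A (chart_inv a y) a /\ a (chart_inv a y) = y.
Proof.
move=> [Aa ap]; have iap : (a @` chart_dom a) (a p) by exists p.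
apply: filterS (open_nbhs_nbhs (conj (chart_img_open a) iap)).
by move=> _ [q aq <-]; rewrite chart_funK.
Qed.

Lemma tangent_ext (p : M) (v w : tangent A p) (c : chart E M) :
  chart_at A p c -> v c = w c -> v = w.
Proof.
move=> cp vw; apply/val_inj/funext => b /=.
have /asboolP[vt v0] := valP v; have /asboolP[wt w0] := valP w.
have [bp|nbp] := pselect (chart_at A p b); last by rewrite v0// w0.
exact: (etrans (vt c b cp bp) (etrans (congr1 _ vw) (esym (wt c b cp bp)))).
Qed.

Lemma tangent_sumE (p : M) n (z : 'I_n -> C) (v : 'I_n -> tangent A p) c :
  (\sum_(i < n) z i *: v i) c = \sum_(i < n) z i *: v i c.
Proof.
have D : {morph (fun v : tangent A p => v c) : x y / x + y} by [].
by rewrite (big_morph (fun v : tangent A p => v c) D (erefl : (0 : tangent A p) c = 0)).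
Qed.

End Charts.

Section StdMaps.
Context {R : realType}.
Local Notation C := (cplx R).
Variables (E F : normedModType C) (N : topologicalType) (B : atlas F N).

Lemma std_cdiffP (f : E -> N) (x : E) :
  cdiff_at (std_atlas E) B f x <-> {for x, continuous f} /\
  forall b, chart_at B (f x) b -> differentiable (fun y => b (f y)) x.
Proof.
split=> [[fc fd]|[fc fd]]; split=> //.
  by move=> b bx; exact: (fd (std_chart E) b (conj erefl I) bx).
by move=> a b [-> _] bx; exact: fd.
Qed.

Lemma cdiff_one_chart (f : E -> N) (x : E) b : {for x, continuous f} ->
  chart_at B (f x) b -> differentiable (fun y => b (f y)) x ->
  cdiff_at (std_atlas E) B f x.
Proof.
move=> fc [Bb bx] df; apply/std_cdiffP; split=> // b' [Bb' b'x].
have d1 := isd_comp (isd_diff df) (isd_diff (atlas_compat Bb Bb' bx b'x)).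
have H : \forall y \near x, chart_dom b (f y).
  exact: (fc _ (open_nbhs_nbhs (conj (chart_dom_open b) bx))).
have H' : \forall y \near x, b' (chart_inv b (b (f y))) = b' (f y).
  by apply: filterS H => y by_; rewrite chart_funK.
by have [] := isd_near H' d1.
Qed.

End StdMaps.

Section LieCharts.
Context {R : realType} {m : nat} (G : complexLieGroup R m).
Local Notation C := (cplx R).
Local Notation A := (cs_atlas (lie_struct G)).
Local Notation E := 'rV[C]_m.

Lemma mulg_continuous (p q : G) : {for (p, q), continuous (fun gh : G * G => (gh.1 * gh.2)%g)}.
Proof. by have [] := @lie_mul_holomorphic _ _ G (p, q) I. Qed.

Lemma invg_continuous (p : G) : {for p, continuous (fun g : G => (g^-1)%g)}.
Proof. by have [] := @lie_inv_holomorphic _ _ G p I. Qed.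

Lemma lmul_continuous (g p : G) : {for p, continuous (fun h : G => (g * h)%g)}.
Proof.
apply: (@continuous_comp _ _ _ (fun h : G => (g, h)) (fun gh : G * G => (gh.1 * gh.2)%g)).
  by apply: cvg_pair; [exact: cvg_cst|exact: cvg_id].
exact: mulg_continuous.
Qed.

Definition chart_mul (a b c : chart E G) (xy : E * E) : E :=
  c (chart_inv a xy.1 * chart_inv b xy.2)%g.

Lemma chart_mul_differentiable a b c (p q : G) :
  chart_at A p a -> chart_at A q b -> chart_at A (p * q)%g c ->
  differentiable (chart_mul a b c) (a p, b q).
Proof.
move=> [Aa ap] [Ab bq] cpq.
have [_ H] := @lie_mul_holomorphic _ _ G (p, q) I.
apply: (H (prod_chart a b) c) cpq.
by split; [exists a, b|].
Qed.

Lemma chart_mul_differentiable_near a b c (p q : G) :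
  chart_at A p a -> chart_at A q b -> chart_at A (p * q)%g c ->
  exists2 r : R, 0 < r & forall xy : E * E, nr (xy - (a p, b q)) < r ->
    [/\ chart_at A (chart_inv a xy.1) a, a (chart_inv a xy.1) = xy.1,
        chart_at A (chart_inv b xy.2) b, b (chart_inv b xy.2) = xy.2 &
        chart_at A (chart_inv a xy.1 * chart_inv b xy.2)%g c /\
        differentiable (chart_mul a b c) xy].
Proof.
move=> ap bq cpq.
have na := chart_at_inv ap; have nb := chart_at_inv bq.
have nc : \forall xy \near (a p, b q),
    chart_at A (chart_inv a xy.1 * chart_inv b xy.2)%g c.
  have ca : {for (a p, b q), continuous (fun xy : E * E => (chart_inv a xy.1, chart_inv b xy.2))}.
    apply: (@cvg_pair _ _ _ _ (nbhs (chart_inv a (a p))) (nbhs (chart_inv b (b q)))).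
      apply: (@cvg_comp _ _ _ fst (chart_inv a)); first exact: cvg_fst.
      by apply: chart_inv_cont; exists p => //; case: ap.
    apply: (@cvg_comp _ _ _ snd (chart_inv b)); first exact: cvg_snd.
    by apply: chart_inv_cont; exists q => //; case: bq.
  have := @continuous_comp _ _ _ _ _ (a p, b q) ca (@mulg_continuous _ _).
  rewrite /= => H; apply: (H (fun h => chart_at A h c)) => /=.
  by rewrite !chart_funK; [exact: chart_near|case: bq|case: ap].
have /nbhs_nrP[r1 r10 r1P] := na; have /nbhs_nrP[r2 r20 r2P] := nb.
have /nbhs_nrP[r3 r30 r3P] := nc.
exists (Num.min (Num.min r1 r2) r3); first by rewrite !lt_min r10 r20.
move=> [x y]; rewrite !lt_min -[_ - _]/((x - a p, y - b q) : E * E).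
move=> /andP[/andP[h1 h2] h3].
have {}h1 : nr (x - a p) < r1 by move: h1; rewrite nr_pair gt_max => /andP[].
have {}h2 : nr (y - b q) < r2 by move: h2; rewrite nr_pair gt_max => /andP[].
have [cx Ex] := r1P _ h1; have [cy Ey] := r2P _ h2; have cxy := r3P (x, y) h3.
split=> //=; split=> //.
by have := chart_mul_differentiable cx cy cxy; rewrite Ex Ey.
Qed.

End LieCharts.

(** * Left-invariant fields and their integral curves in charts *)

Section LeftInvariant.
Context {R : realType} {m : nat} (G : complexLieGroup R m).
Local Notation C := (cplx R).
Local Notation A := (cs_atlas (lie_struct G)).
Local Notation E := 'rV[C]_m.
Local Open Scope group_scope.
Local Open Scope ring_scope.

Definition chart1 : chart E G := pref_chart A (1 : G)%g.
Local Notation b0 := chart1.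
Local Notation e0 := (b0 (1 : G)%g).

Lemma chart1P : chart_at A (1 : G)%g b0.
Proof. exact: pref_chartP. Qed.

Lemma chart1K : chart_inv b0 e0 = 1%g.
Proof. by rewrite chart_funK//; case: chart1P. Qed.

Lemma lmul_differentiable a c (g p : G) : chart_at A p a -> chart_at A (g * p)%g c ->
  differentiable (fun y => c (g * chart_inv a y)%g) (a p).
Proof.
move=> ap cgp; have a'g := pref_chartP A g; set a' := pref_chart A g in a'g.
have dm := chart_mul_differentiable a'g ap cgp.
have := isd_comp (isd_pair (isd_cst (a' g) (a p)) (isd_id (a p))) (isd_diff dm).
have E1 y : chart_mul a' a c (a' g, y) = c (g * chart_inv a y)%g.
  by rewrite /chart_mul /= chart_funK//; case: a'g.
by move=> /isd_near H; have [] := H _ (filterS (fun y _ => E1 y) filterT).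
Qed.

Lemma lmul_cdiff (g p : G) : cdiff_at A A (fun h : G => (g * h)%g) p.
Proof.
split=> [|a c ap cgp]; first exact: lmul_continuous.
exact: lmul_differentiable.
Qed.

(** The value at [h], in the chart [c], of the left-invariant field whose value at the
    identity is [w] in the chart [chart1]. *)
Definition lvec (c : chart E G) (h : G) (w : E) : E :=
  'd (fun y => c (h * chart_inv b0 y)%g) e0 w.

Lemma lvec_isd c (h : G) : chart_at A h c ->
  isd (fun y => c (h * chart_inv b0 y)%g) e0 (lvec c h).
Proof.
move=> ch; apply: isd_diff; apply: lmul_differentiable; first exact: chart1P.
by rewrite mulg1.
Qed.

(** Left invariance, from the chain rule. *)
Lemma lvec_lmul c c' (g h : G) w : chart_at A h c' -> chart_at A (g * h)%g c ->
  lvec c (g * h)%g w = 'd (fun y => c (g * chart_inv c' y)%g) (c' h) (lvec c' h w).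
Proof.
move=> c'h cgh.
have E1 : c' (h * chart_inv b0 e0)%g = c' h by rewrite chart1K mulg1.
have d1 := lvec_isd c'h.
have d2 := isd_diff (lmul_differentiable c'h cgh); rewrite -{1}E1 in d2.
have d12 := isd_comp d1 d2.
have nE : \forall y \near e0, c (g * chart_inv c' (c' (h * chart_inv b0 y)))%g =
    c (g * h * chart_inv b0 y)%g.
  have cont : {for e0, continuous (fun y => (h * chart_inv b0 y)%g)}.
    apply: (@continuous_comp _ _ _ (chart_inv b0) (fun k : G => (h * k)%g)).
      by apply: chart_inv_cont; exists (1%g) => //; case: chart1P.
    exact: lmul_continuous.
  have nd : \forall y \near e0, chart_dom c' (h * chart_inv b0 y)%g.
    apply: cont; rewrite chart1K mulg1.
    by apply: open_nbhs_nbhs; split; [exact: chart_dom_open|case: c'h].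
  by apply: filterS nd => y /chart_funK ->; rewrite mulgA.
exact: isd_uniq (lvec_isd cgh) (isd_near nE d12) w.
Qed.

Lemma lvec_transition c c' (h : G) w : chart_at A h c' -> chart_at A h c ->
  lvec c h w = 'd (fun y => c (chart_inv c' y)) (c' h) (lvec c' h w).
Proof.
move=> c'h ch.
have ch1 : chart_at A (1 * h)%g c by rewrite mul1g.
have E1 : (fun y => c (1 * chart_inv c' y)%g) = (fun y => c (chart_inv c' y)).
  by apply/funext => y; rewrite mul1g.
by have := lvec_lmul w c'h ch1; rewrite E1 mul1g.
Qed.

(** [gamma] is at time [t] an integral curve of the left-invariant field generated
    by [w]. *)
Definition integral_at (w : E) (gamma : C -> G) (t : C) :=
  {for t, continuous gamma} /\ forall c, chart_at A (gamma t) c ->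
    isd (fun s => c (gamma s)) t (fun h => h *: lvec c (gamma t) w).

Lemma integral_at_near (w : E) (gamma eta : C -> G) (t : C) : (\forall s \near t, gamma s = eta s) ->
  integral_at w gamma t -> integral_at w eta t.
Proof.
move=> ge [gc gd]; have gt : gamma t = eta t by exact: nbhs_singleton ge.
split=> [B|c]; rewrite -gt.
  by move=> /gc H; apply: filterS2 ge H => s /= ->.
move=> /gd H; have nE : \forall s \near t, c (gamma s) = c (eta s).
  by apply: filterS ge => s ->.
exact: isd_near nE H.
Qed.

Lemma integral_at_chart (w : E) (gamma : C -> G) (t : C) c : {for t, continuous gamma} ->
  chart_at A (gamma t) c ->
  isd (fun s => c (gamma s)) t (fun h => h *: lvec c (gamma t) w) ->
  integral_at w gamma t.
Proof.
move=> gc [Ac ct] dc; split; first exact: gc.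
move=> c' [Ac' c't].
have d2 := isd_diff (atlas_compat Ac Ac' ct c't).
have d12 := isd_comp dc d2.
have nE : \forall s \near t, (c' \o chart_inv c) (c (gamma s)) = c' (gamma s).
  have H : \forall s \near t, chart_dom c (gamma s).
    exact: (gc _ (open_nbhs_nbhs (conj (chart_dom_open c) ct))).
  by apply: filterS H => s /= cs; rewrite chart_funK.
apply: isd_eq (isd_near nE d12) => h; rewrite linearZ/=; congr (_ *: _).
by apply: esym; apply: lvec_transition.
Qed.

Lemma integral_at_lmul (w : E) (gamma : C -> G) (t : C) g : integral_at w gamma t ->
  integral_at w (fun s => (g * gamma s)%g) t.
Proof.
move=> [gc gd].
have gc' : {for t, continuous (fun s => (g * gamma s)%g)}.
  apply: (@continuous_comp _ _ _ gamma (fun k : G => (g * k)%g)) => //.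
  exact: lmul_continuous.
split; first exact: gc'.
move=> c cgt; have c't := pref_chartP A (gamma t).
set c' := pref_chart A (gamma t) in c't.
have d1 := gd c' c't; have d2 := isd_diff (lmul_differentiable c't cgt).
have nE : \forall s \near t, c (g * chart_inv c' (c' (gamma s)))%g = c (g * gamma s)%g.
  have H : \forall s \near t, chart_at A (gamma s) c' by exact: (gc _ (chart_near c't)).
  by apply: filterS H => s [_ cs]; rewrite chart_funK.
apply: isd_eq (isd_near nE (isd_comp d1 d2)) => h; rewrite linearZ/=; congr (_ *: _).
by apply: esym; apply: lvec_lmul.
Qed.

Lemma integral_at_shift (w : E) (gamma : C -> G) (t k : C) : integral_at w gamma (t + k) ->
  integral_at w (fun s => gamma (s + k)) t.
Proof.
move=> [gc gd].
have dk : isd (fun s : C => s + k) t id.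
  by apply: isd_eq (isdD (isd_id t) (isd_cst k t)) => h; rewrite addr0.
split=> [|c ct].
  apply: (@continuous_comp _ _ _ (fun s => s + k) gamma) => //.
  exact: isd_continuous dk.
exact: (isd_comp dk (gd c ct)).
Qed.

Lemma dL_e_chart (g : G) (v : tangent A (1 : G)%g) a : chart_at A g a ->
  dL_e g v a = lvec a g (v b0).
Proof.
move=> ag; rewrite /dL_e.
by rewrite (tdiffE (mulg1 g : (fun k : G => g * k)%g 1%g = g) v (lmul_cdiff g 1%g) chart1P ag).
Qed.

Lemma left_invariant_field_chart (g h : G) (k : C) (v : tangent A (1 : G)%g) c :
  chart_at A h c ->
  left_invariant_field (k *: dL_e g v) h c = k *: lvec c h (v b0).
Proof.
move=> ch; rewrite /left_invariant_field.
have ag := pref_chartP A g; set a := pref_chart A g in ag.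
rewrite (tdiffE (divgK g h : (fun k : G => h / g * k)%g g = h) (k *: dL_e g v)
  (lmul_cdiff (h / g)%g g) ag ch).
have -> : (k *: dL_e g v) a = k *: dL_e g v a by [].
rewrite dL_e_chart// linearZ/=; congr (_ *: _).
have chg : chart_at A (h / g * g)%g c by rewrite divgK.
by have := lvec_lmul (v b0) ag chg; rewrite divgK => ->.
Qed.

Lemma velocity_chart (gamma : C -> G) (t : C) c :
  cdiff_at (std_atlas C) A gamma t -> chart_at A (gamma t) c ->
  velocity gamma t c = 'd (fun s => c (gamma s)) t 1.
Proof.
move=> dg ct; rewrite /velocity.
have st : chart_at (std_atlas C) t (std_chart C) by split.
by rewrite (tdiffE (erefl (gamma t)) _ dg st ct) tangent_ofE.
Qed.

Lemma integral_at_cdiff (w : E) (gamma : C -> G) (t : C) : integral_at w gamma t ->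
  cdiff_at (std_atlas C) A gamma t.
Proof.
move=> [gc gd]; apply/std_cdiffP; split; first exact: gc.
by move=> b bt; have [] := gd b bt.
Qed.

Lemma lvecZ c (h : G) (k : C) w : lvec c h (k *: w) = k *: lvec c h w.
Proof. exact: linearZ. Qed.

Lemma lvec0 c (h : G) : lvec c h 0 = 0.
Proof. exact: linear0. Qed.

(** Written at the identity, the field generating the curve does not depend on the
    base point [g]. *)
Lemma is_exp_curveP (g : G) (k : C) (v : tangent A (1 : G)%g) (gamma : C -> G) :
  is_exp_curve (k *: dL_e g v) gamma <->
  gamma 0 = g /\ forall t, integral_at (k *: v b0) gamma t.
Proof.
split=> [[gh g0 gv]|[g0 gi]].
  split; first exact: g0.
  move=> t; have dg := gh t I; have /std_cdiffP[gc gd] := dg.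
  split; first exact: gc.
  move=> c ct; have dct := gd c ct.
  apply: isd_eq (isd_diff dct) => h; rewrite diff1E; congr (_ *: _).
  rewrite -velocity_chart// gv lvecZ; exact: left_invariant_field_chart.
have dg t := integral_at_cdiff (gi t).
split; [by move=> t _; exact: dg|exact: g0|move=> t].
have ct := pref_chartP A (gamma t).
apply: (tangent_ext ct); rewrite velocity_chart// left_invariant_field_chart//.
have [_ /(_ _ ct)[_ H]] := gi t.
by apply: etrans (H 1) _; rewrite scale1r lvecZ.
Qed.

End LeftInvariant.

(** * Differential equations in the complex domain *)

Section Vitali.
Context {R : realType}.
Local Notation C := (cplx R).

(** Bounded holomorphic maps are equi-Lipschitz, so that pointwise convergence is
    uniform on smaller balls, which are compact. *)
Lemma bounded_limit_differentiable m n (fs : nat -> 'rV[C]_m -> 'rV[C]_n)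
    (f : 'rV[C]_m -> 'rV[C]_n) (x0 : 'rV[C]_m) (r B : R) : 0 < r ->
  (forall k x, nr (x - x0) < r -> differentiable (fs k) x) ->
  (forall k x, nr (x - x0) < r -> nr (fs k x) <= B) ->
  (forall x, nr (x - x0) < r -> forall e : R, 0 < e -> exists N, forall k, (N <= k)%N ->
     nr (fs k x - f x) <= e) ->
  forall x, nr (x - x0) < r / 4 -> differentiable f x.
Proof.
move=> r0 dfs fsB cv.
have B0 : 0 <= B by rewrite (le_trans (nr_ge0 (fs 0%N x0)))// fsB// subrr nr0.
pose L := 8 * B / r; have L0 : 0 <= L by rewrite divr_ge0 ?mulr_ge0// ltW.
have lip k x y : nr (x - x0) < r / 2 -> nr (y - x0) < r / 2 ->
    nr (fs k y - fs k x) <= L * nr (y - x).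
  by move=> xr yr; apply: (diff_lipschitz r0 (dfs k) (fsB k)).
have sub x : nr (x - x0) < r / 2 -> nr (x - x0) < r by lra.
have lipf x y : nr (x - x0) < r / 2 -> nr (y - x0) < r / 2 ->
    nr (f y - f x) <= L * nr (y - x).
  move=> xr yr; apply: (@le_of_lim _ _ _ 2) => // e e0.
  have [N1 N1P] := cv x (sub _ xr) e e0; have [N2 N2P] := cv y (sub _ yr) e e0.
  pose k := maxn N1 N2.
  have h1 := N1P k (leq_maxl _ _); have h2 := N2P k (leq_maxr _ _).
  have h3 := nr_tri (fs k y) (f y) (f x); have h4 := nr_tri (fs k x) (fs k y) (f x).
  rewrite [nr (f y - fs k y)]nr_distC in h3; have h5 := lip k x y xr yr.
  by clear -h1 h2 h3 h4 h5; lra.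
have unif (e : R) : 0 < e -> exists N, forall k, (N <= k)%N ->
    forall x, nr (x - x0) <= r / 4 -> nr (fs k x - f x) <= e.
  move=> e0; have /compact_near_coveringP := @compact_nr_ball R m x0 (r / 4).
  move=> /(_ _ \oo (fun k x => nr (fs k x - f x) <= e) _) [x /= xr|N _ NP]; last first.
    by exists N => k Nk x; exact: (NP k Nk x).
  have e30 : 0 < e / 3 by rewrite divr_gt0.
  have xr2 : nr (x - x0) < r / 2 by lra.
  have [N NP] := cv x (sub _ xr2) _ e30.
  pose d := Num.min (r / 4) (e / 3 / (L + 1)).
  have L1 : 0 < L + 1 by rewrite ltr_wpDl.
  have d0 : 0 < d by rewrite lt_min !divr_gt0.
  exists ([set y | nr (y - x) < d], [set k | (N <= k)%N]) => /=.
    by split; [apply/nbhs_nrP; exists d|exists N].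
  move=> [y k] [/= yd Nk]; have := yd; rewrite lt_min => /andP[y1].
  rewrite ltr_pdivlMr// => y2.
  have yr2 : nr (y - x0) < r / 2 by have := nr_tri x y x0; lra.
  have h1 := lip k x y xr2 yr2; have h2 := lipf x y xr2 yr2; have h3 := NP k Nk.
  have h4 : L * nr (y - x) <= e / 3.
    by rewrite mulrC (le_trans _ (ltW y2))// ler_wpM2l ?nr_ge0// lerDl.
  have h5 := nr_tri (fs k x) (fs k y) (f y); have h6 := nr_tri (f x) (fs k x) (f y).
  rewrite [nr (f x - f y)]nr_distC in h6; clear -h1 h2 h3 h4 h5 h6; lra.
move=> x xr.
have r'0 : 0 < r / 4 - nr (x - x0) by rewrite subr_gt0.
have sub' y : nr (y - x) < r / 4 - nr (x - x0) -> nr (y - x0) < r / 4.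
  by move=> yx; have := nr_tri x y x0; lra.
have [] := @weierstrass R _ n fs f x _ r'0 => //.
- by move=> k y /sub' yr; apply: dfs; lra.
- move=> e e0; have [N NP] := unif e e0; exists N => k Nk y /sub' yr.
  by apply: NP => //; exact: ltW.
Qed.

(** The partial differential is a limit of difference quotients, which are uniformly
    bounded holomorphic functions of the first variable. *)
Lemma partial_differentiable m n (F : 'rV[C]_m * 'rV[C]_m -> 'rV[C]_n) x0 y0 (r : R) w :
  0 < r ->
  (forall p : 'rV[C]_m * 'rV[C]_m, nr (p - (x0, y0)) < r -> differentiable F p) ->
  exists2 rho : R, 0 < rho & forall x, nr (x - x0) < rho ->
    differentiable (fun x => 'd (fun y => F (x, y)) y0 w) x.
Proof.
move=> r0 dF.
have pairE x y : nr ((x, y) - (x0, y0) : 'rV[C]_m * 'rV[C]_m) =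
    Num.max (nr (x - x0)) (nr (y - y0)).
  by rewrite -nr_pair.
have F0 : differentiable F (x0, y0) by apply: dF; rewrite subrr nr0.
have [K K0 KP] := diff_nr_bounded F0.
have [d d0 dP] := strict_differentiable r0 dF ltr01.
pose D := Num.min d r; have D0 : 0 < D by rewrite lt_min d0.
have lipF p q : nr (p - (x0, y0)) < D -> nr (q - (x0, y0)) < D ->
    nr (F q - F p) <= (K + 1) * nr (q - p).
  rewrite !lt_min => /andP[h1 _] /andP[h2 _].
  rewrite (le_trans (nr_subD _ ('d F (x0, y0) (q - p))))//.
  by rewrite mulrDl addrC lerD// dP.
have [N NP] : exists N : nat, nr w / N.+1%:R < D.
  exists (Num.truncn (nr w / D)); rewrite ltr_pdivrMr// mulrC -ltr_pdivrMr//.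
  exact: truncnS_gt.
have small k : (N <= k)%N -> nr w / k.+1%:R < D.
  move=> Nk; apply: le_lt_trans NP; rewrite ler_wpM2l ?nr_ge0//.
  by rewrite lef_pV2 ?posrE// ler_nat.
(* The increments [w / (N + k + 1)] are small enough for all the difference quotients
   to be defined on the ball of radius [D]. *)
pose c k : C := ((N + k).+1%:R : R)%:C.
have ck0 k : c k != 0 by rewrite -nr_eq0E nr_real normr_eq0 pnatr_eq0.
have nc k : nr (c k) = (N + k).+1%:R by rewrite nr_real ger0_norm.
have nvk k : nr ((c k)^-1 *: w) = nr w / (N + k).+1%:R by rewrite nrZ nrV nc mulrC.
pose Q k x := c k *: (F (x, y0 + (c k)^-1 *: w) - F (x, y0)).
have y0D x : nr (x - x0) < D -> nr ((x, y0) - (x0, y0) : 'rV[C]_m * 'rV[C]_m) < D.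
  by move=> xD; rewrite pairE subrr nr0 gt_max xD.
have ykD k x : nr (x - x0) < D ->
    nr ((x, y0 + (c k)^-1 *: w) - (x0, y0) : 'rV[C]_m * 'rV[C]_m) < D.
  move=> xD; rewrite pairE [y0 + _]addrC addrK nvk gt_max xD small//.
  exact: leq_addr.
have DF p : nr (p - (x0, y0)) < D -> differentiable F p.
  by rewrite lt_min => /andP[_ h]; exact: dF.
have dline x : nr (x - x0) < D -> isd (fun y => F (x, y)) y0 (fun h => 'd F (x, y0) (0, h)).
  move=> xD; apply: (isd_comp (isd_pair (isd_cst x y0) (isd_id y0))).
  exact/isd_diff/DF/y0D.
exists (D / 4); first by rewrite divr_gt0.
apply: (@bounded_limit_differentiable _ _ Q _ x0 D ((K + 1) * nr w)) => //.
- move=> k x xD; apply: (isdZ (c k) (isdB _ _)).1.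
  + apply: (isd_comp (isd_pair (isd_id x) (isd_cst _ x))).
    exact/isd_diff/DF/ykD.
  + apply: (isd_comp (isd_pair (isd_id x) (isd_cst _ x))).
    exact/isd_diff/DF/y0D.
- move=> k x xD; rewrite nrZ nc.
  have := lipF _ _ (y0D x xD) (ykD k x xD).
  have -> : nr ((x, y0 + (c k)^-1 *: w) - (x, y0) : 'rV[C]_m * 'rV[C]_m) = nr w / (N + k).+1%:R.
    have -> : (x, y0 + (c k)^-1 *: w) - (x, y0) = (0, (c k)^-1 *: w).
      by congr (_, _); rewrite /= ?subrr// addrC addKr.
    by rewrite nr_pair nr0 max_r ?nr_ge0.
  by rewrite mulrA ler_pdivlMr// mulrC.
- move=> x xD e e0; have [df dE] := dline x xD.
  have w1 : 0 < nr w + 1 by rewrite ltr_wpDl ?nr_ge0.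
  have [|d1 d10 d1P] := differentiable_nr df (_ : 0 < e / (nr w + 1)).
    by rewrite divr_gt0.
  exists (Num.truncn (nr w / d1)) => k Nk.
  have sk : nr w / (N + k).+1%:R < d1.
    rewrite ltr_pdivrMr// mulrC -ltr_pdivrMr//; apply: lt_le_trans (truncnS_gt _) _.
    by rewrite ler_nat ltnS (leq_trans Nk)// leq_addl.
  have := d1P (y0 + (c k)^-1 *: w); rewrite [y0 + _]addrC addrK nvk => /(_ sk).
  rewrite linearZ/= => H.
  have -> : Q k x - 'd (fun y => F (x, y)) y0 w =
      c k *: (F (x, (c k)^-1 *: w + y0) - F (x, y0) - (c k)^-1 *: 'd (fun y => F (x, y)) y0 w).
    by rewrite /Q [y0 + _]addrC [RHS]scalerBr scalerA divff// scale1r.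
  rewrite nrZ nc mulrC -ler_pdivlMr//; apply: le_trans H _.
  rewrite mulrA ler_wpM2r ?invr_ge0//.
  by rewrite mulrAC ler_pdivrMr// ler_pM2l// lerDl.
Qed.

End Vitali.

Section ODE.
Context {R : realType}.
Local Notation C := (cplx R).
Variable n : nat.
Local Notation E := 'rV[C]_n.

Section Picard.
Variables (X : E -> E) (x1 : E) (r M L tau : R).
Hypotheses (r0 : 0 < r) (t0 : 0 < tau) (M0 : 0 <= M) (L0 : 0 <= L).
Hypothesis dX : forall x, nr (x - x1) < r -> differentiable X x.
Hypothesis XM : forall x, nr (x - x1) < r -> nr (X x) <= M.
Hypothesis XL : forall x y, nr (x - x1) < r -> nr (y - x1) < r ->
  nr (X y - X x) <= L * nr (y - x).
Hypotheses (tauM : M * tau <= r / 2) (tauL : L * tau <= 2^-1).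

(** On the disc of radius [tau] an iteration of Picard's operator halves distances. *)
Lemma picard_contraction (c c' : C -> E) (u u' : C -> E) (s K : R) : s <= tau -> 0 <= K ->
  c 0 = c' 0 ->
  (forall t, nr t < s -> isd c t (fun h => h *: u t)) ->
  (forall t, nr t < s -> isd c' t (fun h => h *: u' t)) ->
  (forall t, nr t < s -> nr (u t - u' t) <= L * K) ->
  forall t, nr t < s -> nr (c t - c' t) <= K / 2.
Proof.
move=> st K0 cc' cu cu' uu' t ts.
have s0 : 0 < s by apply: le_lt_trans ts; exact: nr_ge0.
have D z : nr (z - 0 : C) < s -> isd (fun t => c t - c' t) z (fun h => h *: u z - h *: u' z).
  by rewrite subr0 => zs; apply: isdB; [exact: cu|exact: cu'].
have := @diff_mvi _ _ _ (fun t : C => c t - c' t) 0 s (L * K).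
have H1 z : nr (z - 0 : C) < s -> differentiable (fun t : C => c t - c' t) z.
  by move=> zs; have [] := D z zs.
have H2 (z h : C) : nr (z - 0) < s ->
    nr ('d (fun t : C => c t - c' t) z h) <= L * K * nr h.
  move=> zs; have [_ H] := D z zs; rewrite H -scalerBr nrZ mulrC.
  by rewrite ler_wpM2r ?nr_ge0// uu'//; rewrite subr0 in zs.
move=> /(_ H1 H2 0 t); rewrite !subr0 nr0 => /(_ s0 ts).
rewrite cc' subrr subr0 => /le_trans; apply.
rewrite mulrAC [K / 2]mulrC ler_wpM2r//.
by rewrite (le_trans _ tauL)// ler_wpM2l// ltW// (lt_le_trans ts).
Qed.

Lemma picard_unique (c c' : C -> E) (s : R) : s <= tau -> c 0 = c' 0 ->
  (forall t, nr t < s -> nr (c t - x1) < r /\ isd c t (fun h => h *: X (c t))) ->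
  (forall t, nr t < s -> nr (c' t - x1) < r /\ isd c' t (fun h => h *: X (c' t))) ->
  forall t, nr t < s -> c t = c' t.
Proof.
move=> st cc' cP c'P t ts; apply/eqP; rewrite -subr_eq0; apply/eqP/nr_eq0.
have H k : forall t, nr t < s -> nr (c t - c' t) <= (r + r) / 2 ^+ k.
  elim: k => [|k IH] z zs.
    rewrite expr0 divr1; have [h1 _] := cP z zs; have [h2 _] := c'P z zs.
    by rewrite (le_trans (nr_tri x1 _ _))// [nr (x1 - _)]nr_distC lerD// ltW.
  rewrite exprSr invfM mulrA.
  apply: (@picard_contraction c c' (fun t => X (c t)) (fun t => X (c' t)) s) => //.
  - by rewrite divr_ge0 ?exprn_ge0// addr_ge0// ltW.
  - by move=> y ys; have [] := cP y ys.
  - by move=> y ys; have [] := c'P y ys.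
  - move=> y ys; have [h1 _] := cP y ys; have [h2 _] := c'P y ys.
    by rewrite (le_trans (XL h2 h1))// ler_wpM2l// IH.
apply/le_anti; rewrite nr_ge0 andbT leNgt; apply/negP => n0.
have [|k /(_ k (leqnn k))] := dyadic_small (_ : 0 <= r + r) n0.
  by rewrite addr_ge0// ltW.
by rewrite ltNge H.
Qed.

(** Picard's iterates, built with primitives instead of integrals, stay in the ball of
    radius [r / 2] and converge uniformly; by [weierstrass] the limit is a solution. *)
Lemma picard_exists : exists c : C -> E, c 0 = x1 /\
  forall t, nr t < tau -> nr (c t - x1) < r /\ isd c t (fun h => h *: X (c t)).
Proof.
have prim (u : C -> E) : exists P : C -> E, (forall z, nr z < tau -> differentiable u z) ->
    P 0 = 0 /\ forall z, nr z < tau -> isd P z (fun h => h *: u z).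
  have [du|nd] := pselect (forall z, nr z < tau -> differentiable u z).
    by have [P PP] := primitive_rV t0 du; exists P.
  by exists (fun=> 0).
have [P PP] := choice prim.
pose c k := iter k (fun u t => x1 + P (fun s => X (u s)) t) (fun=> x1).
have cS k t : c k.+1 t = x1 + P (fun s => X (c k s)) t by [].
have step (u : C -> E) : (forall t, nr t < tau -> nr (u t - x1) < r /\ differentiable u t) ->
    let v := fun t => x1 + P (fun s => X (u s)) t in
    v 0 = x1 /\ (forall t, nr t < tau -> isd v t (fun h => h *: X (u t))) /\
    forall t, nr t < tau -> nr (v t - x1) <= r / 2.
  move=> uP v.
  have dXu z : nr z < tau -> differentiable (fun s => X (u s)) z.
    move=> zt; have [ur du] := uP z zt.
    by have [] := isd_comp (isd_diff du) (isd_diff (dX ur)).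
  have [P0 PE] := PP (fun s => X (u s)) dXu.
  have v0 : v 0 = x1 by rewrite /v P0 addr0.
  have dv t : nr t < tau -> isd v t (fun h => h *: X (u t)).
    by move=> tt; apply: isd_eq (isdD (isd_cst x1 t) (PE t tt)) => h; rewrite add0r.
  split; first exact: v0.
  split; first exact: dv.
  move=> t tt; have H1 z : nr (z - 0 : C) < tau -> differentiable v z.
    by rewrite subr0 => zt; have [] := dv z zt.
  have H2 (z h : C) : nr (z - 0) < tau -> nr ('d v z h) <= M * nr h.
    rewrite subr0 => zt; have [_ H] := dv z zt; rewrite H nrZ mulrC.
    by rewrite ler_wpM2r ?nr_ge0// XM//; have [] := uP z zt.
  have := @diff_mvi _ _ _ v 0 tau M H1 H2 0 t.
  rewrite !subr0 nr0 v0 => /(_ t0 tt) /le_trans; apply.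
  by rewrite (le_trans _ tauM)// ler_wpM2l// ltW.
have cP k : forall t, nr t < tau -> nr (c k t - x1) < r /\ differentiable (c k) t.
  elim: k => [|k IH] t tt.
    by split; [rewrite /c /= subrr nr0|exact: (isd_cst x1 t).1].
  have [_ [d1 b1]] := step _ IH.
  have b : nr (c k.+1 t - x1) <= r / 2 := b1 t tt.
  split; last exact: (d1 t tt).1.
  by apply: le_lt_trans b _; rewrite ltr_pdivrMr// ltr_pMr// ltr1n.
have c0 k : c k 0 = x1 by case: k => [//|k]; have [] := step _ (cP k).
have dc k t : nr t < tau -> isd (c k.+1) t (fun h => h *: X (c k t)).
  by have [_ [d1 _]] := step _ (cP k); exact: d1.
have cB t : nr t < tau -> nr (c 1%N t - x1) <= r / 2.
  by have [_ [_ b1]] := step _ (cP 0%N); exact: b1.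
have diffk k : forall t, nr t < tau -> nr (c k.+1 t - c k t) <= r / 2 / 2 ^+ k.
  elim: k => [|k IH] t tt; first by rewrite expr0 divr1; exact: cB.
  rewrite exprSr invfM mulrA.
  have K0 : 0 <= r / 2 / 2 ^+ k by rewrite !divr_ge0 ?exprn_ge0// ltW.
  have E0 : c k.+2 0 = c k.+1 0 by rewrite !c0.
  have XK y : nr y < tau -> nr (X (c k.+1 y) - X (c k y)) <= L * (r / 2 / 2 ^+ k).
    move=> ys; have [h1 _] := cP k y ys; have [h2 _] := cP k.+1 y ys.
    by apply: le_trans (XL h1 h2) _; apply: ler_wpM2l => //; exact: IH.
  exact: (@picard_contraction (c k.+2) (c k.+1) (fun t => X (c k.+1 t))
    (fun t => X (c k t)) tau _ (lexx _) K0 E0 (dc k.+1) (dc k) XK t tt).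
have diffki k i t : nr t < tau -> nr (c (k + i)%N t - c k t) <= r / 2 ^+ k * (1 - (2 ^+ i)^-1).
  move=> tt; elim: i => [|i IH]; first by rewrite addn0 subrr nr0 expr0 invr1 subrr mulr0.
  rewrite addnS (le_trans (nr_tri (c (k + i)%N t) _ _))//.
  rewrite (le_trans (lerD (diffk _ t tt) IH))// le_eqVlt; apply/orP; left; apply/eqP.
  by rewrite exprD exprSr; field; rewrite !expf_neq0.
have diffj k j t : nr t < tau -> (k <= j)%N -> nr (c j t - c k t) <= r / 2 ^+ k.
  move=> tt kj; rewrite -(subnKC kj) (le_trans (diffki _ _ _ tt))//.
  rewrite mulrBr mulr1 lerBlDr lerDl mulr_ge0 ?invr_ge0 ?exprn_ge0//.
  by rewrite divr_ge0 ?exprn_ge0// ltW.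
have lim t : exists l, nr t < tau -> forall e : R, 0 < e -> exists N, forall k, (N <= k)%N ->
    nr (c k t - l) <= e.
  have [tt|] := ltP (nr t) tau; last by exists 0.
  have [|l lP] := @rVseq_complete R n (fun k => c k t); last by exists l.
  move=> e e0; have [N NP] := dyadic_small (ltW r0) (divr_gt0 e0 (ltr0n _ 2)).
  exists N => j k Nj Nk; rewrite (le_trans (nr_tri (c N t) _ _))// [e]splitr.
  rewrite [nr (c N t - _)]nr_distC.
  by rewrite lerD// (le_trans (diffj _ _ _ tt _))// ltW// NP.
have [l lP] := choice lim.
have limB k t : nr t < tau -> nr (c k t - l t) <= r / 2 ^+ k.
  move=> tt; apply: (@le_of_lim _ _ _ 1) => // e e0; have [N NP] := lP t tt e e0.
  rewrite (le_trans (nr_tri (c (maxn N k) t) _ _))// mul1r lerD//.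
    by rewrite nr_distC diffj// leq_maxr.
  by rewrite NP// leq_maxl.
have l0 : l 0 = x1.
  apply/eqP; rewrite -subr_eq0; apply/eqP/nr_eq0/le_anti; rewrite nr_ge0 andbT.
  apply: (@le_of_lim _ _ _ 1) => // e e0.
  have [|N /(_ N (leqnn N))] := lP 0 _ e e0; first by rewrite nr0.
  by rewrite c0 nr_distC add0r mul1r.
have lr t : nr t < tau -> nr (l t - x1) < r.
  move=> tt; apply: (@le_lt_trans _ _ (r / 2)); last by rewrite ltr_pdivrMr// ltr_pMr// ltr1n.
  apply: (@le_of_lim _ _ _ 1) => // e e0; have [N NP] := lP t tt e e0.
  have [_ [_ b1]] := step _ (cP N).
  have h1 : nr (c N.+1 t - x1) <= r / 2 := b1 t tt.
  have h2 := NP N.+1 (leqnSn N).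
  rewrite (le_trans (nr_tri (c N.+1 t) _ _))// mul1r addrC lerD//.
  by rewrite nr_distC.
exists l; split=> // t tt; split; first exact: lr.
have rt0 : 0 < tau - nr t by rewrite subr_gt0.
have sub y : nr (y - t : C) < tau - nr t -> nr y < tau.
  by move=> yt; have := nr_subD y t; lra.
have [dl El] : differentiable l t /\ forall h (e : R), 0 < e ->
    exists N, forall k, (N <= k)%N -> nr ('d (c k) t h - 'd l t h) <= e.
  apply: (@weierstrass R _ n c l t _ rt0).
  - by move=> k y /sub yt; have [] := cP k y yt.
  - move=> e e0; have [N NP] := dyadic_small (ltW r0) e0.
    exists N => k Nk y /sub yt; rewrite (le_trans (limB _ _ yt))// ltW//.
    exact: NP.
split; first exact: dl.
move=> h; apply/eqP; rewrite -subr_eq0; apply/eqP/nr_eq0/le_anti; rewrite nr_ge0 andbT.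
apply: (@le_of_lim _ _ _ (1 + nr h * L)) => [|e e0].
  by rewrite addr_ge0// mulr_ge0 ?nr_ge0.
have [N1 N1P] := El h e e0; have [N2 N2P] := lP t tt e e0.
pose k := maxn N1 N2.
have h1 := N1P k.+1 (leq_trans (leq_maxl _ _) (leqnSn _)).
have h2 := N2P k (leq_maxr _ _).
have [_ /(_ h) E1] := dc k t tt.
rewrite -[_ - _](subrKA ('d (c k.+1) t h)) add0r mulrDl mul1r.
apply: le_trans (nrD _ _) _; apply: lerD; first by rewrite nr_distC; exact: h1.
have -> : 'd (c k.+1) t h - h *: X (l t) = h *: (X (c k t) - X (l t)).
  by rewrite scalerBr; congr (_ - _); exact: E1.
rewrite nrZ -mulrA ler_wpM2l ?nr_ge0//.
have [ck _] := cP k t tt.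
by rewrite (le_trans (XL (lr t tt) ck))// ler_wpM2l.
Qed.

End Picard.

(** Since [X] is Lipschitz near [x1] by [diff_lipschitz], [picard_exists] and
    [picard_unique] apply on a small time disc. *)
Theorem holomorphic_ode (X : E -> E) (x1 : E) (r : R) : 0 < r ->
  (forall x, nr (x - x1) < r -> differentiable X x) ->
  exists r' tau : R, [/\ 0 < r', r' <= r, 0 < tau &
    (exists c : C -> E, c 0 = x1 /\ forall t, nr t < tau ->
       nr (c t - x1) < r' /\ isd c t (fun h => h *: X (c t))) /\
    forall (c c' : C -> E) (s : R), s <= tau -> c 0 = c' 0 ->
      (forall t, nr t < s -> nr (c t - x1) < r' /\ isd c t (fun h => h *: X (c t))) ->
      (forall t, nr t < s -> nr (c' t - x1) < r' /\ isd c' t (fun h => h *: X (c' t))) ->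
      forall t, nr t < s -> c t = c' t].
Proof.
move=> r0 dX.
have /differentiable_continuous/continuous_nrP : differentiable X x1.
  by apply: dX; rewrite subrr nr0.
move=> /(_ _ ltr01)[d d0 dP].
pose q := Num.min d r; have q0 : 0 < q by rewrite lt_min d0.
pose M := nr (X x1) + 1; have M0 : 0 < M by rewrite ltr_wpDl ?nr_ge0.
have XM x : nr (x - x1) < q -> nr (X x) <= M.
  rewrite lt_min => /andP[/dP h _]; have := nr_subD (X x) (X x1); rewrite /M; lra.
have dXq x : nr (x - x1) < q -> differentiable X x.
  by rewrite lt_min => /andP[_ h]; exact: dX.
pose L := 8 * M / q; have L0 : 0 < L by rewrite divr_gt0// mulr_gt0.
have XL := diff_lipschitz q0 dXq XM.
have q20 : 0 < q / 2 by rewrite divr_gt0.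
have q2 x : nr (x - x1) < q / 2 -> nr (x - x1) < q by lra.
(* Small enough for curves of speed [M] to stay in the ball of radius [q / 4] and for
   the iteration to be contracting. *)
pose tau := Num.min (q / 2 / 2 / M) (2^-1 / L).
have tau0 : 0 < tau.
  have h1 : 0 < q / 2 / 2 / M by rewrite divr_gt0// divr_gt0.
  have h2 : 0 < 2^-1 / L by rewrite divr_gt0// invr_gt0.
  by rewrite lt_min h1 h2.
have tM : M * tau <= q / 2 / 2.
  by rewrite mulrC -ler_pdivlMr// ge_min lexx.
have tL : L * tau <= 2^-1 by rewrite mulrC -ler_pdivlMr// ge_min lexx orbT.
exists (q / 2), tau; split => //.
  have : q <= r by rewrite ge_min lexx orbT.
  by lra.
have dX' x : nr (x - x1) < q / 2 -> differentiable X x by move=> /q2; exact: dXq.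
have XM' x : nr (x - x1) < q / 2 -> nr (X x) <= M by move=> /q2; exact: XM.
split.
  exact: (@picard_exists X x1 (q / 2) M L tau q20 tau0 (ltW M0) (ltW L0) dX' XM' XL tM tL).
move=> c c' s st cc' cP c'P.
exact: (@picard_unique X x1 (q / 2) L tau q20 (ltW L0) XL tL c c' s st cc' cP c'P).
Qed.

End ODE.

(** * Existence of the exponential curves *)

Section ExpCurve.
Context {R : realType} {m : nat} (G : complexLieGroup R m).
Local Notation C := (cplx R).
Local Notation A := (cs_atlas (lie_struct G)).
Local Notation E := 'rV[C]_m.
Local Notation b0 := (chart1 G).
Local Notation e0 := (chart1 G (1 : G)%g).

(** A local one-parameter subgroup with velocity [w], from the differential equation
    of integral curves in the chart [chart1]. The additivity comes from uniqueness:
    for fixed [s] both sides are integral curves in [t]. *)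
Lemma local_one_parameter_subgroup (w : E) : exists (g0 : C -> G) (sigma : R),
  [/\ 0 < sigma, g0 0 = 1%g, integral_at w g0 0 &
      forall s t, nr s < sigma -> nr t < sigma -> g0 (s + t) = (g0 s * g0 t)%g].
Proof.
have b01 : chart_at A (1 * 1 : G)%g b0 by rewrite mulg1; exact: chart1P.
have [r r0 rP] := chart_mul_differentiable_near (chart1P G) (chart1P G) b01.
have [rho rho0 rhoP] := @partial_differentiable R m m (chart_mul b0 b0 b0) e0 e0 r w r0
  (fun p pr => match rP p pr with And5 _ _ _ _ h => h.2 end).
pose X x := lvec b0 (chart_inv b0 x) w.
pose r1 := Num.min rho r; have r10 : 0 < r1 by rewrite lt_min rho0.
have dX (x : E) : nr (x - e0) < r1 -> differentiable X x.
  by rewrite lt_min => /andP[h _]; exact: rhoP.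
have inv_chart (x : E) : nr (x - e0) < r1 ->
    chart_at A (chart_inv b0 x) b0 /\ b0 (chart_inv b0 x) = x.
  rewrite lt_min => /andP[_ h]; have [] := rP (x, e0) => //.
  have -> : (x, e0) - (e0, e0) = (x - e0, 0) :> E * E by rewrite -[RHS]/(x - e0, 0) -(subrr e0).
  by rewrite nr_pair nr0 max_l// nr_ge0.
have [r' [tau [r'0 r'r tau0 [[c [c0 cP]] uniq]]]] := holomorphic_ode r10 dX.
pose g0 (t : C) := chart_inv b0 (c t).
have cP' (t : C) : nr t < tau -> chart_at A (g0 t) b0 /\ b0 (g0 t) = c t.
  by move=> tt; apply: inv_chart; apply: lt_le_trans r'r; exact: (cP t tt).1.
have g01 : g0 0 = 1%g by rewrite /g0 c0 chart1K.
have near_tau (t : C) : nr t < tau -> \forall s \near t, nr s < tau.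
  move=> tt; apply/nbhs_nrP; exists (tau - nr t); first by rewrite subr_gt0.
  by move=> s st; have := nr_subD s t; lra.
have g0i (t : C) : nr t < tau -> integral_at w g0 t.
  move=> tt; have [ct bt] := cP' t tt; have [_ dc] := cP t tt.
  have gc : {for t, continuous g0}.
    apply: (@continuous_comp _ _ _ c (chart_inv b0)); first exact: isd_continuous dc.
    by apply: chart_inv_cont; exists (g0 t) => //; case: ct.
  have nE : \forall s \near t, c s = b0 (g0 s).
    by apply: filterS (near_tau t tt) => s st; rewrite (cP' s st).2.
  exact: (integral_at_chart gc ct (isd_near nE dc)).
have g0_uniq (eta : C -> G) (s : R) : s <= tau -> eta 0 = 1%g ->
    (forall t, nr t < s -> [/\ integral_at w eta t, chart_dom b0 (eta t) &
       nr (b0 (eta t) - e0) < r']) ->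
    forall t, nr t < s -> eta t = g0 t.
  move=> st eta0 etaP t ts; have [_ dt _] := etaP t ts.
  rewrite -[LHS](chart_funK dt) /g0; congr (chart_inv b0 _).
  apply: (uniq (fun t => b0 (eta t)) c s st) => //; first by rewrite eta0 c0.
    move=> z zs; have [[_ iz] dz nz] := etaP z zs; split; first exact: nz.
    by rewrite /X chart_funK//; apply: iz; split=> //; case: (chart1P G).
  by move=> z zs; apply: cP; exact: lt_le_trans st.
(* Uniqueness is applied to [(g0 s)^-1 * g0 (t + s)], which stays in the domain of the
   chart for small [s] and [t]. *)
have cont0 : {for ((0, 0) : C * C),
    continuous (fun st : C * C => ((g0 st.1)^-1 * g0 (st.2 + st.1))%g)}.
  have gc : {for 0, continuous g0} by have [] := g0i 0; rewrite ?nr0.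
  apply: (@continuous_comp _ _ _ (fun st : C * C => ((g0 st.1)^-1%g, g0 (st.2 + st.1)))
    (fun gh : G * G => (gh.1 * gh.2)%g)); last exact: mulg_continuous.
  apply: cvg_pair => /=.
    apply: (@cvg_comp _ _ _ (fun st : C * C => g0 st.1) (fun g : G => g^-1%g)).
      by apply: (@cvg_comp _ _ _ fst g0); [exact: cvg_fst|exact: gc].
    exact: invg_continuous.
  apply: (@cvg_comp _ _ _ (fun st : C * C => st.2 + st.1) g0).
    by apply: cvgD; [exact: cvg_snd|exact: cvg_fst].
  by rewrite addr0; exact: gc.
have [sigma [sigma0 sigmatau sigmaP]] : exists sigma : R, [/\ 0 < sigma, sigma <= tau / 2 &
    forall s t : C, nr s < sigma -> nr t < sigma ->
      chart_dom b0 ((g0 s)^-1 * g0 (t + s))%g /\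
      nr (b0 ((g0 s)^-1 * g0 (t + s))%g - e0) < r'].
  have nb : \forall h \near ((g0 0)^-1 * g0 (0 + 0))%g, chart_dom b0 h /\ nr (b0 h - e0) < r'.
    rewrite addr0 g01 mulg1 invg1.
    have [_ d1] := chart1P G.
    apply: filterI; first exact: open_nbhs_nbhs (conj (chart_dom_open b0) d1).
    have bc : {for (1 : G)%g, continuous b0} by exact: chart_fun_cont.
    exact: (bc _ (nr_ball_nbhs e0 r'0)).
  have /nbhs_nrP[d d0 dP] := cont0 _ nb.
  exists (Num.min d (tau / 2)); rewrite lt_min d0 divr_gt0// ge_min lexx orbT; split=> //.
  move=> s t; rewrite !lt_min => /andP[sd _] /andP[td _].
  apply: (dP (s, t)); have -> : (s, t) - (0, 0) = (s, t) :> C * C by congr (_, _); rewrite subr0.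
  by rewrite nr_pair gt_max sd.
exists g0, sigma; split => //; first by apply: g0i; rewrite nr0.
move=> s t ss ts.
have H : ((g0 s)^-1 * g0 (t + s))%g = g0 t.
  have st : sigma <= tau by lra.
  have eta0 : ((g0 s)^-1 * g0 (0 + s))%g = 1%g by rewrite add0r mulVg.
  apply: (g0_uniq (fun t => ((g0 s)^-1 * g0 (t + s))%g) sigma st eta0 _ t ts).
  move=> z zs; have [h1 h2] := sigmaP s z ss zs; split; [|exact: h1|exact: h2].
  apply: integral_at_lmul; apply: integral_at_shift; apply: g0i.
  by have := nrD z s; lra.
by rewrite -H mulVKg addrC.
Qed.

(** Local one-parameter subgroups extend to [C] by repeated squaring. *)
Lemma one_parameter_subgroup (w : E) : exists g : C -> G,
  g 0 = 1%g /\ forall t, integral_at w g t.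
Proof.
have [g0 [sigma [sigma0 g01 g0i g0D]]] := local_one_parameter_subgroup w.
pose F := fix F k (t : C) := if k is k'.+1 then (F k' (t / 2)%R * F k' (t / 2)%R)%g else g0 t.
have half (t : C) : nr (t / 2) = nr t / 2.
  rewrite nrM nrV; congr (_ / _).
  have -> : (2 : C) = (2 : R)%:C by rewrite rmorph_nat.
  by rewrite nr_real ger0_norm.
have halfD (t : C) : t / 2 + t / 2 = t by field.
have FD k : forall s t : C, nr s < 2 ^+ k * sigma -> nr t < 2 ^+ k * sigma ->
    F k (s + t) = (F k s * F k t)%g.
  elim: k => [|k IH] s t; first by rewrite expr0 mul1r; exact: g0D.
  rewrite exprS => ss ts /=.
  have s2 : nr (s / 2) < 2 ^+ k * sigma by rewrite half; lra.
  have t2 : nr (t / 2) < 2 ^+ k * sigma by rewrite half; lra.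
  rewrite mulrDl IH//.
  have comm : (F k (t / 2)%R * F k (s / 2)%R = F k (s / 2)%R * F k (t / 2)%R)%g.
    by rewrite -!IH// addrC.
  by rewrite -mulgA [X in (_ * X)%g]mulgA comm !mulgA.
have FS k (t : C) : nr t < 2 ^+ k * sigma -> F k.+1 t = F k t.
  move=> tk; rewrite /= -FD ?halfD// half; have := nr_ge0 t; lra.
have p2 k : 0 < 2 ^+ k * sigma by rewrite mulr_gt0// exprn_gt0.
have p2S k i : 2 ^+ k * sigma <= 2 ^+ (k + i) * sigma.
  by rewrite ler_pM2r// exprD ler_peMr ?exprn_ge0// exprn_ege1// ler1n.
have Fle k i (t : C) : nr t < 2 ^+ k * sigma -> F (k + i)%N t = F k t.
  move=> tk; elim: i => [|i IH]; first by rewrite addn0.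
  by rewrite addnS FS// (lt_le_trans tk).
have big (x : R) : exists k, x < 2 ^+ k * sigma.
  have [k /(_ k (leqnn k))] := dyadic_small (normr_ge0 x) sigma0.
  by rewrite ltr_pdivrMr ?exprn_gt0// mulrC => /(le_lt_trans (ler_norm x)) h; exists k.
have [K KP] := choice (fun t : C => big (nr t)).
pose g (t : C) := F (K t) t.
have gE k (t : C) : nr t < 2 ^+ k * sigma -> g t = F k t.
  move=> tk; have [/subnKC <-|/ltnW/subnKC e] := leqP (K t) k.
    by rewrite Fle//; exact: KP.
  by rewrite /g -e Fle.
exists g; split; first by rewrite (gE 0%N) ?nr0// expr0 mul1r.
move=> t0; have [k kP] := big (nr t0 + sigma).
have t0k : nr t0 < 2 ^+ k * sigma by lra.
have H : integral_at w (fun t => (g t0 * g0 (t - t0))%g) t0.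
  by apply: integral_at_lmul; apply: integral_at_shift; rewrite subrr.
apply: integral_at_near H.
apply/nbhs_nrP; exists sigma => // t tt.
have tk : nr t < 2 ^+ k * sigma by have := nr_subD t t0; lra.
rewrite (gE k t tk) (gE k t0 t0k) -{2}[t](subrKC t0) FD//; last first.
  by have := nr_ge0 t0; lra.
congr (_ * _)%g; apply: esym; apply: (Fle 0%N k (t - t0)).
by rewrite expr0 mul1r.
Qed.

(** Left translates of one-parameter subgroups witness the existence of the curve
    that [exp_curve] selects. *)
Lemma exp_curveP (g : G) (k : C) (v : tangent A (1 : G)%g) :
  is_exp_curve (k *: dL_e g v) (exp_curve (k *: dL_e g v)).
Proof.
have [c [c1 ci]] := one_parameter_subgroup (k *: v b0).
apply: (@xgetPex _ (fun=> g) (is_exp_curve (k *: dL_e g v))).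
exists (fun t => (g * c t)%g); apply/is_exp_curveP; split; first by rewrite c1 mulg1.
by move=> t; exact: integral_at_lmul.
Qed.

End ExpCurve.

(** * First-order behaviour of the exponential mappings *)

Section ExpAsymptotics.
Context {R : realType} {m : nat} (G : complexLieGroup R m).
Local Notation C := (cplx R).
Local Notation A := (cs_atlas (lie_struct G)).
Local Notation E := 'rV[C]_m.
Local Notation b0 := (chart1 G).
Local Notation e0 := (chart1 G (1 : G)%g).

Lemma isd_lip (V W : normedModType C) (f : V -> W) x L (K d : R) : 0 < d ->
  isd f x L -> (forall y, nr (y - x) < d -> nr (f y - f x) <= K * nr (y - x)) ->
  forall h, nr (L h) <= K * nr h.
Proof.
move=> d0 [df dE] fK h; apply: (@le_of_lim _ _ _ (nr h)); first exact: nr_ge0.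
move=> e e0'; have [d' d'0 d'P] := differentiable_nr df e0'.
pose D := Num.min d d'; have D0 : 0 < D by rewrite lt_min d0.
have h1 : 0 < nr h + 1 by rewrite ltr_wpDl ?nr_ge0.
pose t := D / (nr h + 1); have t0 : 0 < t by rewrite divr_gt0.
have th : nr (t%:C *: h) = t * nr h by rewrite nrZ nr_real gtr0_norm.
have tD : nr (x + t%:C *: h - x) < D.
  by rewrite addrC addKr th mulrAC ltr_pdivrMr// ltr_pM2l// ltrDl.
have := tD; rewrite lt_min => /andP[/fK H1 /d'P H2].
rewrite [x + _ - x]addrC addKr th in H1 H2.
have E1 : 'd f x (t%:C *: h) = t%:C *: L h by rewrite linearZ/=; congr (_ *: _); exact: dE.
rewrite E1 in H2.
have := nr_subD (t%:C *: L h) (f (x + t%:C *: h) - f x); rewrite nr_distC nrZ nr_real gtr0_norm// => H3.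
rewrite -(ler_pM2l t0); lra.
Qed.

Lemma rder_isd (W : normedModType C) (f : C -> W) (t : R) L : isd f t%:C L ->
  rder (fun s : R => f s%:C) t (L 1).
Proof.
move=> [df dE].
have E1 (s : R) : 0 + s%:C *: (1 : C) = s%:C :> C by rewrite add0r /GRing.scale/= mulr1.
have H := @rder_line R C W f 0 1 t; rewrite E1 in H.
have := H df; rewrite dE; apply: rder_eq => s; rewrite E1 //.
Qed.

Section AtPoint.
Variables (p0 : G) (a : chart E G).
Hypothesis ap0 : chart_at A p0 a.
Local Notation x0 := (a p0).

Lemma lvec_mu (h : G) : chart_at A h a ->
  isd (fun y => chart_mul a b0 a (a h, y)) e0 (lvec a h).
Proof.
move=> ah; have := lvec_isd ah; congr isd; apply/funext => y.
by rewrite /chart_mul /= chart_funK//; case: ah.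
Qed.

(** The field [lvec a h] is the partial differential at [(a h, e0)] of the
    multiplication in charts, which is strictly differentiable at [(a p0, e0)]. *)
Lemma lvec_near (e : R) : 0 < e -> exists2 d : R, 0 < d & forall h : G,
  chart_dom a h -> nr (a h - x0) < d ->
  forall w, nr (lvec a h w - lvec a p0 w) <= e * nr w.
Proof.
move=> e0'; have ap1 : chart_at A (p0 * 1)%g a by rewrite mulg1.
have [r r0 rP] := chart_mul_differentiable_near ap0 (chart1P G) ap1.
have dmu p : nr (p - (x0, e0)) < r -> differentiable (chart_mul a b0 a) p.
  by move=> /rP[_ _ _ _ []].
have [d d0 dP] := strict_differentiable r0 dmu e0'.
have dmu0 : differentiable (chart_mul a b0 a) (x0, e0) by apply: dmu; rewrite subrr nr0.
exists d => // h ha hd w.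
have ah : chart_at A h a by split=> //; case: ap0.
have DE u : 'd (chart_mul a b0 a) (x0, e0) (0, u) = lvec a p0 u.
  have H := isd_comp (isd_pair (isd_cst x0 e0) (isd_id e0)) (isd_diff dmu0).
  exact: isd_uniq H (lvec_mu ap0) u.
have isdD0 : isd (fun y => lvec a p0 (y - e0)) e0 (lvec a p0).
  have [_ dl] := lvec_isd ap0; have [M _ MP] := diff_nr_bounded (lvec_isd ap0).1.
  apply: (@isd_affine R _ _ _ _ _ M) => //; first exact: linearP.
  by move=> y; rewrite subrr lvec0 subr0.
have := @isd_lip _ _ (fun y => chart_mul a b0 a (a h, y) - lvec a p0 (y - e0)) e0 _ e d d0
  (isdB (lvec_mu ah) isdD0).
apply=> y yd.
have pairE z : ((a h, z) - (x0, e0) : E * E) = (a h - x0, z - e0) by [].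
have h1 : nr ((a h, y) - (x0, e0) : E * E) < d by rewrite pairE nr_pair gt_max hd.
have h2 : nr ((a h, e0) - (x0, e0) : E * E) < d.
  by rewrite pairE nr_pair gt_max hd subrr nr0.
have := dP _ _ h2 h1.
have -> : ((a h, y) - (a h, e0) : E * E) = (0, y - e0) by congr (_, _); rewrite subrr.
rewrite DE nr_pair nr0 max_r ?nr_ge0// => H.
by rewrite subrr lvec0 subr0 addrAC.
Qed.

(** The curve defining [lie_exp] stays near [p0] by continuous induction on the time
    interval [0, 1]; its velocity there is almost constant. *)
Lemma exp_asymptotics (e : R) : 0 < e -> exists2 d : R, 0 < d &
  forall (p : G) (k : R) (v : tangent A (1 : G)%g),
    chart_dom a p -> nr (a p - x0) < d -> 0 <= k -> k * nr (v b0) < d ->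
    let q := lie_exp (k%:C *: dL_e p v) in
    chart_dom a q /\
    nr (a q - a p - k%:C *: lvec a p0 (v b0)) <= e * (k * nr (v b0)).
Proof.
move=> e0'; pose e1 := Num.min e 1.
have e10 : 0 < e1 by rewrite lt_min e0' ltr01.
have [d1 d10 d1P] := lvec_near e10.
have [K K0 KP] := diff_nr_bounded (lvec_isd ap0).1.
have /nbhs_nrP[d2 d20 d2P] := chart_at_inv ap0.
pose r := Num.min d1 d2; have r0 : 0 < r by rewrite lt_min d10.
pose d := Num.min (r / 4) (r / 4 / (K + 1)).
have K10 : 0 < K + 1 by rewrite ltr_wpDl// ltW.
have r40 : 0 < r / 4 by rewrite divr_gt0.
exists d; first by rewrite lt_min r40 divr_gt0.
move=> p k v pa pd k0 kd q.
have [gc0 gint] := (is_exp_curveP p k%:C v _).1 (exp_curveP p k%:C v).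
rewrite -/(lie_exp _) in q *.
pose g := exp_curve (k%:C *: dL_e p v); rewrite -/g in gc0 gint.
pose w := v b0; rewrite -/w in kd gint *.
have kw : (K + 1) * (k * nr w) <= r / 4.
  by rewrite mulrC -ler_pdivlMr//; move: kd; rewrite lt_min => /andP[_ /ltW].
have pr : nr (a p - x0) < r / 4 by move: pd; rewrite lt_min => /andP[].
have kw0 : 0 <= k * nr w by rewrite mulr_ge0 ?nr_ge0.
pose P (t : R) := chart_dom a (g t%:C) /\ nr (a (g t%:C) - x0) < r.
have gder t : P t -> rder (fun s : R => a (g s%:C)) t (k%:C *: lvec a (g t%:C) w).
  move=> [gt _]; have [_ H] := gint t%:C.
  have := rder_isd (H a (conj ap0.1 gt)).
  by rewrite scale1r lvecZ.
have vnear t : P t -> nr (lvec a (g t%:C) w - lvec a p0 w) <= e1 * nr w.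
  by move=> [gt gr]; apply: d1P => //; apply: lt_le_trans gr _; rewrite ge_min lexx.
have vle t : P t -> nr (k%:C *: lvec a (g t%:C) w) <= r / 4.
  move=> Pt; rewrite nrZ nr_real ger0_norm//; apply: le_trans kw.
  rewrite mulrCA ler_wpM2l//.
  apply: le_trans (nr_subD _ (lvec a p0 w)) _; rewrite mulrDl [leRHS]addrC.
  apply: lerD (KP w); apply: le_trans (vnear t Pt) _.
  by rewrite ler_wpM2r ?nr_ge0// ge_min lexx orbT.
have gcont (t e' : R) (V : set G) : nbhs (g t%:C) V ->
    exists2 d' : R, 0 < d' & forall s : R, `|s - t| < d' -> V (g s%:C).
  move=> Vt; have [gc _] := gint t%:C; have /nbhs_nrP[d' d'0 d'P] := gc _ Vt.
  by exists d' => // s st; apply: d'P; rewrite -rmorphB nr_real.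
have stay t : 0 <= t <= 1 -> P t.
  apply: real_induction => {}t t01 IH.
  have Pt : P t.
    have [t0|t0] := leP t 0.
      have -> : t = 0 by apply/le_anti; rewrite t0; case/andP: t01.
      by rewrite /P gc0; split=> //; lra.
    have half s : 0 <= s -> s < t -> nr (a (g s%:C) - x0) <= r / 2.
      move=> s0 st; have := @rder_mvi R _ (fun s : R => a (g s%:C))
        (fun s => k%:C *: lvec a (g s%:C) w) 0 s (r / 4) s0.
      have Ps z : 0 <= z <= s -> P z.
        by move=> /andP[z0 zs]; apply: IH => //; exact: le_lt_trans zs st.
      move=> /(_ (fun z zP => gder z (Ps z zP)) (fun z zP => vle z (Ps z zP))).
      rewrite subr0 gc0 => H; have := nr_tri (a p) (a (g s%:C)) x0.
      have : r / 4 * s <= r / 4 by rewrite ger_pMr//; case/andP: t01 => _; lra.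
      lra.
    (* The points [g s] with [s < t] lie in the compact set [Kc], which is closed since
       [G] is Hausdorff: hence so does [g t], which is not known to be in the domain
       of the chart beforehand. *)
    pose Kc := chart_inv a @` [set y | nr (y - x0) <= r / 2].
    have ballP y : nr (y - x0) <= r / 2 -> chart_dom a (chart_inv a y) /\ a (chart_inv a y) = y.
      move=> yr; have yd2 : nr (y - x0) < d2.
        have : r <= d2 by rewrite ge_min lexx orbT.
        lra.
      by have [[]] := d2P y yd2.
    have clKc : closed Kc.
      apply: compact_closed; first exact: cs_hausdorff (lie_struct G).
      apply: continuous_compact; last exact: compact_nr_ball.
      apply: continuous_in_subspaceT => y; rewrite inE /= => yr.
      have [y1 y2] := ballP y yr.
      by apply: chart_inv_cont; exists (chart_inv a y).
    have Kct : Kc (g t%:C).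
      apply: contrapT => nK.
      have nb : nbhs (g t%:C) (~` Kc).
        by apply: open_nbhs_nbhs; split=> //; exact: closed_openC.
      have [d' d'0 d'P] := gcont t 1 _ nb.
      pose s := Num.max 0 (t - d' / 2).
      have s0 : 0 <= s by rewrite le_max lexx.
      have st : s < t by rewrite gt_max t0 ltrBlDr ltrDl divr_gt0.
      have sd : `|s - t| < d'.
        rewrite ltr0_norm ?subr_lt0// opprB ltrBlDr -ltrBlDl lt_max; apply/orP; right; lra.
      apply: (d'P s sd); exists (a (g s%:C)); first exact: half.
      by rewrite chart_funK//; case: (IH s s0 st).
    have [y /= yr yE] := Kct; have [y1 y2] := ballP y yr.
    by rewrite /P -yE y2; split=> //; lra.
  split=> //; have [gt gr] := Pt.
  have nb : nbhs (g t%:C) [set h | chart_dom a h /\ nr (a h - x0) < r].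
    apply: filterI; first exact: open_nbhs_nbhs (conj (chart_dom_open a) gt).
    have ac : {for g t%:C, continuous a} by exact: chart_fun_cont.
    have nb : nbhs (a (g t%:C)) [set y | nr (y - x0) < r].
      by apply: open_nbhs_nbhs; split=> //; exact: open_nr_ball.
    exact: (ac _ nb).
  have [d' d'0 d'P] := gcont t 1 _ nb.
  by exists d' => // s ts sd _; apply: d'P; rewrite gtr0_norm ?subr_gt0// ltrBlDl.
have [q1 _] : P 1 by apply: stay; rewrite ler01 lexx.
split; first exact: q1.
have := @rder_mvi R _ (fun s : R => a (g s%:C) - s%:C *: (k%:C *: lvec a p0 w))
  (fun s => k%:C *: lvec a (g s%:C) w - k%:C *: lvec a p0 w) 0 1 (e * (k * nr w)) ler01.
rewrite scale1r scale0r gc0 !subr0 mulr1 => H.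
have -> : a q - a p - k%:C *: lvec a p0 w = a (g 1%:C) - k%:C *: lvec a p0 w - a p.
  by rewrite addrAC.
apply: H => t /stay Pt.
  by apply: rderB; [exact: gder|exact: rder_scal].
rewrite -scalerBr nrZ nr_real ger0_norm// mulrCA ler_wpM2l//.
apply: le_trans (vnear t Pt) _.
by rewrite ler_wpM2r ?nr_ge0// ge_min lexx.
Qed.

(** The translations by [p0] and [p0^-1] are inverse to each other. *)
Lemma lvec_surjective (u : E) : exists w, lvec a p0 w = u.
Proof.
have c1 : chart_at A (p0^-1 * p0)%g b0 by rewrite mulVg; exact: chart1P.
have d1 := isd_diff (lmul_differentiable ap0 c1).
have E1 : b0 (p0^-1 * chart_inv a x0)%g = e0.
  by rewrite chart_funK ?mulVg//; case: ap0.
have d2 := lvec_isd ap0; rewrite -{1}E1 in d2.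
exists ('d (fun y => b0 (p0^-1 * chart_inv a y)%g) x0 u).
have nE : \forall y \near x0,
    a (p0 * chart_inv b0 (b0 (p0^-1 * chart_inv a y)))%g = y.
  have ic : {for x0, continuous (fun y => (p0^-1 * chart_inv a y)%g)}.
    apply: (@continuous_comp _ _ _ (chart_inv a) (fun k : G => (p0^-1 * k)%g)).
      by apply: chart_inv_cont; exists p0 => //; case: ap0.
    exact: lmul_continuous.
  have n1 : \forall y \near x0, chart_dom b0 (p0^-1 * chart_inv a y)%g.
    apply: ic; rewrite chart_funK; last by case: ap0.
    by rewrite mulVg; apply: open_nbhs_nbhs; split; [exact: chart_dom_open|case: (chart1P G)].
  apply: filterS2 n1 (chart_at_inv ap0) => y y1 [_ y2].
  by rewrite chart_funK// mulVKg.
exact: isd_uniq (isd_near nE (isd_comp d1 d2)) (isd_id x0) u.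
Qed.

End AtPoint.

End ExpAsymptotics.

(** * Rescaling families of holomorphic maps into a compact manifold *)

Section Rescaling.
Context {R : realType} {m n : nat} {N : topologicalType}.
Local Notation C := (cplx R).
Local Notation E := 'rV[C]_m.
Variables (B : atlas 'rV[C]_n N) (d : N -> N -> R).
Hypotheses (Nc : compact [set: N]) (dP : is_distance d).
Local Notation hol f x := (cdiff_at (std_atlas E) B f x).

Lemma lebesgue_number (del : N -> R) : (forall q, 0 < del q) ->
  exists2 delta : R, 0 < delta &
    forall q, exists q0, d q0 q < del q0 /\ delta <= del q0.
Proof.
move=> del0; have /compact_near_coveringP := Nc.
move=> /(_ _ \oo (fun k q => exists q0, d q0 q < del q0 /\ 1 / 2 ^+ k <= del q0) _).
case=> [q _|K _ KP].
  have [K KP] := dyadic_small ler01 (del0 q).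
  exists ([set q' | d q q' < del q], [set k | (K <= k)%N]) => /=.
    by split; [apply/(nbhs_distP dP); exists (del q)|exists K].
  by move=> [q' k] /= [qq' Kk]; exists q; split=> //; rewrite ltW// KP.
exists (1 / 2 ^+ K); first by rewrite divr_gt0// exprn_gt0.
by move=> q; exact: (KP K (leqnn K) q I).
Qed.

Definition small_osc (delta : R) (f : E -> N) (x : E) (r : R) :=
  forall y, nr (y - x) < r -> d (f x) (f y) < delta.

(** Holomorphic maps of oscillation less than [delta] are equicontinuous, with a modulus
    of continuity that is invariant under rescaling of the source. *)
Definition schwarz_constant (delta : R) := forall e : R, 0 < e ->
  exists2 eta : R, 0 < eta & forall (f : E -> N) (x : E) (r : R), 0 < r ->
    (forall y, nr (y - x) < r -> hol f y) -> small_osc delta f x r ->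
    forall y, nr (y - x) < eta * r -> d (f x) (f y) < e.

(** A form of the Schwarz lemma: a map of small oscillation takes its values in the
    domain of a chart, where Cauchy's estimate applies. *)
Lemma schwarz : exists2 delta : R, 0 < delta & schwarz_constant delta.
Proof.
pose b q := pref_chart B q.
have bP q : chart_at B q (b q) := pref_chartP B q.
have delP q0 : exists del : R, 0 < del /\ forall q, d q0 q < 2 * del ->
    chart_dom (b q0) q /\ nr (b q0 q - b q0 q0) < 1.
  have [_ bq] := bP q0.
  have bc : {for q0, continuous (b q0)} by exact: chart_fun_cont.
  have nb : nbhs q0 [set q | chart_dom (b q0) q /\ nr (b q0 q - b q0 q0) < 1].
    apply: filterI; first exact: open_nbhs_nbhs (conj (chart_dom_open _) bq).
    exact: (bc _ (nr_ball_nbhs (b q0 q0) ltr01)).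
  have [e e0 eP] := (nbhs_distP dP _ _).1 nb.
  by exists (e / 2); split=> [|q qe]; [rewrite divr_gt0|apply: eP => /=; lra].
have [del del_P] := choice delP.
have [delta delta0 deltaP] := lebesgue_number (fun q => (del_P q).1).
exists delta => // e e0; have e20 : 0 < e / 2 by rewrite divr_gt0.
(* The modulus [r / 2 ^+ k] works for the values [f x] near a given point of [N]; the
   compactness of [N] yields a common [k]. *)
have /compact_near_coveringP := Nc.
move=> /(_ _ \oo (fun k q => forall (f : E -> N) (x : E) (r : R), f x = q -> 0 < r ->
    (forall y, nr (y - x) < r -> hol f y) ->
    (forall y, nr (y - x) < r -> d (f x) (f y) < delta) ->
    forall y, nr (y - x) < r / 2 ^+ k -> d (f x) (f y) < e) _).
case=> [q _|K _ KP]; last first.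
  exists (1 / 2 ^+ K); first by rewrite divr_gt0// exprn_gt0.
  move=> f x r r0 fh fd y; rewrite mul1r mulrC => yr.
  exact: (KP K (leqnn K) (f x) I f x r).
have [q0 [qq0 dq0]] := deltaP q; have [del0 delq0] := del_P q0.
have [qb _] : chart_dom (b q0) q /\ nr (b q0 q - b q0 q0) < 1 by apply: delq0; lra.
have ic : {for b q0 q, continuous (chart_inv (b q0))}.
  by apply: chart_inv_cont; exists q.
have ninv : \forall z \near b q0 q, d q (chart_inv (b q0) z) < e / 2.
  apply: (ic (fun q' => d q q' < e / 2)); rewrite chart_funK//.
  exact: dist_ball_nbhs dP _ _ e20.
have /nbhs_nrP[h h0 hP] := ninv.
have bc : {for q, continuous (b q0)} by exact: chart_fun_cont.
have h20 : 0 < h / 2 by rewrite divr_gt0.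
have [K KP] := dyadic_small (ler0n _ 8 : 0 <= 8 :> R) h20.
pose V := [set q' | d q q' < e / 2 /\ d q q' < del q0 - d q0 q] `&`
  [set q' | nr (b q0 q' - b q0 q) < h / 2].
exists (V, [set k | (maxn K 1 <= k)%N]) => /=.
  split; last by exists (maxn K 1).
  apply: filterI; last exact: (bc _ (nr_ball_nbhs (b q0 q) h20)).
  apply: filterI; apply: dist_ball_nbhs dP _ _ _ => //.
  by rewrite subr_gt0.
move=> [q' k] /= [[[q'1 q'2] q'3]]; rewrite geq_max => /andP[Kk k1].
move=> f x r fx r0 fh fd y yr.
have vals (z : E) : nr (z - x) < r -> d q0 (f z) < 2 * del q0.
  move=> zr; have := fd z zr; have := dist_tri dP (f x) q0 (f z).
  by have := dist_tri dP q q0 (f x); rewrite fx; lra.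
have fb (z : E) : nr (z - x) < r ->
    chart_dom (b q0) (f z) /\ nr (b q0 (f z) - b q0 q0) < 1.
  by move=> /vals; exact: delq0.
pose g (z : E) := b q0 (f z) - b q0 q0.
have dg (z : E) : nr (z - x) < r -> differentiable g z.
  move=> zr; have /std_cdiffP[_ /(_ (b q0))H] := fh z zr.
  have dz : differentiable (fun y => b q0 (f y)) z.
    by apply: H; split; [case: (bP q0)|case: (fb z zr)].
  by have [] := isdB (isd_diff dz) (isd_cst (b q0 q0) z).
have gB (z : E) : nr (z - x) < r -> nr (g z) <= 1.
  by move=> /fb[_ /ltW].
have k2 : r / 2 ^+ k <= r / 2.
  rewrite ler_pM2l// lef_pV2 ?posrE ?exprn_gt0// -{1}[2]expr1.
  by rewrite ler_weXn2l// ler1n.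
have yr2 : nr (y - x) < r / 2 by exact: lt_le_trans k2.
have xr2 : nr (x - x) < r / 2 by rewrite subrr nr0 divr_gt0.
have := @diff_lipschitz R E n g x r 1 r0 dg gB x y xr2 yr2.
have -> : g y - g x = b q0 (f y) - b q0 (f x) by rewrite /g opprB addrA subrK.
rewrite mulr1 => lip.
have small : nr (b q0 (f y) - b q0 (f x)) < h / 2.
  apply: le_lt_trans (KP k Kk); apply: le_trans lip _.
  rewrite -mulrA ler_wpM2l// mulrC ler_pdivrMr//.
  by rewrite mulrC (le_trans (ltW yr)).
have yr' : nr (y - x) < r by lra.
have hy : nr (b q0 (f y) - b q0 q) < h.
  apply: le_lt_trans (nr_tri (b q0 (f x)) _ _) _; rewrite [ltRHS]splitr.
  by apply: ltrD small _; rewrite fx; exact: q'3.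
have := hP _ hy; rewrite /= chart_funK; last by case: (fb y yr').
by have := dist_tri dP q (f x) (f y); rewrite fx (distC dP q' q); lra.
Qed.

Variable delta : R.
Hypothesis delta0 : 0 < delta.

(** A point of large oscillation at scale [r] can be replaced by a nearby one around
    which the oscillation at half the scale is small: otherwise halving the scale
    repeatedly would produce a point of discontinuity. *)
Lemma oscillation_selection (f : E -> N) (x : E) (r a : R) : 0 < r -> 0 <= a ->
  (forall z, nr (z - x) <= 2 * a * r -> {for z, continuous f}) ->
  ~ small_osc delta f x r ->
  exists (y : E) (rho : R), [/\ 0 < rho, rho <= r, nr (y - x) <= 2 * a * r,
    ~ small_osc delta f y rho & forall z, nr (z - y) < a * rho -> small_osc delta f z (rho / 2)].
Proof.
move=> r0 a0 fc nx; apply: contrapT => nex.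
have step (y : E) (rho : R) : exists z : E, 0 < rho -> rho <= r -> nr (y - x) <= 2 * a * r ->
    ~ small_osc delta f y rho -> nr (z - y) < a * rho /\ ~ small_osc delta f z (rho / 2).
  have [[z [z1 z2]]|nz] := pselect (exists z, nr (z - y) < a * rho /\ ~ small_osc delta f z (rho / 2)).
    by exists z.
  exists y => rho0 rhor yx ny; exfalso; apply: nex; exists y, rho; split=> // z zy.
  by apply: contrapT => nz'; apply: nz; exists z.
have [next nextP] := choice (fun p : E * R => step p.1 p.2).
pose s := fix s k := if k is k'.+1 then next (s k', r / 2 ^+ k') else x.
have p2 k : 0 < 2 ^+ k :> R by rewrite exprn_gt0.
(* The displacements [a * r / 2 ^+ k] add up to at most [2 * a * r]. *)
have sP k : nr (s k - x) <= 2 * a * r * (1 - (2 ^+ k)^-1) /\ ~ small_osc delta f (s k) (r / 2 ^+ k).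
  elim: k => [|k [IH1 IH2]].
    by split; [rewrite expr0 invr1 /= !subrr nr0 mulr0|rewrite expr0 divr1].
  have rk0 : 0 < r / 2 ^+ k by rewrite divr_gt0.
  have rkr : r / 2 ^+ k <= r.
    by rewrite ler_pdivrMr// ler_peMr ?exprn_ege1 ?ler1n// ltW.
  have skx : nr (s k - x) <= 2 * a * r.
    rewrite (le_trans IH1)// mulrBr mulr1 lerBlDr lerDl mulr_ge0 ?invr_ge0 ?exprn_ge0//.
    by rewrite !mulr_ge0// ltW.
  have /= [h1 h2] := nextP (s k, r / 2 ^+ k) rk0 rkr skx IH2.
  split; last by rewrite exprSr invfM mulrA.
  rewrite (le_trans (nr_tri (s k) _ _))//.
  have := lerD (ltW h1) IH1; move=> /le_trans; apply; rewrite le_eqVlt; apply/orP; left.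
  by apply/eqP; rewrite exprSr; field; rewrite gt_eqF.
have sx k : nr (s k - x) <= 2 * a * r.
  have [h _] := sP k; rewrite (le_trans h)// mulrBr mulr1 lerBlDr lerDl.
  by rewrite mulr_ge0 ?invr_ge0 ?exprn_ge0// !mulr_ge0// ltW.
have [|z [/= zx zcl]] := @compact_nr_ball R m x (2 * a * r) (s @ \oo) _.
  by exists 0%N => // k _; exact: sx.
have d20 : 0 < delta / 2 by rewrite divr_gt0.
have /(dist_continuousP dP)/(_ _ d20)/nbhs_nrP[h h0 hP] := fc z zx.
have h20 : 0 < h / 2 by rewrite divr_gt0.
have [K KP] := dyadic_small (ltW r0) h20.
have tail : (s @ \oo) [set y | exists2 k, (K <= k)%N & y = s k].
  by exists K => // k Kk; exists k.
have [y [[k Kk ->] sz]] := zcl _ _ tail (nr_ball_nbhs z h20).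
have [_ nosc] := sP k; apply: nosc => w ws.
have hsk : nr (s k - z) < h by lra.
have hw : nr (w - z) < h.
  by have := nr_tri (s k) w z; have := KP k Kk; lra.
have := hP _ hsk; have := hP _ hw.
by have := dist_tri dP (f z) (f (s k)) (f w); rewrite (distC dP (f (s k)) (f z)); lra.
Qed.

End Rescaling.

Section Zalcman.
Context {R : realType} {m n : nat} {N : topologicalType}.
Local Notation C := (cplx R).
Local Notation E := 'rV[C]_m.
Variables (B : atlas 'rV[C]_n N) (d : N -> N -> R).
Hypotheses (Nc : compact [set: N]) (dP : is_distance d).
Local Notation hol f x := (cdiff_at (std_atlas E) B f x).

Lemma homo_ltn_ge (s : nat -> nat) : {homo s : i j / (i < j)%N} -> forall i, (i <= s i)%N.
Proof. by move=> sh; elim=> [//|i IH]; rewrite (leq_ltn_trans IH)// sh. Qed.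

(** Near [z0] all the values lie in the domain of one chart of [N], which reduces the
    claim to bounded maps between vector spaces. *)
Lemma limit_holomorphic (g : nat -> E -> N) (phi : E -> N) (z0 : E) :
  {for z0, continuous phi} ->
  (exists (h : R) (M : nat), 0 < h /\ forall z j, nr (z - z0) < h -> (M <= j)%N ->
     hol (g j) z) ->
  (forall (y : E) (e : R), 0 < e -> exists (h : R) (M : nat), 0 < h /\ forall z j,
     nr (z - y) < h -> (M <= j)%N -> d (g j z) (phi z) < e) ->
  hol phi z0.
Proof.
move=> phic [h0 [M0 [h00 gh]]] luc.
have bz := pref_chartP B (phi z0); set b := pref_chart B (phi z0) in bz.
apply: (cdiff_one_chart phic bz); have [Bb bz'] := bz.
have bc q : chart_dom b q -> {for q, continuous b} by exact: chart_fun_cont.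
have nb : nbhs (phi z0) [set q | chart_dom b q /\ nr (b q - b (phi z0)) < 1].
  apply: filterI; first exact: open_nbhs_nbhs (conj (chart_dom_open b) bz').
  exact: (bc _ bz' _ (nr_ball_nbhs (b (phi z0)) ltr01)).
have [e1 e10 e1P] := (nbhs_distP dP _ _).1 nb.
have e20 : 0 < e1 / 2 by rewrite divr_gt0.
have /(dist_continuousP dP)/(_ _ e20)/nbhs_nrP[h1 h10 h1P] := phic.
have [h2 [M2 [h20 h2P]]] := luc z0 _ e20.
pose h := Num.min h0 (Num.min h1 h2).
have h_gt0 : 0 < h by rewrite !lt_min h00 h10.
have hP z : nr (z - z0) < h -> [/\ nr (z - z0) < h0, nr (z - z0) < h1 & nr (z - z0) < h2].
  by rewrite !lt_min => /and3P[].
pose M := maxn M0 M2.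
have gb (z : E) j : nr (z - z0) < h -> (M <= j)%N ->
    chart_dom b (g j z) /\ nr (b (g j z) - b (phi z0)) < 1.
  move=> /hP[_ z1 z2]; rewrite geq_max => /andP[_ Mj]; apply: e1P => /=.
  have := h1P _ z1; have := h2P _ _ z2 Mj; have := dist_tri dP (phi z) (phi z0) (g j z).
  by rewrite (distC dP (phi z) (g j z)) /=; lra.
have phib (z : E) : nr (z - z0) < h -> chart_dom b (phi z).
  move=> /hP[_ z1 _].
  have H : d (phi z0) (phi z) < e1 by have := h1P _ z1; lra.
  by have [] := e1P _ H.
pose fs k (z : E) := b (g (M + k)%N z).
have Mk k : (M <= M + k)%N by rewrite leq_addr.
apply: (@bounded_limit_differentiable R m n fs (fun z => b (phi z)) z0 h
  (nr (b (phi z0)) + 1) h_gt0 _ _ _ z0) => [k z zh|k z zh|z zh e e0|];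
  last by rewrite subrr nr0 divr_gt0.
- have [zh0 _ _] := hP z zh.
  have M0k : (M0 <= M + k)%N by rewrite (leq_trans (leq_maxl _ _) (Mk k)).
  have /std_cdiffP[_ H] := gh z _ zh0 M0k.
  by apply: H; split=> //; case: (gb z _ zh (Mk k)).
- have [_ H] := gb z _ zh (Mk k).
  by have := nr_subD (fs k z) (b (phi z0)); rewrite /fs in H *; lra.
- have nb' : nbhs (phi z) [set q | nr (b q - b (phi z)) < e].
    exact: (bc _ (phib z zh) _ (nr_ball_nbhs (b (phi z)) e0)).
  have [e2 e2_0 e2P] := (nbhs_distP dP _ _).1 nb'.
  have [h3 [M3 [h30 h3P]]] := luc z _ e2_0.
  exists M3 => k M3k; apply/ltW/e2P => /=; rewrite (distC dP).
  by apply: h3P; rewrite ?subrr ?nr0// (leq_trans M3k)// leq_addl.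
Qed.

(** Zalcman's rescaling. The points and scales come from [oscillation_selection]; the
    rescaled maps have small oscillation on all balls of radius 1/2, hence are
    equicontinuous, and large oscillation on the unit ball, which prevents the limit
    from being constant. *)
Theorem zalcman (F : set (E -> N)) (delta : R) (x0 : E) (R0 : R) :
  0 < delta ->
  schwarz_constant (m := m) B d delta ->
  0 < R0 ->
  (forall f, F f -> forall x, nr (x - x0) < R0 -> hol f x) ->
  (forall r : R, 0 < r -> exists f x, [/\ F f, nr (x - x0) < r & ~ small_osc d delta f x r]) ->
  exists (f_ : nat -> E -> N) (y_ : nat -> E) (rho_ : nat -> R) (phi : E -> N),
    [/\ forall j, F (f_ j),
        forall e : R, 0 < e -> exists M, forall j, (M <= j)%N ->
          nr (y_ j - x0) < e /\ rho_ j < e,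
        forall j, 0 < rho_ j,
        forall (z0 : E) (e : R), 0 < e -> exists (h : R) (M : nat), 0 < h /\
          forall z j, nr (z - z0) < h -> (M <= j)%N ->
          d (f_ j (y_ j + (rho_ j)%:C *: z)) (phi z) < e &
        (forall z, hol phi z) /\ exists z w, phi z <> phi w].
Proof.
move=> delta0 schwarzP R00 Fh nosc.
(* In [oscillation_selection] the parameter [a] is [q j], and the initial scale is
   [W j / q j]: then all displacements are at most [2 * W j], whereas the rescaled maps
   have small oscillation around all points of larger and larger balls. *)
pose q j : R := j.+1%:R; have q0 j : 0 < q j by [].
have q1 j : 1 <= q j by rewrite ler1n.
have [W WP] : exists W : nat -> R, forall j,
    [/\ 0 < W j, W j <= R0 / 8 & W j * q j = R0 / 8].
  exists (fun j => R0 / 8 / q j) => j; split; first by rewrite !divr_gt0.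
    by rewrite ler_pdivrMr// ler_peMr// divr_ge0// ltW.
  by rewrite divfK// gt_eqF.
have sel j : exists t : (E -> N) * E * R, [/\ F t.1.1, 0 < t.2,
    nr (t.1.2 - x0) <= 4 * W j /\ t.2 * q j <= W j,
    ~ small_osc d delta t.1.1 t.1.2 t.2 &
    forall z, nr (z - t.1.2) < q j * t.2 -> small_osc d delta t.1.1 z (t.2 / 2)].
  have [W0 WR _] := WP j; pose r := W j / q j.
  have r0 : 0 < r by rewrite divr_gt0.
  have rq : r * q j = W j by rewrite /r divfK// gt_eqF.
  have rle : r <= W j by rewrite -rq ler_peMr// ltW.
  have E2 : 2 * q j * r = 2 * W j by rewrite -mulrA [q j * r]mulrC rq.
  have [f [x [Ff xr nx]]] := nosc r r0.
  have fc (z : E) : nr (z - x) <= 2 * q j * r -> {for z, continuous f}.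
    rewrite E2 => zx.
    have zr : nr (z - x0) < R0.
      apply: le_lt_trans (nr_tri x z x0) _.
      apply: le_lt_trans (lerD zx (ltW (lt_le_trans xr rle))) _; lra.
    by have [] := Fh f Ff z zr.
  have [y [rho [rho0 rhor yx ny yP]]] :=
    oscillation_selection dP delta0 r0 (ltW (q0 j)) fc nx.
  exists (f, y, rho); split=> //=; split; last by rewrite -rq ler_pM2r.
  rewrite E2 in yx; apply: le_trans (nr_tri x y x0) _.
  by apply: le_trans (lerD yx (ltW (lt_le_trans xr rle))) _; lra.
have [t tP] := choice sel.
pose f j := (t j).1.1; pose y j := (t j).1.2; pose rho j := (t j).2.
have Ff j : F (f j) by have [] := tP j.
have rho0 j : 0 < rho j by have [] := tP j.
have yB j : nr (y j - x0) <= 4 * W j by have [_ _ []] := tP j.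
have rhoB j : rho j * q j <= W j by have [_ _ []] := tP j.
have nosc' j : ~ small_osc d delta (f j) (y j) (rho j) by have [] := tP j.
have osc j z : nr (z - y j) < q j * rho j -> small_osc d delta (f j) z (rho j / 2).
  by have [_ _ _ _] := tP j; exact.
have rhoB' j : rho j <= W j.
  by rewrite (le_trans _ (rhoB j))// ler_peMr// ltW.
have dom j (z : E) : nr (z - y j) < q j * rho j + rho j / 2 -> hol (f j) z.
  move=> zy; apply: Fh => //; apply: le_lt_trans (nr_tri (y j) z x0) _.
  have := yB j; have := rhoB j; have := rhoB' j; have [W0 WR _] := WP j.
  by rewrite mulrC => a1 a2 a3; lra.
have nsc j (z w : E) : nr (y j + (rho j)%:C *: z - (y j + (rho j)%:C *: w)) = rho j * nr (z - w).
  by rewrite opprD addrACA subrr add0r -scalerBr nrZ nr_real gtr0_norm.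
have nsc0 j (z : E) : nr (y j + (rho j)%:C *: z - y j) = rho j * nr z.
  by rewrite addrC addKr nrZ nr_real gtr0_norm.
pose g j (z : E) := f j (y j + (rho j)%:C *: z).
have equi (x : E) (e : R) : 0 < e -> exists (h : R), 0 < h /\ forall z j,
    nr (z - x) < h -> nr x < q j -> d (g j x) (g j z) < e.
  move=> e0; have [eta eta0 etaP] := schwarzP e e0.
  exists (eta / 2); split=> [|z j zx xj]; first by rewrite divr_gt0.
  have xq : nr (y j + (rho j)%:C *: x - y j) < q j * rho j.
    by rewrite nsc0 mulrC ltr_pM2r.
  apply: (etaP (f j) (y j + (rho j)%:C *: x) (rho j / 2)); first by rewrite divr_gt0.
  - move=> w wx; apply: dom; have := nr_tri (y j + (rho j)%:C *: x) w (y j); lra.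
  - exact: (osc j _ xq).
  - rewrite nsc mulrA [_ * rho j]mulrC -mulrA ltr_pM2l//; lra.
have ghol (z : E) j : nr z < q j -> hol (g j) z.
  move=> zq; have hz : hol (f j) (y j + (rho j)%:C *: z).
    by apply: dom; rewrite nsc0 mulrC; have := rho0 j; nra.
  have aff : isd (fun w : E => y j + (rho j)%:C *: w) z (fun h => (rho j)%:C *: h).
    by apply: isd_eq (isdD (isd_cst (y j) z) (isdZ (rho j)%:C (isd_id z))) => h; rewrite add0r.
  have /std_cdiffP[fc fd] := hz; apply/std_cdiffP; split.
    apply: (@continuous_comp _ _ _ (fun w : E => y j + (rho j)%:C *: w) (f j)) => //.
    exact: isd_continuous aff.
  by move=> b bz; have [] := isd_comp aff (isd_diff (fd b bz)).
pose K (k : nat) := [set z : E | nr (z - 0) <= k%:R].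
have Kc k : compact (K k) by exact: compact_nr_ball.
have gequi k x : K k x -> forall e : R, 0 < e ->
    \forall z \near x & j \near \oo, d (g j z) (g j x) < e.
  rewrite /K /= subr0 => xk e e0; have [h [h0 hP]] := equi x e e0.
  exists ([set z | nr (z - x) < h], [set j | (k <= j)%N]) => /=.
    by split; [apply/nbhs_nrP; exists h|exists k].
  move=> [z j] /= [zx kj]; rewrite (distC dP); apply: hP => //.
  by rewrite (le_lt_trans xk)// ltr_nat.
have [s [sh [phi phiP]]] := ascoli_subsequence dP Nc Kc gequi.
have s_ge := homo_ltn_ge sh.
have big (x : R) : exists M : nat, forall j, (M <= j)%N -> x < j%:R.
  exists (Num.truncn x).+1 => j Mj; apply: lt_le_trans (truncnS_gt _) _.
  by rewrite ler_nat.
have luc (z0 : E) (e : R) : 0 < e -> exists (h : R) (M : nat), 0 < h /\ forall z j,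
    nr (z - z0) < h -> (M <= j)%N -> d (g (s j) z) (phi z) < e.
  move=> e0; have [k /(_ k (leqnn k)) kP] := big (nr z0 + 1).
  have [M _ MP] := phiP k e e0.
  exists 1, M; split=> // z j zz Mj; apply: MP => //; rewrite /K /= subr0.
  by have := nr_subD z z0; lra.
have phic (z0 : E) : {for z0, continuous phi}.
  apply/(dist_continuousP dP) => e e0; have e30 : 0 < e / 3 by rewrite divr_gt0.
  have [h1 [M1 [h10 h1P]]] := luc z0 _ e30; have [h2 [h20 h2P]] := equi z0 _ e30.
  have [M2 M2P] := big (nr z0).
  apply/nbhs_nrP; exists (Num.min h1 h2); first by rewrite lt_min h10.
  move=> z; rewrite lt_min => /andP[z1 z2]; pose j := maxn M1 M2.
  have zq : nr z0 < q (s j).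
    apply: M2P; rewrite (leq_trans _ (leqnSn _))// (leq_trans _ (s_ge j))//.
    exact: leq_maxr.
  have a1 := h1P z j z1 (leq_maxl _ _); have a2 := h2P z (s j) z2 zq.
  have a3 : d (g (s j) z0) (phi z0) < e / 3.
    by apply: h1P; [rewrite subrr nr0|exact: leq_maxl].
  have := dist_tri dP (g (s j) z0) (phi z0) (phi z).
  have := dist_tri dP (g (s j) z) (g (s j) z0) (phi z).
  by rewrite (distC dP (phi z0) (g (s j) z0)); lra.
exists (fun j => f (s j)), (fun j => y (s j)), (fun j => rho (s j)), phi; split=> //.
- move=> e e0; have [M MP] := big (R0 / e); exists M => j Mj.
  have : R0 / e < q (s j).
    by apply: MP; rewrite (leq_trans Mj)// (leq_trans (s_ge j)).
  rewrite ltr_pdivrMr// => Rq; have [W0 WR Wq] := WP (s j).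
  have We : 8 * W (s j) < e.
    rewrite -(ltr_pM2r (q0 (s j))) -mulrA Wq.
    have -> : 8 * (R0 / 8) = R0 by field.
    by rewrite mulrC.
  by have := yB (s j); have := rhoB' (s j); split; lra.
- split.
    move=> z; apply: (@limit_holomorphic (fun j => g (s j)) phi z (phic z)) => //.
    have [M MP] := big (nr z + 1); exists 1, M; split=> // w j wz Mj; apply: ghol.
    apply: (@lt_trans _ _ (nr z + 1)); first by have := nr_subD w z; lra.
    by apply: MP; rewrite (leq_trans Mj)// (leq_trans (s_ge j)).
  apply: contrapT => ncst.
  have cst z w : phi z = phi w.
    by apply: contrapT => zw; apply: ncst; exists z, w.
  have d20 : 0 < delta / 2 by rewrite divr_gt0.
  have [M _ /(_ M (leqnn M)) MP] := phiP 1%N _ d20.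
  apply: (nosc' (s M)) => w wy.
  pose z := (rho (s M))^-1%:C *: (w - y (s M)).
  have wE : w = y (s M) + (rho (s M))%:C *: z.
    rewrite /z scalerA -rmorphM divff ?gt_eqF// scale1r.
    by rewrite addrC subrK.
  have z1 : K 1%N z.
    rewrite /K /= subr0 nrZ nr_real gtr0_norm ?invr_gt0//.
    by rewrite ler_pdivrMl// mulr1 ltW.
  have o1 : K 1%N 0 by rewrite /K /= subrr nr0.
  have h1 := MP _ z1; have h2 := MP _ o1.
  rewrite /g scaler0 addr0 -wE (cst 0 z) in h1 h2.
  have := dist_tri dP (phi z) (f (s M) (y (s M))) (f (s M) w).
  rewrite (distC dP (phi z) (f (s M) w)); lra.
Qed.

End Zalcman.

(** * Normality and uniform convergence *)

Section NormalityCriteria.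
Context {R : realType}.

(** An ultrafilter that contains no single term of the sequence contains its tails. *)
Lemma compact_sequence (X : topologicalType) (v : nat -> X) (p : X) :
  v @ \oo --> p -> compact ([set p] `|` range v).
Proof.
move=> vp; rewrite compact_ultra => W WU WK.
have WP : ProperFilter W by exact: ultra_proper.
have [[i Wi]|nW] := pselect (exists i, W [set v i]).
  exists (v i); split; first by right; exists i.
  by move=> V /nbhs_singleton Vi; apply: filterS Wi => _ ->.
exists p; split; first by left.
move=> V Vnb; have [M _ MP] := vp _ Vnb.
have Wn k : W [set q | forall i, (i < k)%N -> q <> v i].
  elim: k => [|k IH]; first exact: filterS filterT.
  have [Wi|Wi] := in_ultra_setVsetC [set v k] WU; first by exfalso; apply: nW; exists k.
  apply: filterS2 IH Wi => q q1 q2 i; rewrite ltnS leq_eqVlt => /orP[/eqP ->|]; first exact: q2.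
  exact: q1.
apply: filterS2 WK (Wn M) => q [->|[i _ <-]] q2; first exact: nbhs_singleton.
have [Mi|iM] := leqP M i; first exact: MP.
by have := q2 i iM.
Qed.

Lemma set_type_cvg (X : topologicalType) (U : set X) (c : nat -> U) (x : U) :
  (fun j => set_val (c j)) @ \oo --> set_val x -> c @ \oo --> x.
Proof.
move=> cx V [/= _ [[W oW <-] Wx] WV].
have [M _ MP] := cx _ (open_nbhs_nbhs (conj oW Wx)).
by exists M => // j Mj; apply: WV; exact: MP.
Qed.

Section Uniform.
Context {X N : topologicalType} (d : N -> N -> R).
Hypothesis dP : is_distance d.

Lemma point_compact_open_nbhs (g : {compact-open, X -> N}) (x : X) (e : R) : 0 < e ->
  nbhs g [set h | d (g x) (h x) < e].
Proof.
move=> e0; have nb := dist_ball_nbhs dP (g x) e0.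
have oO : open (interior [set q | d (g x) q < e]) by exact: open_interior.
have H := @compact_open_open X N [set x] _ (@compact_set1 _ x) oO.
have : nbhs g [set h : X -> N | h @` [set x] `<=` interior [set q | d (g x) q < e]].
  by apply: open_nbhs_nbhs; split; [exact: H|move=> _ [_ -> <-]].
apply: filterS => h hx; apply: (@interior_subset _ [set q | d (g x) q < e]).
by apply: hx; exists x.
Qed.

Lemma uniform_compact_open (v : nat -> X -> N) (psi : X -> N) : continuous psi ->
  (forall e : R, 0 < e -> exists M, forall i, (M <= i)%N -> forall x, d (v i x) (psi x) < e) ->
  (v : nat -> {compact-open, X -> N}) @ \oo --> (psi : {compact-open, X -> N}).
Proof.
move=> psic unif; apply/compact_open_cvgP => K O Kc oO psiKO.
have /compact_near_coveringP := Kc.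
move=> /(_ _ \oo (fun i x => O (v i x)) _) [x Kx|M _ MP]; last first.
  by exists M => // i Mi _ [x Kx <-]; exact: (MP i Mi x Kx).
have nO : nbhs (psi x) O by apply: open_nbhs_nbhs; split=> //; apply: psiKO; exists x.
have [e e0 eO] := (nbhs_distP dP _ _).1 nO.
have e20 : 0 < e / 2 by rewrite divr_gt0.
have [M MP] := unif _ e20.
have nx : \forall y \near x, d (psi x) (psi y) < e / 2.
  by have /(dist_continuousP dP) := psic x; exact.
exists ([set y | d (psi x) (psi y) < e / 2], [set i | (M <= i)%N]) => /=.
  by split=> //; exists M.
move=> [y i] /= [xy Mi]; apply: eO => /=; have := MP i Mi y.
by have := dist_tri dP (psi y) (psi x) (v i y); rewrite (distC dP (psi y)); lra.
Qed.

(** A uniformly convergent sequence of continuous maps, together with its limit, is a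
    closed and compact set of continuous maps. *)
Lemma uniform_relatively_compact (v : nat -> X -> N) (psi : X -> N) :
  (forall i, continuous (v i)) -> continuous psi ->
  (forall e : R, 0 < e -> exists M, forall i, (M <= i)%N -> forall x, d (v i x) (psi x) < e) ->
  relatively_compact (range v).
Proof.
move=> vc psic unif; have cv := uniform_compact_open psic unif.
rewrite /relatively_compact.
have := @compact_sequence {compact-open, X -> N} v psi cv.
congr compact; apply/seteqP; split.
  move=> g [->|[i _ <-]]; last by split; [apply: subset_closure; exists i|exact: vc].
  split; last exact: psic.
  move=> V /cv[M _ MP]; exists (v M); split; first by exists M.
  by apply: MP => /=.
move=> g [gcl _]; have [[i gi]|ng] := pselect (exists i, g = v i); first by right; exists i.
(* A limit [g] other than the terms has a neighborhood that avoids finitely many of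
   them, so that it is determined by the remaining ones. *)
left; apply/funext => x; apply: dist0 dP _ _ _; apply/eqP; apply: contrapT => /negP gp.
have {}gp : 0 < d (g x) (psi x) by rewrite lt_def gp (dist_ge0 dP).
have e0 : 0 < d (g x) (psi x) / 2 by rewrite divr_gt0.
have [M MP] := unif _ e0.
have nb k : nbhs (g : {compact-open, X -> N}) [set h | forall i, (i < k)%N -> h <> v i].
  elim: k => [|k IH]; first exact: filterS filterT.
  have [y gy] : exists y, g y <> v k y.
    apply: contrapT => ny; apply: ng; exists k; apply/funext => y.
    by apply: contrapT => gy; apply: ny; exists y.
  have e'0 : 0 < d (g y) (v k y).
    rewrite lt_def (dist_ge0 dP) andbT; apply/eqP => /(dist0 dP); exact: gy.
  apply: filterS2 IH (point_compact_open_nbhs g y e'0) => h h1 h2 i.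
  rewrite ltnS leq_eqVlt => /orP[/eqP -> hE|]; last exact: h1.
  by move: h2; rewrite /= hE ltxx.
have [h [[i _ <-] [/= h1 h2]]] := gcl _ (filterI (nb M) (point_compact_open_nbhs g x e0)).
have [Mi|iM] := leqP M i; last by have := h1 i iM.
have := MP i Mi x; have := dist_tri dP (v i x) (g x) (psi x); lra.
Qed.

(** A cluster map [g] of the sequence is continuous, and some late [v i] is close to
    [g p0] on the compact set formed by [p0] and the points [c i]: hence [q = g p0]. *)
Lemma relatively_compact_same_limit (U : set X) (v : nat -> U -> N) (p0 : U) :
  (forall i, continuous (v i)) -> relatively_compact (range v) ->
  exists q0 : N, forall (c : nat -> U) (q : N), c @ \oo --> p0 ->
    (forall e : R, 0 < e -> exists M, forall i, (M <= i)%N -> d (v i (c i)) q < e) -> q = q0.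
Proof.
move=> vc rc.
pose T := closure (range v : set {compact-open, U -> N}) `&`
  [set f : {compact-open, U -> N} | continuous (f : U -> N)].
have FT : ((v : nat -> {compact-open, U -> N}) @ \oo) T.
  by exists 0%N => // i _; split; [apply: subset_closure; exists i|exact: vc].
have [g [[_ gc] gcl]] := rc _ _ FT.
exists (g p0) => c q cp cq; apply: dist0 dP _ _ _; apply/eqP; apply: contrapT => /negP qp.
have {}qp : 0 < d q (g p0) by rewrite lt_def qp (dist_ge0 dP).
have e0 : 0 < d q (g p0) / 2 by rewrite divr_gt0.
have [M1 M1P] := cq _ e0.
pose O := interior [set q' | d (g p0) q' < d q (g p0) / 2].
have oO : open O by exact: open_interior.
have nO : nbhs (g p0) O.
  by apply: open_nbhs_nbhs; split=> //; exact: (dist_ball_nbhs dP (g p0) e0).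
have [M2 _ M2P] := cp _ (gc p0 _ nO).
pose K := [set p0] `|` range (fun i => c (M2 + i)%N).
have cK : compact K.
  apply: compact_sequence => V Vp; have [M _ MP] := cp _ Vp.
  by exists M => // i /= Mi; apply: MP; rewrite /= (leq_trans Mi)// leq_addl.
have gK : nbhs (g : {compact-open, U -> N}) [set h : U -> N | h @` K `<=` O].
  apply: open_nbhs_nbhs; split; first exact: compact_open_open.
  move=> _ [x [->|[i _ <-]] <-]; first exact: nbhs_singleton.
  by apply: M2P; rewrite /= leq_addr.
have tail : ((v : nat -> {compact-open, U -> N}) @ \oo)
    [set h | exists2 i, (maxn M1 M2 <= i)%N & h = v i].
  by exists (maxn M1 M2) => // i Mi; exists i.
have [h [[i Mi ->] hK]] := gcl _ _ tail gK.
have [M1i M2i] : (M1 <= i)%N /\ (M2 <= i)%N by apply/andP; rewrite -geq_max.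
have Ovi : O (v i (c i)).
  by apply: hK; exists (c i) => //; right; exists (i - M2)%N => //; rewrite subnKC.
have /= := @interior_subset _ [set q' | d (g p0) q' < d q (g p0) / 2] _ Ovi.
have := M1P i M1i; have := dist_tri dP (v i (c i)) q (g p0).
by rewrite (distC dP q (v i (c i))) (distC dP (v i (c i)) (g p0)); lra.
Qed.

End Uniform.

End NormalityCriteria.

Section LocalFamilies.
Context {R : realType} {m n : nat} {M N : topologicalType}.
Local Notation C := (cplx R).
Local Notation E := 'rV[C]_m.
Variables (A : atlas E M) (B : atlas 'rV[C]_n N).

Lemma chart_ball (p0 : M) (a : chart E M) (Omega : set M) :
  chart_at A p0 a -> open Omega -> Omega p0 ->
  exists2 R0 : R, 0 < R0 & forall y, nr (y - a p0) < R0 ->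
    [/\ chart_dom a (chart_inv a y), a (chart_inv a y) = y & Omega (chart_inv a y)].
Proof.
move=> ap oO Op.
have nO : \forall y \near a p0, Omega (chart_inv a y).
  by apply: chart_inv_near; [case: ap|exact: open_nbhs_nbhs].
have /nbhs_nrP[r1 r10 r1P] := chart_at_inv ap; have /nbhs_nrP[r2 r20 r2P] := nO.
exists (Num.min r1 r2); first by rewrite lt_min r10.
by move=> y; rewrite lt_min => /andP[/r1P[[_ h1] h2] /r2P h3].
Qed.

Lemma holomorphic_in_chart (f : M -> N) (Omega : set M) (a : chart E M) (y : E) :
  holomorphic_on A B Omega f -> charts A a -> Omega (chart_inv a y) ->
  chart_dom a (chart_inv a y) -> a (chart_inv a y) = y ->
  cdiff_at (std_atlas E) B (fun z => f (chart_inv a z)) y.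
Proof.
move=> fh Aa Oy ay yE; have [fc fd] := fh _ Oy.
apply/std_cdiffP; split.
  apply: (@continuous_comp _ _ _ (chart_inv a) f) => //.
  by apply: chart_inv_cont; exists (chart_inv a y).
by move=> b bf; have := fd a b (conj Aa ay) bf; rewrite yE.
Qed.

Variables (d : N -> N -> R).
Hypotheses (Nc : compact [set: N]) (dP : is_distance d).

(** A family whose members have small oscillation on all balls of one radius around
    the points near [p0] is equicontinuous there, by the Schwarz lemma. *)
Lemma normal_of_small_osc (Omega : set M) (F : set (M -> N)) (p0 : M) (a : chart E M)
    (delta R0 r : R) :
  schwarz_constant (m := m) B d delta ->
  (forall f, F f -> holomorphic_on A B Omega f) ->
  chart_at A p0 a ->
  (forall y, nr (y - a p0) < R0 ->
    [/\ chart_dom a (chart_inv a y), a (chart_inv a y) = y & Omega (chart_inv a y)]) ->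
  0 < r -> r + r <= R0 ->
  (forall f x, F f -> nr (x - a p0) < r -> small_osc d delta (fun z => f (chart_inv a z)) x r) ->
  normal_at Omega F p0.
Proof.
move=> schwarzP Fh ap RP r0 rR osc; have [Aa adom] := ap.
pose U := [set h : M | chart_dom a h /\ nr (a h - a p0) < r / 2].
have nrU h : U h -> nbhs h U.
  move=> [ah hr]; apply: filterI; first exact: open_nbhs_nbhs (conj (chart_dom_open a) ah).
  have ac : {for h, continuous a} by exact: chart_fun_cont.
  have nb : nbhs (a h) [set y | nr (y - a p0) < r / 2].
    by apply: open_nbhs_nbhs; split=> //; exact: open_nr_ball.
  exact: (ac _ nb).
have UOmega : U `<=` Omega.
  move=> h [ah hr]; have [] := RP (a h) _; first by lra.
  by rewrite chart_funK.
exists U; split=> //.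
- by rewrite openE.
- by split=> //; rewrite subrr nr0 divr_gt0.
move=> u uF.
have uF' j : exists f, F f /\ (fun x : U => f (set_val x)) = u j.
  by have [f Ff fu] := uF j; exists f.
have [f fP] := choice uF'.
have Ff j : F (f j) by have [] := fP j.
have uE j (x : U) : u j x = f j (set_val x) by have [_ <-] := fP j.
pose g j (z : E) := f j (chart_inv a z).
pose K (k : nat) := [set y : E | nr (y - a p0) <= r / 2].
have Kc k : compact (K k) by exact: compact_nr_ball.
have hg j y : nr (y - a p0) < R0 -> cdiff_at (std_atlas E) B (g j) y.
  by move=> /RP[h1 h2 h3]; apply: (@holomorphic_in_chart (f j) Omega) => //; exact: Fh.
have equi k x : K k x -> forall e : R, 0 < e ->
    \forall y \near x & j \near \oo, d (g j y) (g j x) < e.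
  move=> xK e e0; have [eta eta0 etaP] := schwarzP e e0.
  have er0 : 0 < eta * r by rewrite mulr_gt0.
  exists ([set y | nr (y - x) < eta * r], setT) => /=.
    by split; [apply/nbhs_nrP; exists (eta * r)|exact: filterT].
  rewrite /K /= in xK.
  move=> [y j] /= [yx _]; rewrite (distC dP); apply: (etaP (g j) x r) => //.
    by move=> w wx; apply: hg; have := nr_tri x w (a p0); lra.
  by apply: osc => //; lra.
have [s [sh [phi phiP]]] := ascoli_subsequence dP Nc Kc equi.
exists s; split; first exact: sh.
left; pose psi (x : U) := phi (a (set_val x)).
have Uval (x : U) : chart_dom a (set_val x) /\ nr (a (set_val x) - a p0) < r / 2 := set_valP x.
have unif (e : R) : 0 < e -> exists M0, forall i, (M0 <= i)%N -> forall x,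
    d (u (s i) x) (psi x) < e.
  move=> e0; have [M0 _ MP] := phiP 0%N e e0; exists M0 => i Mi x.
  have [x1 x2] := Uval x; have := MP i Mi (a (set_val x)) (ltW x2).
  by rewrite /g chart_funK// uE.
have valc : continuous (set_val : U -> M) by exact: initial_continuous.
have uc j : continuous (u j).
  move=> x; have [fc _] := Fh _ (Ff j) _ (UOmega _ (Uval x)).
  have H := @continuous_comp _ _ _ (set_val : U -> M) (f j) x (valc x) fc.
  by have -> : u j = f j \o set_val by apply/funext => y; rewrite uE.
apply: (uniform_relatively_compact dP _ _ unif); first by move=> i; exact: uc.
move=> x; apply/(dist_continuousP dP) => e e0; have e30 : 0 < e / 3 by rewrite divr_gt0.
have [M0 /(_ M0 (leqnn M0)) MP] := unif _ e30.
have := uc (s M0) x; move=> /(dist_continuousP dP)/(_ _ e30).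
apply: filterS => y uy; have := MP x; have := MP y.
have := dist_tri dP (u (s M0) x) (psi x) (psi y).
have := dist_tri dP (u (s M0) y) (u (s M0) x) (psi y).
by rewrite (distC dP (psi x) (u (s M0) x)); lra.
Qed.

End LocalFamilies.

(** * The rescaled exponential mappings *)

Section RescaledExponential.
Context {R : realType} {m : nat} (G : complexLieGroup R m).
Local Notation C := (cplx R).
Local Notation A := (cs_atlas (lie_struct G)).
Local Notation E := 'rV[C]_m.
Local Notation b0 := (chart1 G).
Variable eps : 'I_m -> tangent (lie_struct G) (1 : G)%g.
Hypothesis epsP : is_basis eps.
Variables (p0 : G) (a : chart E G).
Hypothesis ap0 : chart_at A p0 a.

(** The differential at [0] of [z |-> exp_{p0} (dL_{p0} (eps z^T))], in the chart [a]. *)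
Definition frame (z : E) : E := lvec a p0 ((\sum_(k < m) z 0 k *: eps k) b0).

Lemma frame_coordE (z : E) : (\sum_(k < m) z 0 k *: eps k) b0 = \sum_(k < m) z 0 k *: (eps k b0).
Proof. exact: tangent_sumE. Qed.

Lemma frame_coord_bound : exists2 K : R, 0 < K &
  forall z : E, nr ((\sum_(k < m) z 0 k *: eps k) b0) <= K * nr z.
Proof.
exists (\sum_(k < m) nr (eps k b0) + 1).
  by rewrite ltr_wpDl// sumr_ge0// => k _; exact: nr_ge0.
move=> z; rewrite frame_coordE mulrDl mul1r.
have H : nr (\sum_(k < m) z 0 k *: (eps k b0)) <= \sum_(k < m) nr (z 0 k *: (eps k b0)).
  elim/big_ind2: _ => [|x1 x2 y1 y2 h1 h2|//]; first by rewrite nr0.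
  by rewrite (le_trans (nrD _ _))// lerD.
rewrite (le_trans H)// ler_wpDr ?nr_ge0// mulr_suml ler_sum// => k _.
by rewrite nrZ mulrC ler_wpM2l ?nr_ge0// nr_coord.
Qed.

Lemma frame_isd (z : E) : isd frame z frame.
Proof.
have [K K0 KP] := frame_coord_bound.
have [M M0 MP] := diff_nr_bounded (lvec_isd ap0).1.
have lin : linear frame.
  move=> k x y; rewrite /frame !frame_coordE -lvecZ.
  have -> : \sum_(i < m) (k *: x + y) 0 i *: (eps i b0) =
     k *: (\sum_(i < m) x 0 i *: (eps i b0)) + \sum_(i < m) y 0 i *: (eps i b0).
    rewrite scaler_sumr -big_split/=; apply: eq_bigr => i _.
    by rewrite !mxE scalerDl scalerA.
  by rewrite /lvec linearD.
apply: (@isd_affine R _ _ _ _ frame (M * K)) => //.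
  move=> h; rewrite (le_trans (MP _))// -mulrA ler_wpM2l//; exact: ltW.
move=> y; have := lin (-1) z y; rewrite !scaleN1r => H.
by rewrite [y - z]addrC H addrC.
Qed.

Lemma frame_surjective (u : E) : exists z, frame z = u.
Proof.
have [w <-] := lvec_surjective ap0 u.
have [z [zE _]] := epsP (tangent_of (lie_struct G) (1 : G)%g b0 w).
exists z; rewrite /frame -zE; congr (lvec a p0 _).
by apply: tangent_ofE; exact: chart1P.
Qed.

(** The case of [exp_asymptotics] where the tangent vectors are bounded and scaled by
    [rho_]: in the chart [a] the error is [o(rho)]. *)
Lemma rescaled_exp (p_ : nat -> G) (rho_ : nat -> R) :
  p_ @ \oo --> p0 -> (forall j, 0 < rho_ j) -> rho_ @ \oo --> (0 : R) ->
  forall (z0 : E) (e : R), 0 < e -> exists (h : R) (M : nat), 0 < h /\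
    forall (z : E) j, nr (z - z0) < h -> (M <= j)%N ->
    let q := lie_exp ((rho_ j)%:C *: dL_e (p_ j) (\sum_(k < m) z 0 k *: eps k)) in
    chart_dom a q /\ nr (a q - a (p_ j) - (rho_ j)%:C *: frame z) <= e * rho_ j.
Proof.
move=> pp rho0 rhoc z0 e e0.
have [K K0 KP] := frame_coord_bound.
pose Q := K * (nr z0 + 1).
have Q0 : 0 < Q by rewrite mulr_gt0// ltr_wpDl ?nr_ge0.
have [d d0 dP] := exp_asymptotics ap0 (divr_gt0 e0 Q0).
have [adom ac] : chart_dom a p0 /\ {for p0, continuous a}.
  by case: ap0 => _ h; split=> //; exact: chart_fun_cont.
have [M1 _ M1P] := pp _ (open_nbhs_nbhs (conj (chart_dom_open a) adom)).
have [M2 _ M2P] := pp _ (ac _ (nr_ball_nbhs (a p0) d0)).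
have dQ0 : 0 < d / Q by rewrite divr_gt0.
have /cvgrPdist_lt/(_ _ dQ0)[M3 _ M3P] := rhoc.
exists 1, (maxn M1 (maxn M2 M3)); split=> // z j zz; rewrite !geq_max => /and3P[h1 h2 h3].
have vQ : nr ((\sum_(k < m) z 0 k *: eps k) b0) <= Q.
  rewrite (le_trans (KP z))// ler_wpM2l//; first exact: ltW.
  by have := nr_subD z z0; lra.
have rQ : rho_ j * Q < d.
  by have := M3P j h3; rewrite /= sub0r normrN gtr0_norm// ltr_pdivlMr.
have kd : rho_ j * nr ((\sum_(k < m) z 0 k *: eps k) b0) < d.
  by apply: le_lt_trans rQ; rewrite ler_pM2l.
have [q1 q2] := dP (p_ j) (rho_ j) (\sum_(k < m) z 0 k *: eps k)
  (M1P j h1) (M2P j h2) (ltW (rho0 j)) kd.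
split; first exact: q1.
apply: le_trans q2 _; rewrite mulrAC ler_pdivrMr// -mulrA.
by rewrite ler_pM2l// ler_pM2l.
Qed.

Lemma rescaled_exp_cvg (p_ : nat -> G) (rho_ : nat -> R) (z : E) :
  p_ @ \oo --> p0 -> (forall j, 0 < rho_ j) -> rho_ @ \oo --> (0 : R) ->
  (fun j => lie_exp ((rho_ j)%:C *: dL_e (p_ j) (\sum_(k < m) z 0 k *: eps k))) @ \oo --> p0.
Proof.
move=> pp rho0 rhoc V Vp.
have [adom ac] : chart_dom a p0 /\ {for p0, continuous a}.
  by case: ap0 => _ h; split=> //; exact: chart_fun_cont.
have /nbhs_nrP[r r0 rP] := chart_inv_near adom Vp.
have [h [M [h0 MP]]] := rescaled_exp pp rho0 rhoc z ltr01.
have r20 : 0 < r / 2 by rewrite divr_gt0.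
have [M1 _ M1P] := pp _ (ac _ (nr_ball_nbhs (a p0) r20)).
have D0 : 0 < r / 2 / (1 + nr (frame z)).
  by rewrite divr_gt0// ltr_wpDr ?nr_ge0.
have /cvgrPdist_lt/(_ _ D0)[M3 _ M3P] := rhoc.
exists (maxn M (maxn M1 M3)) => // j /=; rewrite !geq_max => /and3P[h1 h2 h3].
have zz : nr (z - z) < h by rewrite subrr nr0.
have /= [q1 q2] := MP z j zz h1; move: q1 q2; set q := lie_exp _ => q1 q2.
suff : V (chart_inv a (a q)) by rewrite chart_funK.
apply: rP.
have := M3P j h3; rewrite /= sub0r normrN gtr0_norm// ltr_pdivlMr ?ltr_wpDr ?nr_ge0// => rr.
have pr := M1P j h2; rewrite /= in pr.
have T1 := nr_tri (a (p_ j)) (a q) (a p0).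
have T2 := nr_subD (a q - a (p_ j)) ((rho_ j)%:C *: frame z).
rewrite nrZ nr_real gtr0_norm// in T2.
rewrite mulrDr mulr1 in rr; rewrite mul1r in q2.
by clear -T1 T2 rr q2 pr; lra.
Qed.

End RescaledExponential.

(** * Rescaling of a family on the group *)

Section RescalingCriterion.
Context {R : realType} {m n : nat} (G : complexLieGroup R m) {N : topologicalType}.
Local Notation C := (cplx R).
Local Notation A := (cs_atlas (lie_struct G)).
Local Notation E := 'rV[C]_m.
Variables (B : atlas 'rV[C]_n N) (d : N -> N -> R).
Hypotheses (Nc : compact [set: N]) (dP : is_distance d).
Variable eps : 'I_m -> tangent (lie_struct G) (1 : G)%g.
Hypothesis epsP : is_basis eps.
Variables (Omega : set G) (F : set (G -> N)) (p0 : G).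
Hypotheses (Omega_open : open Omega) (Omega_p0 : Omega p0).
Hypothesis Fh : forall f, F f -> holomorphic_on A B Omega f.

Let psi (p_ : nat -> G) (rho_ : nat -> R) (j : nat) (z : E) : G :=
  lie_exp ((rho_ j)%:C *: dL_e (p_ j) (\sum_(k < m) z 0 k *: eps k)).

(** All the points [psi j z] tend to [p0], where the subsequential limits of a normal
    family are continuous: hence the limit does not depend on [z]. *)
Lemma normal_limit_constant f_ p_ rho_ (phi : E -> N) :
  normal_at Omega F p0 ->
  (forall j, F (f_ j)) -> p_ @ \oo --> p0 ->
  (forall j, 0 < rho_ j) -> rho_ @ \oo --> (0 : R) ->
  cvg_on_compacts d (fun j => psi p_ rho_ j @^-1` Omega)
    (fun j => f_ j \o psi p_ rho_ j) phi ->
  exists q0, forall z, phi z = q0.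
Proof.
move=> [U [oU Up0 UO nU]] Ff pp rho0 rhoc cvg.
pose u j := fun x : set_type U => f_ j (set_val x).
have uF j : [set (fun x : set_type U => f (set_val x)) | f in F] (u j) by exists (f_ j).
have [s [sh sP]] := nU u uF.
pose x0 : set_type U := exist _ p0 (mem_set Up0).
(* Compact divergence is excluded by testing it on a point and on the compact [N]. *)
case: sP => [rc|cd]; last first.
  have [M _ /(_ M (leqnn M))] := cd [set x0] setT (@compact_set1 _ x0) Nc.
  by rewrite setIT => H; have : set0 (u (s M) x0) by rewrite -H; exists x0.
have uc j : continuous (u j).
  move=> x; have [fc _] := Fh (Ff j) (UO _ (set_valP x)).
  have valc : continuous (set_val : set_type U -> G) by exact: initial_continuous.
  exact: (@continuous_comp _ _ _ (set_val : set_type U -> G) (f_ j) x (valc x) fc).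
have [q0 qP] := relatively_compact_same_limit dP x0 (fun i => uc (s i)) rc.
exists q0 => z.
have s_ge := homo_ltn_ge sh.
have psip : psi p_ rho_ ^~ z @ \oo --> p0.
  exact: (rescaled_exp_cvg eps (pref_chartP A p0) z pp rho0 rhoc).
have [M1 _ M1P] := psip _ (open_nbhs_nbhs (conj oU Up0)).
pose c i : set_type U := if pselect (U (psi p_ rho_ (s i) z)) is left h
  then exist _ (psi p_ rho_ (s i) z) (mem_set h) else x0.
have cE i : (M1 <= i)%N -> set_val (c i) = psi p_ rho_ (s i) z.
  move=> Mi; rewrite /c; case: pselect => //; case.
  by apply: M1P; exact: leq_trans (s_ge i).
apply: (qP c); last first.
  move=> e e0; have [_ /(_ e e0)[M2 _ M2P]] := cvg [set z] (@compact_set1 _ z).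
  exists (maxn M1 M2) => i; rewrite geq_max => /andP[i1 i2].
  rewrite /= /u cE//; apply: (M2P (s i)) => //; exact: leq_trans (s_ge i).
apply: set_type_cvg => V Vp; have [M3 _ M3P] := psip _ Vp.
exists (maxn M1 M3) => // i; rewrite /= geq_max => /andP[i1 i3].
by rewrite cE//; apply: M3P; exact: leq_trans (s_ge i).
Qed.

(** In the chart [a] the point [psi j z] has the form [y_ j + rho_ j w], where [w] is
    close to [frame z] for large [j], locally uniformly in [z]. *)
Lemma rescaling_through_exp (a : chart E G) (R0 : R) (f_ : nat -> G -> N) (p_ : nat -> G)
    (y_ : nat -> E) (rho_ : nat -> R) (Phi : E -> N) :
  chart_at A p0 a -> 0 < R0 ->
  (forall y, nr (y - a p0) < R0 ->
    [/\ chart_dom a (chart_inv a y), a (chart_inv a y) = y & Omega (chart_inv a y)]) ->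
  p_ @ \oo --> p0 -> (forall j, 0 < rho_ j) -> rho_ @ \oo --> (0 : R) ->
  (exists M, forall j, (M <= j)%N -> a (p_ j) = y_ j) ->
  (forall z, {for z, continuous Phi}) ->
  (forall (z0 : E) (e : R), 0 < e -> exists (h : R) (M : nat), 0 < h /\
     forall z j, nr (z - z0) < h -> (M <= j)%N ->
     d (f_ j (chart_inv a (y_ j + (rho_ j)%:C *: z))) (Phi z) < e) ->
  cvg_on_compacts d (fun j => psi p_ rho_ j @^-1` Omega)
    (fun j => f_ j \o psi p_ rho_ j) (Phi \o frame eps p0 a).
Proof.
move=> ap R00 RP pp rho0 rhoc [M0 apy] Phic luc.
have loc (z0 : E) (e : R) : 0 < e -> exists (h : R) (M : nat), 0 < h /\
    forall z j, nr (z - z0) < h -> (M <= j)%N ->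
    Omega (psi p_ rho_ j z) /\ d (f_ j (psi p_ rho_ j z)) (Phi (frame eps p0 a z)) < e.
  move=> e0; have e30 : 0 < e / 3 by rewrite divr_gt0.
  pose w0 := frame eps p0 a z0.
  have [h1 [M1 [h10 h1P]]] := luc w0 _ e30.
  have /(dist_continuousP dP)/(_ _ e30)/nbhs_nrP[h2 h20 h2P] := Phic w0.
  have [h [h_gt0 hh1 hh2]] : exists h : R, [/\ 0 < h, h <= h1 & h <= h2].
    by exists (Num.min h1 h2); rewrite lt_min h10 h20 !ge_min !lexx orbT.
  have hh0 : 0 < h / 2 by rewrite divr_gt0.
  have /continuous_nrP/(_ _ hh0)[h3 h30 h3P] := isd_continuous (frame_isd eps ap z0).
  have [h4 [M4 [h40 h4P]]] := rescaled_exp eps ap pp rho0 rhoc z0 hh0.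
  have ac : {for p0, continuous a} by case: ap => _ ?; exact: chart_fun_cont.
  have R20 : 0 < R0 / 2 by rewrite divr_gt0.
  have [M5 _ M5P] := pp _ (ac _ (nr_ball_nbhs (a p0) R20)).
  have Q0 : 0 < nr w0 + h by rewrite ltr_wpDl ?nr_ge0.
  have D0 : 0 < R0 / 2 / (nr w0 + h) by rewrite divr_gt0.
  have /cvgrPdist_lt/(_ _ D0)[M6 _ M6P] := rhoc.
  exists (Num.min h3 h4), (maxn M0 (maxn M1 (maxn M4 (maxn M5 M6)))).
  split; first by rewrite lt_min h30.
  move=> z j; rewrite lt_min => /andP[z3 z4].
  rewrite !geq_max => /and5P[j0 j1 j4 j5 j6].
  have := h4P z j z4 j4; rewrite /= -/(psi p_ rho_ j z); set q := psi p_ rho_ j z.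
  rewrite apy// => -[aq qw].
  have r0 : 0 < rho_ j := rho0 j.
  pose w := (rho_ j)%:C^-1 *: (a q - y_ j).
  have rC : (rho_ j)%:C != 0 :> C by rewrite fmorph_eq0 gt_eqF.
  have wE : (rho_ j)%:C *: w = a q - y_ j by rewrite scalerA divff// scale1r.
  have wf : nr (w - frame eps p0 a z) <= h / 2.
    move: qw; rewrite -wE -scalerBr nrZ nr_real gtr0_norm// mulrC.
    by rewrite ler_pM2r.
  have ff := h3P z z3.
  have ww : nr (w - w0) < h.
    rewrite [ltRHS]splitr; exact: le_lt_trans (nr_tri (frame eps p0 a z) _ _) (ler_ltD wf ff).
  have fw : nr (frame eps p0 a z - w0) < h.
    by apply: lt_trans ff _; rewrite ltr_pdivrMr// ltr_pMr// ltr1n.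
  have aqE : a q = y_ j + (rho_ j)%:C *: w by rewrite wE addrC subrK.
  have aqR : nr (a q - a p0) < R0.
    have := M5P j j5; rewrite /= apy// => yR.
    have := M6P j j6; rewrite /= sub0r normrN gtr0_norm// ltr_pdivlMr// => rR.
    have wQ : nr w < nr w0 + h.
      by rewrite (le_lt_trans (nr_subD w w0))// [X in X < _]addrC ltrD2l.
    have wR : rho_ j * nr w < R0 / 2 by apply: lt_trans rR; rewrite ltr_pM2l.
    rewrite [ltRHS]splitr (le_lt_trans (nr_tri (y_ j) _ _))// -wE nrZ nr_real.
    by rewrite gtr0_norm// ltrD.
  split; first by have [_ _] := RP _ aqR; rewrite chart_funK.
  have := h1P w j (lt_le_trans ww hh1) j1; rewrite -aqE chart_funK// => H1.
  have H2 := h2P w (lt_le_trans ww hh2); rewrite (distC dP) in H2.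
  have H3 := h2P (frame eps p0 a z) (lt_le_trans fw hh2).
  have T1 := dist_tri dP (Phi w) (f_ j q) (Phi (frame eps p0 a z)).
  have T2 := dist_tri dP (Phi w0) (Phi w) (Phi (frame eps p0 a z)).
  by clear -H1 H2 H3 T1 T2; lra.
move=> K Kc.
have unif (e : R) : 0 < e -> exists M, forall j z, (M <= j)%N -> K z ->
    Omega (psi p_ rho_ j z) /\ d (f_ j (psi p_ rho_ j z)) (Phi (frame eps p0 a z)) < e.
  move=> e0; have /compact_near_coveringP := Kc.
  move=> /(_ _ \oo (fun j z => Omega (psi p_ rho_ j z) /\
    d (f_ j (psi p_ rho_ j z)) (Phi (frame eps p0 a z)) < e) _) [z Kz|M _ MP]; last first.
    by exists M => j z Mj Kz; exact: (MP j Mj z Kz).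
  have [h [M [h0 hP]]] := loc z e e0.
  exists ([set w | nr (w - z) < h], [set j | (M <= j)%N]) => /=.
    by split; [apply/nbhs_nrP; exists h|exists M].
  by move=> [w j] /= [wz Mj]; exact: hP.
split.
  by have [M MP] := unif 1 ltr01; exists M => // j Mj z Kz; have [] := MP j z Mj Kz.
by move=> e /unif[M MP]; exists M => // j Mj z Kz; have [] := MP j z Mj Kz.
Qed.

(** By [normal_of_small_osc], the members of [F] written in a chart have large
    oscillation at arbitrarily small scales near [p0], so that [zalcman] applies. *)
Lemma exists_rescaling : ~ normal_at Omega F p0 ->
  exists (f_ : nat -> G -> N) (p_ : nat -> G) (rho_ : nat -> R),
    [/\ forall j, F (f_ j),
        (forall j, Omega (p_ j)) /\ p_ @ \oo --> p0,
        (forall j, 0 < rho_ j) /\ rho_ @ \oo --> (0 : R) &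
        exists phi : E -> N,
          [/\ cvg_on_compacts d (fun j => psi p_ rho_ j @^-1` Omega)
                (fun j => f_ j \o psi p_ rho_ j) phi,
              holomorphic_on (std_atlas E) B setT phi &
              exists z w, phi z <> phi w]].
Proof.
move=> nn; pose a := pref_chart A p0.
have ap : chart_at A p0 a := pref_chartP A p0.
have [R0 R00 RP] := chart_ball ap Omega_open Omega_p0.
have [delta delta0 schwarzP] := schwarz (m := m) B Nc dP.
pose Fa : set (E -> N) := [set (fun z => f (chart_inv a z)) | f in F].
have nosc (r : R) : 0 < r -> exists f x,
    [/\ Fa f, nr (x - a p0) < r & ~ small_osc d delta f x r].
  move=> r0; apply: contrapT => nex; apply: nn.
  have [r' [r'0 r'r r'R]] : exists r' : R, [/\ 0 < r', r' <= r & r' + r' <= R0].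
    exists (Num.min r (R0 / 2)); split; first by rewrite lt_min r0 divr_gt0.
      by rewrite ge_min lexx.
    have : Num.min r (R0 / 2) <= R0 / 2 by rewrite ge_min lexx orbT.
    lra.
  apply: (normal_of_small_osc Nc dP schwarzP Fh ap RP r'0 r'R) => f x Ff xr y yr.
  apply: contrapT => nd; apply: nex; exists (fun z => f (chart_inv a z)), x; split.
  - by exists f.
  - exact: lt_le_trans r'r.
  - by move=> /(_ y (lt_le_trans yr r'r)).
have Fah f : Fa f -> forall x, nr (x - a p0) < R0 -> cdiff_at (std_atlas E) B f x.
  move=> [g Fg <-] x /RP[h1 h2 h3].
  by apply: (@holomorphic_in_chart R m n G N A B g Omega) => //; [exact: Fh|case: ap].
have [g_ [y_ [rho_ [Phi [Fg yr rho0 luc [Phih [w1 [w2 w12]]]]]]]] :=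
  zalcman Nc dP delta0 schwarzP R00 Fah nosc.
have Fg' j : exists f, F f /\ (fun z => f (chart_inv a z)) = g_ j.
  by have [f Ff fu] := Fg j; exists f.
have [f_ f_P] := choice Fg'.
pose p_ j := if nr (y_ j - a p0) < R0 then chart_inv a (y_ j) else p0.
have rhoc : rho_ @ \oo --> (0 : R).
  apply/cvgrPdist_lt => e e0; have [M MP] := yr e e0; exists M => // j /= Mj.
  by rewrite sub0r normrN gtr0_norm//; have [] := MP j Mj.
have [M MP] := yr R0 R00.
have pp : p_ @ \oo --> p0.
  move=> V Vp; have [_ adom] := ap.
  have /nbhs_nrP[r r0 rP] := chart_inv_near adom Vp.
  have [M1 M1P] := yr r r0; exists (maxn M M1) => // j; rewrite /= geq_max => /andP[j0 j1].
  have [yR _] := MP j j0; have [yr' _] := M1P j j1.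
  by rewrite /p_ yR; exact: rP.
exists f_, p_, rho_; split.
- by move=> j; have [] := f_P j.
- by split=> // j; rewrite /p_; case: ifP => // /RP[].
- by split.
exists (Phi \o frame eps p0 a); split.
- apply: (rescaling_through_exp ap R00 RP pp rho0 rhoc (y_ := y_)).
  + by exists M => j Mj; have [yR _] := MP j Mj; rewrite /p_ yR; have [] := RP _ yR.
  + by move=> z; have [] := Phih z.
  + move=> z0 e e0; have [h [M1 [h0 hP]]] := luc z0 e e0; exists h, M1; split=> // z j zh Mj.
    have := hP z j zh Mj; have [_ <-] := f_P j; exact.
- move=> z _; have [Phic Phid] := (std_cdiffP _ _ _).1 (Phih (frame eps p0 a z)).
  apply/std_cdiffP; split.
    exact: (@continuous_comp _ _ _ (frame eps p0 a) Phi z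
      (isd_continuous (frame_isd eps ap z)) Phic).
  move=> b bz; have [H _] := isd_comp (frame_isd eps ap z) (isd_diff (Phid b bz)).
  exact: H.
- have [z1 z1E] := frame_surjective epsP ap w1; have [z2 z2E] := frame_surjective epsP ap w2.
  by exists z1, z2; rewrite /= z1E z2E.
Qed.

End RescalingCriterion.

Theorem corollary1p2 (R : realType) (m n : nat) (G : complexLieGroup R m)
    (Omega : set G) (eps : 'I_m -> tangent (lie_struct G) 1%g)
    (N : hermitianManifold R n) (d : N -> N -> R) (F : set (G -> N)) (p0 : G) :
  is_domain Omega ->
  is_basis eps ->
  compact [set: N] ->
  is_distance d ->
  (forall f, F f -> holomorphic_on (lie_struct G) (hm_struct N) Omega f) ->
  Omega p0 ->
  ~ normal_at Omega F p0 <->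
  exists (f_ : nat -> G -> N) (p_ : nat -> G) (rho_ : nat -> R),
    [/\ forall j, F (f_ j),
        (forall j, Omega (p_ j)) /\ p_ @ \oo --> p0,
        (forall j, 0 < rho_ j) /\ rho_ @ \oo --> (0 : R) &
        let psi_ (j : nat) (z : 'rV[cplx R]_m) : G :=
          lie_exp ((rho_ j)%:C *: dL_e (p_ j) (\sum_(k < m) z 0 k *: eps k)) in
        exists phi : 'rV[cplx R]_m -> N,
          [/\ cvg_on_compacts d (fun j => psi_ j @^-1` Omega)
                (fun j => f_ j \o psi_ j) phi,
              holomorphic_on (std_atlas 'rV[cplx R]_m) (hm_struct N) setT phi &
              exists z w, phi z <> phi w]].
Proof.
move=> [_ oO _] epsP Nc dP Fh Op; split.
  exact: exists_rescaling.
move=> [f_ [p_ [rho_ [Ff [_ pp] [rho0 rhoc] [phi [cvg _ [z [w zw]]]]]]]] nF.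
have [q0 q0P] := normal_limit_constant Nc dP Fh nF Ff pp rho0 rhoc cvg.
by apply: zw; rewrite !q0P.
Qed.
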